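(* Let $n\ge 5$ and $p>\frac{2n}{n+4}$ (with $p\le\infty$). Then the estimate $$\|P_0u\|_{L^2(\mathbb{R}^n)}^2\lesssim\|P_0f\|_{L^p(\mathbb{R}^n)}^2$$ fails; that is, there is no finite constant $C$ such that $\|P_0u\|_{L^2(\mathbb{R}^n)}^2\le C\,\|P_0f\|_{L^p(\mathbb{R}^n)}^2$ for all $f\in L^1(\mathbb{R}^n)\cap L^p(\mathbb{R}^n)$ whose Fourier transform $\hat f$ vanishes on the cone $\{(\xi,\tau)\in\mathbb{R}^{n-1}\times\mathbb{R}:|\xi|^2=\tau^2\}$, where $P_0f$ and $P_0u$ are defined by $$\widehat{P_0f}=\chi\hat f,\qquad \widehat{P_0u}(\xi,\tau)=\frac{\hat f(\xi,\tau)}{|\xi|^2-\tau^2}\,\chi(\xi,\tau).$$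
   Context: The Fourier transform on $\mathbb{R}^n=\mathbb{R}^{n-1}\times\mathbb{R}$ is $\hat f(\xi,\tau)=\int_{\mathbb{R}^n}f(x,t)e^{-2\pi i(x\cdot\xi+t\tau)}\,dx\,dt$. The function $\chi$ is a fixed radial Schwartz function on $\mathbb{R}^n$ supported on $A=\{z\in\mathbb{R}^n:1/3\le|z|\le1\}$ and satisfying $\sum_{j\in\mathbb{Z}}|\chi(2^{-j}\xi,2^{-j}\tau)|^2=1$ for all $(\xi,\tau)\in\mathbb{R}^n\setminus\{0\}$. The quantity $\|P_0u\|_{L^2}$ is the $L^2$ norm of the measurable function $\widehat{P_0u}$ (Plancherel), taken to be $+\infty$ if that function is not in $L^2$. *)

(* Defs.v *)
From HB Require Import structures.
From mathcomp Require Import all_boot all_order all_algebra.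
From mathcomp.real_closed Require Import complex.
From mathcomp Require Import all_classical all_reals all_analysis.

Set Implicit Arguments.
Unset Strict Implicit.
Unset Printing Implicit Defensive.

Import Order.TTheory GRing.Theory Num.Theory.
Import numFieldNormedType.Exports.

Local Open Scope classical_set_scope.
Local Open Scope ring_scope.

(* 'rV[T]_m carries the sigma-algebra generated by the coordinates (the Borel
   sigma-algebra when T = R), as n.-tuple T does in measurable_structure.v. *)
Definition measure_rV_display : measure_display -> measure_display.
Proof. exact. Qed.

Section measurable_rV.
Context {d} {T : sigmaRingType d}.
Variable m : nat.

Let coors : 'I_m -> 'rV[T]_m -> T := fun i x => x ord0 i.

HB.instance Definition _ := @isMeasurable.Build (measure_rV_display d)
  'rV[T]_m (g_sigma_preimage coors) (@sigma_algebra0 _ _ _)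
  (@sigma_algebraC _ _) (@sigma_algebra_bigcup _ _ _).

End measurable_rV.

Lemma measurable_rV_coord d (T : sigmaRingType d) m (i : 'I_m) :
  measurable_fun [set: 'rV[T]_m] (fun x : 'rV[T]_m => x ord0 i).
Proof.
move=> _ Y mY; rewrite setTI; apply: sub_sigma_algebra => /=.
rewrite -bigcup_seq/=; exists i => /=; first by rewrite mem_index_enum.
by exists Y => //; rewrite setTI.
Qed.

Lemma measurable_fun_rV d1 d2 (T1 : measurableType d1) (T2 : measurableType d2)
    m (f : T1 -> 'rV[T2]_m) :
  (forall i, measurable_fun [set: T1] (fun x => f x ord0 i)) ->
  measurable_fun [set: T1] f.
Proof.
move=> mf _ A mA; rewrite setTI.
suff : @measurable _ 'rV[T2]_m `<=` [set B | measurable (f @^-1` B)] by exact.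
apply: smallest_sub.
  split; first by rewrite /= preimage_set0.
  - by move=> B /= mB; rewrite setTD preimage_setC; exact: measurableC.
  - by move=> F mF; rewrite /= preimage_bigcup; exact: bigcupT_measurable.
move=> B; rewrite -bigcup_seq => -[i _ [C mC <-]] /=.
by rewrite setTI; have := mf i measurableT _ mC; rewrite setTI.
Qed.

(* R^(d+1) = R^d * R: a point z is the pair (space z, time z). *)
Section space_time.
Variable T : Type.

Definition space d (z : 'rV[T]_d.+1) : 'rV[T]_d :=
  \row_i z ord0 (lift ord_max i).

Definition time d (z : 'rV[T]_d.+1) : T := z ord0 ord_max.

Definition spacetime d (p : 'rV[T]_d * T) : 'rV[T]_d.+1 :=
  \row_i if unlift ord_max i is Some j then p.1 ord0 j else p.2.

Lemma spacetimeK d : cancel (@spacetime d) (fun z => (space z, time z)).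
Proof.
move=> [x t]; congr pair; last by rewrite /time mxE unlift_none.
by apply/rowP => i; rewrite !mxE liftK.
Qed.

Lemma space_timeK d : cancel (fun z => (space z, time z)) (@spacetime d).
Proof.
move=> z; apply/rowP => i; rewrite mxE.
by case: unliftP => [j ->|->] //=; rewrite mxE.
Qed.

End space_time.

Section lebesgue_rV.
Variable R : realType.

Lemma measurable_spacetime d :
  measurable_fun [set: 'rV[R]_d * R] (@spacetime R d).
Proof.
apply: measurable_fun_rV => i.
rewrite [X in measurable_fun _ X](_ : _ = fun p : 'rV[R]_d * R =>
  if unlift ord_max i is Some j then p.1 ord0 j else p.2); last first.
  by apply/funext => p; rewrite mxE.
case: (unlift ord_max i) => [j|]; last exact: measurable_snd.
exact: (measurableT_comp (measurable_rV_coord j) measurable_fst).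
Qed.

Lemma measurable_space d : measurable_fun [set: 'rV[R]_d.+1] (@space R d).
Proof.
apply: measurable_fun_rV => i.
rewrite [X in measurable_fun _ X](_ : _ = fun z : 'rV[R]_d.+1 =>
  z ord0 (lift ord_max i)); first exact: measurable_rV_coord.
by apply/funext => z; rewrite mxE.
Qed.

Lemma measurable_time d : measurable_fun [set: 'rV[R]_d.+1] (@time R d).
Proof. exact: measurable_rV_coord. Qed.

Section step.
Variables (d : nat) (mu : {sigma_finite_measure set 'rV[R]_d -> \bar R}).

Definition lebesgue_step : set 'rV[R]_d.+1 -> \bar R :=
  pushforward (mu \x @lebesgue_measure R)%E (@spacetime R d).

HB.instance Definition _ := Measure.copy lebesgue_step
  (measure_function_pushforward__canonical__measure_function_Measure
    (mu \x @lebesgue_measure R)%E (@measurable_spacetime d)).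

Lemma sigma_finite_lebesgue_step : sigma_finite setT lebesgue_step.
Proof.
have /sigma_finiteP[F [FT ndF Foo]] := sigma_finiteT mu.
have /sigma_finiteP[G [GT ndG Goo]] := sigma_finiteT (@lebesgue_measure R).
pose H k := @space R d @^-1` F k `&` @time R d @^-1` G k.
exists H.
  rewrite predeqE => z; split => // _.
  have [i _ Fi] : (\bigcup_i F i) (space z) by rewrite -FT.
  have [j _ Gj] : (\bigcup_i G i) (time z) by rewrite -GT.
  exists (maxn i j) => //; split => /=.
  - by move: Fi; exact/subsetPset/ndF/leq_maxl.
  - by move: Gj; exact/subsetPset/ndG/leq_maxr.
move=> k; have [mF Fk] := Foo k; have [mG Gk] := Goo k; split.
  apply: measurableI; rewrite -[X in measurable X]setTI.
  - exact: measurable_space.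
  - exact: measurable_time.
rewrite /lebesgue_step /pushforward /=.
rewrite (_ : _ @^-1` _ = F k `*` G k); last first.
  apply/funext => -[x t].
  by rewrite /H /preimage /=; have [-> ->] := spacetimeK (x, t).
by rewrite product_measure1E// lte_mul_pinfty// ge0_fin_numE.
Qed.

HB.instance Definition _ := Measure_isSigmaFinite.Build _ _ _
  lebesgue_step sigma_finite_lebesgue_step.

End step.

Fixpoint lebesgue_rV d : {sigma_finite_measure set 'rV[R]_d -> \bar R} :=
  match d return {sigma_finite_measure set 'rV[R]_d -> \bar R} with
  | 0 => \d_(0 : 'rV[R]_0)
  | k.+1 => lebesgue_step (lebesgue_rV k)
  end.

End lebesgue_rV.

Section euclidean.
Variables (R : realType) (n : nat).
Implicit Types z w : 'rV[R]_n.

Definition dotmul z w : R := \sum_i z ord0 i * w ord0 i.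

(* The library norm `|z| on 'rV[R]_n is the sup norm. *)
Definition enorm z : R := Num.sqrt (dotmul z z).

End euclidean.

Section complex_valued.
Variable R : realType.

Definition cabs (c : R[i]) : R := Normc.normc c.

Definition expi (theta : R) : R[i] := (cos theta +i* sin theta)%C.

Section measure.
Context d (T : measurableType d) (mu : {measure set T -> \bar R}).

Definition Cmeasurable (f : T -> R[i]) :=
  measurable_fun setT (fun x => complex.Re (f x)) /\
  measurable_fun setT (fun x => complex.Im (f x)).

Definition Cintegral (f : T -> R[i]) : R[i] :=
  ((\int[mu]_x complex.Re (f x)) +i* (\int[mu]_x complex.Im (f x)))%C.

Definition CLnorm (p : \bar R) (f : T -> R[i]) : \bar R :=
  Lnorm mu p (fun x => (cabs (f x))%:E).

Definition CLfun (p : \bar R) (f : T -> R[i]) :=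
  Cmeasurable f /\ (CLnorm p f < +oo)%E.

End measure.
End complex_valued.

Section fourier.
Variables (R : realType) (n : nat).
Implicit Types (f g : 'rV[R]_n -> R[i]) (z w : 'rV[R]_n).

Definition fourier f w : R[i] :=
  Cintegral (lebesgue_rV R n) (fun z => f z * expi (- (2 * pi * dotmul z w))).

Definition inv_fourier g z : R[i] :=
  Cintegral (lebesgue_rV R n) (fun w => g w * expi (2 * pi * dotmul z w)).

Definition iter_partial (s : seq 'I_n) (g : 'rV[R]_n -> R) : 'rV[R]_n -> R :=
  foldr (fun i h => 'D_(delta_mx ord0 i) h) g s.

Definition schwartz_real (g : 'rV[R]_n -> R) :=
  (forall s z, differentiable (iter_partial s g) z) /\
  (forall (alpha : 'I_n -> nat) s, exists M : R, forall z,
     `|(\prod_i z ord0 i ^+ alpha i) * iter_partial s g z| <= M).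

Definition schwartz f :=
  schwartz_real (fun z => complex.Re (f z)) /\
  schwartz_real (fun z => complex.Im (f z)).

Definition radial f := forall z w, enorm z = enorm w -> f z = f w.

End fourier.

Section multipliers.
Variables (R : realType) (d : nat).
Implicit Types (f chi : 'rV[R]_d.+1 -> R[i]) (w : 'rV[R]_d.+1).

(* |xi|^2 - tau^2 at w = (xi, tau). *)
Definition wave_symbol w : R := enorm (space w) ^+ 2 - time w ^+ 2.

Definition cone : set 'rV[R]_d.+1 :=
  [set w | enorm (space w) ^+ 2 = time w ^+ 2].

(* For f in L^1, chi * fourier f is bounded and supported where chi is, so the
   inversion integral converges absolutely. *)
Definition P0f chi f : 'rV[R]_d.+1 -> R[i] :=
  inv_fourier (fun w => chi w * fourier f w).

(* The Fourier transform of P_0 u.  On the cone, a null set, the quotient is 0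
   because the library's inverse of 0 is 0. *)
Definition P0u_hat chi f w : R[i] :=
  fourier f w / (wave_symbol w)%:C%C * chi w.

End multipliers.

(* Main.v *)
Require Import Defs.
From mathcomp Require Import all_boot all_order all_algebra.
From mathcomp.real_closed Require Import complex.
From mathcomp Require Import all_classical all_reals all_analysis.
From mathcomp Require Import measurable_realfun ess_sup_inf ring lra.

(* A Knapp example at the cone. Let [g] be a wave packet whose Fourier transform
   is spread over a box of size eps^2 x eps^(n-2) x 1 (across the cone, along the
   sphere, along a light ray) around a point of the cone where [chi] does not
   vanish; in physical space it lives on the dual box, of volume eps^(-n). Let [f]
   be the wave operator applied to [g], so that f^ = (|xi|^2 - tau^2) g^ up to a
   constant: f^ vanishes on the cone, and u^ = g^ chi. The symbol has size eps^2
   on the box, so |f| <= C eps^2 W with an explicit majorant W <= 1 of integral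
   C eps^(-n). Since [chi] is Schwartz, P_0 is convolution with a rapidly
   decreasing kernel, which preserves such slowly varying majorants, and
   ||P_0 f||_p <= C eps^(2 - n/p). On the other hand ||P_0 u||_2^2 >= c eps^(-n),
   as g^ is of size eps^(-n) on a box of volume eps^n on which [chi] is bounded
   below. The estimate would force eps^(-n) <= C eps^(4 - 2n/p) as eps tends to 0,
   which is false for p > 2n/(n+4). *)

Set Implicit Arguments.
Unset Strict Implicit.
Unset Printing Implicit Defensive.

Import Order.TTheory GRing.Theory Num.Theory.
Import numFieldNormedType.Exports.
Local Open Scope classical_set_scope.
Local Open Scope ring_scope.

(** * Complex-valued integration *)

Section complex_modulus.
Variable R : realType.
Implicit Types c : R[i].

(** The shear (s, t) -> (s, s + t), where s is the spatial coordinate paired with time, separates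
    the three scales. With u = sigma - tau dual to s and tau dual to s + t, the symbol is |xi'|^2 +
    u^2 + 2 u tau, so the wave operator maps a product in these variables to a sum of products, each
    of which gains eps^2 or better. The profile is rational, neither Gaussian nor compactly
    supported: what matters is that its mean is not 0 and that it and two derivatives are dominated
    by (1 + x^2)^-1. No L^p theory of multipliers enters. Since 0 <= W <= 1 and p >= 1, W^p <= W, so
    a pointwise bound by a multiple of W and the integral of W yield every L^p norm, p = oo
    included. P_0 keeps such a bound, with a constant independent of eps, because W varies slowly at
    unit scale (Peetre's inequality). The lower bound reads the L^2 norm on the Fourier side, on a
    part of the box where u > 0; this part lies off the cone, and there the symbol cancels
    exactly. *)

Lemma cabs_ge0 c : 0 <= cabs c.
Proof. by case: c => a b; rewrite /cabs /= sqrtr_ge0. Qed.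

Lemma cabsM c1 c2 : cabs (c1 * c2) = cabs c1 * cabs c2.
Proof. exact: Normc.normcM. Qed.

Lemma cabsV c : cabs c^-1 = (cabs c)^-1.
Proof. exact: Normc.normcV. Qed.

Lemma cabs1 : cabs (1 : R[i]) = 1.
Proof. exact: Normc.normc1. Qed.

Lemma cabsD c1 c2 : cabs (c1 + c2) <= cabs c1 + cabs c2.
Proof. exact: le_normcD. Qed.

Lemma cabs_real (r : R) : cabs (r%:C)%C = `|r|.
Proof. by rewrite /cabs /= expr0n addr0 sqrtr_sqr. Qed.

Lemma cabs_prod (I : Type) (r : seq I) (P : pred I) (F : I -> R[i]) :
  cabs (\prod_(i <- r | P i) F i) = \prod_(i <- r | P i) cabs (F i).
Proof. exact: (big_morph _ cabsM cabs1). Qed.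

Lemma Re_le_cabs c : `|complex.Re c| <= cabs c.
Proof.
case: c => a b /=; rewrite /cabs /= -[leLHS]sqrtr_sqr ler_wsqrtr//.
by rewrite lerDl sqr_ge0.
Qed.

Lemma Im_le_cabs c : `|complex.Im c| <= cabs c.
Proof.
case: c => a b /=; rewrite /cabs /= -[leLHS]sqrtr_sqr ler_wsqrtr//.
by rewrite lerDr sqr_ge0.
Qed.

Lemma cabs_le_ReIm c : cabs c <= `|complex.Re c| + `|complex.Im c|.
Proof.
case: c => a b /=; rewrite /cabs /= -[leRHS]ger0_norm ?addr_ge0//.
rewrite -[leRHS]sqrtr_sqr ler_wsqrtr// sqrrD !real_normK ?num_real//.
by rewrite lerD2r lerDl mulrn_wge0// mulr_ge0.
Qed.

Lemma cabs_expi (t : R) : cabs (expi t) = 1.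
Proof. by rewrite /cabs /= cos2Dsin2 sqrtr1. Qed.

Lemma expiD (s t : R) : expi (s + t) = expi s * expi t.
Proof.
rewrite /expi cosD sinD; apply/eqP; rewrite eq_complex /=; apply/andP; split => //.
by rewrite addrC.
Qed.

Lemma expi0 : expi 0 = 1 :> R[i].
Proof. by rewrite /expi cos0 sin0. Qed.

Lemma expi_sum (I : Type) (r : seq I) (F : I -> R) :
  expi (\sum_(i <- r) F i) = \prod_(i <- r) expi (F i).
Proof. exact: (big_morph _ expiD expi0). Qed.

Lemma ReM c1 c2 : complex.Re (c1 * c2) =
  complex.Re c1 * complex.Re c2 - complex.Im c1 * complex.Im c2.
Proof. by case: c1 c2 => ? ? [? ?]. Qed.

Lemma ImM c1 c2 : complex.Im (c1 * c2) =
  complex.Re c1 * complex.Im c2 + complex.Im c1 * complex.Re c2.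
Proof. by case: c1 c2 => ? ? [? ?]. Qed.

Lemma ReD c1 c2 : complex.Re (c1 + c2) = complex.Re c1 + complex.Re c2.
Proof. by case: c1 c2 => ? ? [? ?]. Qed.

Lemma ImD c1 c2 : complex.Im (c1 + c2) = complex.Im c1 + complex.Im c2.
Proof. by case: c1 c2 => ? ? [? ?]. Qed.

Lemma complex_eqP c1 c2 :
  complex.Re c1 = complex.Re c2 -> complex.Im c1 = complex.Im c2 -> c1 = c2.
Proof. by case: c1 c2 => ? ? [? ?] /= -> ->. Qed.

End complex_modulus.

Section Cmeasurable_theory.
Context d (T : measurableType d) (R : realType).
Implicit Types f g : T -> R[i].

Lemma Cmeasurable_cst (c : R[i]) : Cmeasurable (fun _ : T => c).
Proof. by split; exact: measurable_cst. Qed.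

Lemma CmeasurableM f g : Cmeasurable f -> Cmeasurable g ->
  Cmeasurable (fun x => f x * g x).
Proof.
move=> [f1 f2] [g1 g2]; split.
- under eq_fun do rewrite ReM.
  by apply: measurable_funB; exact: measurable_funM.
- under eq_fun do rewrite ImM.
  by apply: measurable_funD; exact: measurable_funM.
Qed.

Lemma CmeasurableD f g : Cmeasurable f -> Cmeasurable g ->
  Cmeasurable (fun x => f x + g x).
Proof.
move=> [f1 f2] [g1 g2]; split.
- by under eq_fun do rewrite ReD; exact: measurable_funD.
- by under eq_fun do rewrite ImD; exact: measurable_funD.
Qed.

Lemma Cmeasurable_real (h : T -> R) : measurable_fun setT h ->
  Cmeasurable (fun x => (h x)%:C%C).
Proof. by move=> mh; split => //=; exact: measurable_cst. Qed.

Lemma Cmeasurable_expi (h : T -> R) : measurable_fun setT h ->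
  Cmeasurable (fun x => expi (h x)).
Proof.
move=> mh; split => /=; apply: measurableT_comp => //.
- by apply: continuous_measurable_fun; exact: continuous_cos.
- by apply: continuous_measurable_fun; exact: continuous_sin.
Qed.

Lemma Cmeasurable_prod (I : Type) (r : seq I) (F : I -> T -> R[i]) :
  (forall i, Cmeasurable (F i)) -> Cmeasurable (fun x => \prod_(i <- r) F i x).
Proof.
move=> mF; elim: r => [|i r IH].
  by under eq_fun do rewrite big_nil; exact: Cmeasurable_cst.
by under eq_fun do rewrite big_cons; exact: CmeasurableM.
Qed.

Lemma measurable_cabs f : Cmeasurable f -> measurable_fun setT (fun x => cabs (f x)).
Proof.
move=> [f1 f2]; rewrite (_ : (fun x => _) = fun x =>
    Num.sqrt (complex.Re (f x) ^+ 2 + complex.Im (f x) ^+ 2)).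
  have msqrt : measurable_fun setT (@Num.sqrt R).
    by apply: continuous_measurable_fun; exact: sqrt_continuous.
  apply: (measurableT_comp msqrt).
  by apply: measurable_funD; exact: measurable_funX.
by apply/funext => x; rewrite /cabs; case: (f x).
Qed.

Lemma Cmeasurable_comp d' (T' : measurableType d') (h : T' -> T) f :
  Cmeasurable f -> measurable_fun setT h -> Cmeasurable (f \o h).
Proof. by move=> [f1 f2] mh; split; [exact: (measurableT_comp f1 mh)|exact: (measurableT_comp f2 mh)]. Qed.

End Cmeasurable_theory.

Section Cintegral_theory.
Context d (T : measurableType d) (R : realType) (mu : {measure set T -> \bar R}).
Implicit Types (f g : T -> R[i]) (b : T -> R).

Definition Cintegrable f :=
  mu.-integrable setT (EFin \o (fun x => complex.Re (f x))) /\
  mu.-integrable setT (EFin \o (fun x => complex.Im (f x))).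

Lemma Cintegrable_measurable f : Cintegrable f -> Cmeasurable f.
Proof.
by move=> [/measurable_int f1 /measurable_int f2]; split; exact/measurable_EFinP.
Qed.

Lemma le_integrable_real b (h : T -> R) : measurable_fun setT h ->
  mu.-integrable setT (EFin \o b) -> (forall x, `|h x| <= b x) ->
  mu.-integrable setT (EFin \o h).
Proof.
move=> mh ib hb; apply: (le_integrable _ _ _ ib) => //.
- exact/measurable_EFinP.
- by move=> x _ /=; rewrite lee_fin (le_trans (hb x))// ler_norm.
Qed.

Lemma Cintegrable_le b f : Cmeasurable f -> mu.-integrable setT (EFin \o b) ->
  (forall x, cabs (f x) <= b x) -> Cintegrable f.
Proof.
move=> [f1 f2] ib fb; split; apply: (le_integrable_real _ ib) => // x.
- exact: le_trans (Re_le_cabs _) (fb x).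
- exact: le_trans (Im_le_cabs _) (fb x).
Qed.

Lemma integrable_cabs f : Cintegrable f ->
  mu.-integrable setT (EFin \o (fun x => cabs (f x))).
Proof.
move=> [f1 f2]; apply: (@le_integrable_real
    (fun x => `|complex.Re (f x)| + `|complex.Im (f x)|)).
- exact/measurable_cabs/Cintegrable_measurable.
- have := integrableD measurableT (integrable_norm f1) (integrable_norm f2).
  by apply: eq_integrable.
- by move=> x; rewrite ger0_norm ?cabs_ge0// cabs_le_ReIm.
Qed.

(** Real and imaginary parts are bounded separately, hence the factor 2 in place of the sharp
    constant 1; only the finiteness of constants matters later. *)
Lemma cabs_Cintegral_le b f : Cmeasurable f -> mu.-integrable setT (EFin \o b) ->
  (forall x, cabs (f x) <= b x) ->
  cabs (Cintegral mu f) <= 2 * (\int[mu]_x b x).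
Proof.
move=> mf ib fb; have [f1 f2] := Cintegrable_le mf ib fb.
rewrite (le_trans (cabs_le_ReIm _))//= mulrDl mul1r.
apply: lerD; (apply: le_trans (le_normr_Rintegral measurableT _) _ => //);
  apply: le_Rintegral => //; do ?exact: integrable_norm.
- by move=> x _; exact: le_trans (Re_le_cabs _) (fb x).
- by move=> x _; exact: le_trans (Im_le_cabs _) (fb x).
Qed.

Lemma eq_Cintegral f g : f =1 g -> Cintegral mu f = Cintegral mu g.
Proof. by move=> /funext ->. Qed.

Lemma CintegrableZl (c : R[i]) f : Cintegrable f -> Cintegrable (fun x => c * f x).
Proof.
move=> If; apply: (@Cintegrable_le (fun x => cabs c * cabs (f x))).
- by apply: CmeasurableM (Cintegrable_measurable If); exact: Cmeasurable_cst.
- have := integrableZl measurableT (cabs c) (integrable_cabs If).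
  by apply: eq_integrable.
- by move=> x; rewrite cabsM.
Qed.

Lemma CintegralZl (c : R[i]) f : Cintegrable f ->
  Cintegral mu (fun x => c * f x) = c * Cintegral mu f.
Proof.
move=> [f1 f2].
have Z (h : T -> R) (k : R) : mu.-integrable setT (EFin \o h) ->
    mu.-integrable setT (EFin \o (fun x => k * h x)).
  by move=> ih; have := integrableZl measurableT k ih; apply: eq_integrable.
apply: complex_eqP; rewrite ?ReM ?ImM /=.
- under eq_Rintegral do rewrite ReM.
  by rewrite RintegralB ?RintegralZl//; exact: Z.
- under eq_Rintegral do rewrite ImM.
  by rewrite RintegralD ?RintegralZl//; exact: Z.
Qed.

Lemma CintegrableD f g : Cintegrable f -> Cintegrable g ->
  Cintegrable (fun x => f x + g x).
Proof.
move=> [f1 f2] [g1 g2]; split.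
- have := integrableD measurableT f1 g1; apply: eq_integrable => //= x _ /=.
  by rewrite ReD.
- have := integrableD measurableT f2 g2; apply: eq_integrable => //= x _ /=.
  by rewrite ImD.
Qed.

Lemma CintegralD f g : Cintegrable f -> Cintegrable g ->
  Cintegral mu (fun x => f x + g x) = Cintegral mu f + Cintegral mu g.
Proof.
move=> [f1 f2] [g1 g2]; apply: complex_eqP; rewrite ?ReD ?ImD /=.
- by under eq_Rintegral do rewrite ReD; rewrite RintegralD.
- by under eq_Rintegral do rewrite ImD; rewrite RintegralD.
Qed.

Lemma Cintegral0 : Cintegral mu (fun _ : T => 0) = 0 :> R[i].
Proof. by rewrite /Cintegral /Rintegral /= integral0. Qed.

Lemma Cintegrable0 : Cintegrable (fun _ : T => 0).
Proof. by split; exact: integrable0. Qed.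

Lemma Cintegrable_sum (I : Type) (r : seq I) (F : I -> T -> R[i]) :
  (forall i, Cintegrable (F i)) -> Cintegrable (fun x => \sum_(i <- r) F i x).
Proof.
move=> mF; elim: r => [|i r IH].
  by under eq_fun do rewrite big_nil; exact: Cintegrable0.
by under eq_fun do rewrite big_cons; exact: CintegrableD.
Qed.

Lemma Cintegral_sum (I : Type) (r : seq I) (F : I -> T -> R[i]) :
  (forall i, Cintegrable (F i)) ->
  Cintegral mu (fun x => \sum_(i <- r) F i x) = \sum_(i <- r) Cintegral mu (F i).
Proof.
move=> mF; elim: r => [|i r IH].
  by under eq_fun do rewrite big_nil; rewrite big_nil Cintegral0.
under eq_fun do rewrite big_cons.
by rewrite CintegralD ?IH ?big_cons//; exact: Cintegrable_sum.
Qed.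

End Cintegral_theory.

(** * Fubini for finite-valued integrals *)

Section fubini_real.
Context d1 d2 (T1 : measurableType d1) (T2 : measurableType d2) (R : realType).
Variables (m1 : {sigma_finite_measure set T1 -> \bar R}).
Variables (m2 : {sigma_finite_measure set T2 -> \bar R}).

(** The inner integrals are finite only almost everywhere, while the right-hand side turns them into
    reals by [fine]; the outer integrals agree because their integrands agree almost everywhere. *)
Lemma Rfubini1 (f : T1 * T2 -> R) : (m1 \x m2)%E.-integrable setT (EFin \o f) ->
  \int[(m1 \x m2)%E]_z f z = \int[m1]_x \int[m2]_y f (x, y).
Proof.
move=> fi; rewrite /Rintegral -integral12_prod_meas1//; congr fine.
apply: ae_eq_integral => //.
- exact: (measurable_fubini_F fi).
- apply/measurable_EFinP.
  exact: measurableT_comp (measurable_fubini_F fi).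
- have := ae_integrable1 fi; apply: filterS => x /= ix _.
  by rewrite fineK// /fubini_F; exact: integrable_fin_num.
Qed.

Lemma Rfubini2 (f : T1 * T2 -> R) : (m1 \x m2)%E.-integrable setT (EFin \o f) ->
  \int[(m1 \x m2)%E]_z f z = \int[m2]_y \int[m1]_x f (x, y).
Proof.
move=> fi; rewrite /Rintegral -integral21_prod_meas1//; congr fine.
apply: ae_eq_integral => //.
- exact: (measurable_fubini_G fi).
- apply/measurable_EFinP.
  exact: measurableT_comp (measurable_fubini_G fi).
- have := ae_integrable2 fi; apply: filterS => x /= ix _.
  by rewrite fineK// /fubini_G; exact: integrable_fin_num.
Qed.

Lemma Cfubini1 (f : T1 * T2 -> R[i]) : Cintegrable (m1 \x m2)%E f ->
  Cintegral (m1 \x m2)%E f = Cintegral m1 (fun x => Cintegral m2 (fun y => f (x, y))).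
Proof.
by move=> [f1 f2]; rewrite /Cintegral /= (Rfubini1 f1) (Rfubini1 f2).
Qed.

Lemma Cfubini2 (f : T1 * T2 -> R[i]) : Cintegrable (m1 \x m2)%E f ->
  Cintegral (m1 \x m2)%E f = Cintegral m2 (fun y => Cintegral m1 (fun x => f (x, y))).
Proof.
by move=> [f1 f2]; rewrite /Cintegral /= (Rfubini2 f1) (Rfubini2 f2).
Qed.

Lemma Cmeasurable_fubini2 (f : T1 * T2 -> R[i]) : Cintegrable (m1 \x m2)%E f ->
  Cmeasurable (fun y => Cintegral m1 (fun x => f (x, y))).
Proof.
move=> [f1 f2]; split.
- exact: measurableT_comp (measurable_fubini_G f1).
- exact: measurableT_comp (measurable_fubini_G f2).
Qed.

(* Covers a product of functions of [x] and of [x + y], as in the sheared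
   coordinates of the cone. *)
Lemma integrable_iterated (f : T1 * T2 -> R) (a : T1 -> R) (B : \bar R) :
  measurable_fun setT f -> m1.-integrable setT (EFin \o a) ->
  (forall x, 0 <= a x) -> (0 <= B < +oo)%E ->
  (forall x, \int[m2]_y `|f (x, y)|%:E <= (a x)%:E * B)%E ->
  (m1 \x m2)%E.-integrable setT (EFin \o f).
Proof.
move=> mf ia a0 /andP[B0 Boo] fB; apply/integrable12ltyP.
  exact/measurable_EFinP.
have ma : measurable_fun setT (EFin \o a) by exact: measurable_int ia.
apply: (@le_lt_trans _ _ (\int[m1]_x ((a x)%:E * B))%E).
  apply: ge0_le_integral => //.
  - by move=> x _; exact: integral_ge0.
  - apply: (measurable_fun_fubini_tonelli_F (abse \o (EFin \o f))) => //=.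
    by apply: measurableT_comp => //; exact/measurable_EFinP.
  - by apply: emeasurable_funM => //; exact: measurable_cst.
  - by move=> x _; exact: fB.
rewrite ge0_integralZr//; last by move=> x _; rewrite lee_fin.
rewrite lte_mul_pinfty//.
- by apply: integral_ge0 => x _; rewrite lee_fin.
- rewrite ge0_fin_numE; last by apply: integral_ge0 => x _; rewrite lee_fin.
  have /integrableP[_] := ia; congr (_ < _)%E.
  by apply: eq_integral => x _ /=; rewrite ger0_norm.
Qed.

End fubini_real.

Section iterated_complex.
Context d1 d2 (T1 : measurableType d1) (T2 : measurableType d2) (R : realType).
Variables (m1 : {sigma_finite_measure set T1 -> \bar R}).
Variables (m2 : {sigma_finite_measure set T2 -> \bar R}).

Lemma Cintegrable_iterated (F : T1 * T2 -> R[i]) (a : T1 -> R) (B : \bar R) :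
  Cmeasurable F -> m1.-integrable setT (EFin \o a) ->
  (forall x, 0 <= a x) -> (0 <= B < +oo)%E ->
  (forall x, \int[m2]_y (cabs (F (x, y)))%:E <= (a x)%:E * B)%E ->
  Cintegrable (m1 \x m2)%E F.
Proof.
move=> mF ia a0 B0 FB; apply: (@Cintegrable_le _ _ _ _ (fun z => cabs (F z))) => //.
apply: (integrable_iterated (measurable_cabs mF) ia a0 B0) => x.
apply: le_trans (FB x); rewrite le_eqVlt; apply/orP; left; apply/eqP.
by apply: eq_integral => y _; rewrite ger0_norm ?cabs_ge0.
Qed.

Lemma Cintegrable_separated (f : T1 -> R[i]) (g : T2 -> R[i]) :
  Cintegrable m1 f -> Cintegrable m2 g ->
  Cintegrable (m1 \x m2)%E (fun z => f z.1 * g z.2).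
Proof.
move=> If Ig; have mf := Cintegrable_measurable If.
have mg := Cintegrable_measurable Ig.
apply: (@Cintegrable_iterated _ (fun x => cabs (f x)) (\int[m2]_y (cabs (g y))%:E)%E).
- apply: CmeasurableM; first exact: (Cmeasurable_comp mf).
  exact: (Cmeasurable_comp mg).
- exact: integrable_cabs.
- by move=> x; exact: cabs_ge0.
- apply/andP; split; first by apply: integral_ge0 => y _; rewrite lee_fin cabs_ge0.
  have /integrableP[_] := integrable_cabs Ig; congr (_ < _)%E.
  by apply: eq_integral => y _ /=; rewrite ger0_norm ?cabs_ge0.
- move=> x /=; under eq_integral do rewrite cabsM EFinM.
  rewrite ge0_integralZl//; last 2 first.
  + by move=> y _; rewrite lee_fin cabs_ge0.
  + by rewrite lee_fin cabs_ge0.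
  + by apply/measurable_EFinP; exact: measurable_cabs.
Qed.

Lemma Cintegral_separated (f : T1 -> R[i]) (g : T2 -> R[i]) :
  Cintegrable m1 f -> Cintegrable m2 g ->
  Cintegral (m1 \x m2)%E (fun z => f z.1 * g z.2) = Cintegral m1 f * Cintegral m2 g.
Proof.
move=> If Ig; rewrite Cfubini1; last exact: Cintegrable_separated.
under eq_Cintegral do rewrite /= CintegralZl// mulrC.
by rewrite CintegralZl// mulrC.
Qed.

End iterated_complex.

(** * Lebesgue integration on the line and in space-time *)

Section lebesgue_line.
Variable R : realType.
Local Notation leb := (@lebesgue_measure R).
Implicit Types (a b : R).

Let affine a b : R -> measurableTypeR R := fun x => a * x + b.

Let measurable_affine a b : measurable_fun setT (affine a b).
Proof.
apply: measurable_funD; last exact: measurable_cst.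
by apply: measurable_funM => //; exact: measurable_cst.
Qed.

(** Both sides are measures that agree on half-open intervals, whose preimages under [affine a b]
    are again half-open intervals, with length divided by [a]; uniqueness of Lebesgue measure does
    the rest. *)
Let lebesgue_affine a b (a0 : 0 < a) (A : set R) : measurable A ->
  leb A = (a%:E * leb (affine a b @^-1` A))%E.
Proof.
move=> mA.
pose m := mscale (NngNum (ltW a0))
   (measure_function_pushforward__canonical__measure_function_Measure
    leb (measurable_affine a b)).
rewrite (@lebesgue_measure_unique _ m)// => _ [[x y]] _ <-.
rewrite /m /= /mscale /= /pushforward.
rewrite (_ : affine a b @^-1` _ = `](x - b) / a, (y - b) / a]%classic).
  rewrite !lebesgue_measure_itv /= !lte_fin ltr_pM2r ?invr_gt0// ltrD2r.
  case: ifPn => _; last by rewrite mule0.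
  rewrite -EFinD -EFinM; congr EFin; field; exact: lt0r_neq0.
apply/seteqP; split => t /=; rewrite !in_itv /= /affine.
- by rewrite ltr_pdivrMr// ler_pdivlMr// ltrBlDr lerBrDr ![t * a]mulrC.
- by rewrite ltr_pdivrMr// ler_pdivlMr// ltrBlDr lerBrDr ![t * a]mulrC.
Qed.

Lemma ge0_integral_affine a b (f : R -> \bar R) : 0 < a ->
  measurable_fun setT f -> (forall x, 0 <= f x)%E ->
  (\int[leb]_x f (a * x + b)%R = a^-1%:E * \int[leb]_x f x)%E.
Proof.
move=> a0 mf f0.
pose m := measure_function_pushforward__canonical__measure_function_Measure
    leb (measurable_affine a b).
have -> : (\int[leb]_x f x = \int[mscale (NngNum (ltW a0)) m]_x f x)%E.
  by apply: eq_measure_integral => // A mA _; exact: lebesgue_affine.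
rewrite ge0_integral_mscale// /m ge0_integral_pushforward//.
  by rewrite muleA -EFinM mulVf ?mul1e ?lt0r_neq0.
exact: measurable_affine.
Qed.

Lemma integral_affine a b (f : R -> R) : 0 < a ->
  leb.-integrable setT (EFin \o f) ->
  leb.-integrable setT (EFin \o (fun x => f (a * x + b))) /\
  \int[leb]_x f (a * x + b) = a^-1 * \int[leb]_x f x.
Proof.
move=> a0 fi; have /integrableP[mf _] := fi.
have mfa : measurable_fun setT (EFin \o (fun x => f (a * x + b))).
  exact: (measurableT_comp mf (measurable_affine a b)).
split.
  apply/integrableP; split => //.
  rewrite (ge0_integral_affine b (f := abse \o (EFin \o f)) a0)//.
  - rewrite lte_mul_pinfty ?lee_fin ?invr_ge0 ?ltW//.
    by have /integrableP[] := fi.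
  - exact: measurableT_comp.
  - by move=> x; exact: abse_ge0.
(* The nonnegative case applies to the positive and negative parts; both integrals are finite, so
   the factor comes out of their difference. *)
rewrite /Rintegral integralE.
have := ge0_integral_affine b a0 (measurable_funepos mf) (@funepos_ge0 _ _ _).
have := ge0_integral_affine b a0 (measurable_funeneg mf) (@funeneg_ge0 _ _ _).
move=> en ep; transitivity (fine (\int[leb]_x (EFin \o f)^\+ (a * x + b)%R -
  \int[leb]_x (EFin \o f)^\- (a * x + b)%R)%E).
  by congr (fine (_ - _)%E); apply: eq_integral => x _; rewrite ?funeposE ?funenegE.
rewrite en ep -muleBr//; last first.
  by rewrite fin_num_adde_defr// integrable_pos_fin_num.
by rewrite -integralE fineM//; exact: integrable_fin_num.
Qed.

Lemma Cintegrable_affine a b (f : R -> R[i]) : 0 < a ->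
  Cintegrable leb f -> Cintegrable leb (fun x => f (a * x + b)).
Proof.
move=> a0 [f1 f2]; split.
- by have [] := integral_affine b a0 f1.
- by have [] := integral_affine b a0 f2.
Qed.

Lemma Cintegral_affine a b (f : R -> R[i]) : 0 < a -> Cintegrable leb f ->
  Cintegral leb (fun x => f (a * x + b)) = (a^-1)%:C%C * Cintegral leb f.
Proof.
move=> a0 [f1 f2]; have [_ e1] := integral_affine b a0 f1.
have [_ e2] := integral_affine b a0 f2.
by rewrite /Cintegral e1 e2; apply: complex_eqP; rewrite ?ReM ?ImM /=; ring.
Qed.

Lemma integral_shift b (f : R -> \bar R) :
  measurable_fun setT f -> (forall x, 0 <= f x)%E ->
  (\int[leb]_x f (x + b)%R = \int[leb]_x f x)%E.
Proof.
move=> mf f0; have := ge0_integral_affine b ltr01 mf f0.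
by rewrite invr1 mul1e => <-; under [RHS]eq_integral do rewrite mul1r.
Qed.

(** The inverse square of the Japanese bracket. All decay is measured by this weight, which is
    integrable, at most 1, and satisfies Peetre's inequality ([japanese_peetre]). *)
Definition japanese (x : R) : R := (1 + x ^+ 2)^-1.

Lemma oneD_sqr_gt0 (x : R) : 0 < 1 + x ^+ 2.
Proof. by rewrite ltr_pwDl// sqr_ge0. Qed.

Lemma japanese_gt0 x : 0 < japanese x.
Proof. by rewrite invr_gt0 oneD_sqr_gt0. Qed.

Lemma japanese_ge0 x : 0 <= japanese x.
Proof. exact/ltW/japanese_gt0. Qed.

Lemma japanese_le1 x : japanese x <= 1.
Proof. by rewrite invf_le1 ?oneD_sqr_gt0// lerDl sqr_ge0. Qed.

Lemma continuous_japanese : continuous japanese.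
Proof. exact: continuous_oneDsqrV. Qed.

Lemma measurable_japanese : measurable_fun setT japanese.
Proof. by apply: continuous_measurable_fun; exact: continuous_japanese. Qed.

Lemma integral_japanese : (\int[leb]_x (japanese x)%:E = pi%:E)%E.
Proof.
rewrite ge0_symfun_integralT.
- rewrite (_ : [set x | 0 <= x]%R = `[0%R, +oo[%classic).
    by rewrite integral0y_oneDsqr -EFinM mulrC divfK.
  by apply/seteqP; split => x /=; rewrite in_itv/= andbT.
- exact: japanese_ge0.
- exact: continuous_japanese.
- by move=> x; rewrite /= /japanese sqrrN.
Qed.

Lemma integrable_japanese : leb.-integrable setT (EFin \o japanese).
Proof.
apply/integrableP; split.
  by apply/measurable_EFinP; exact: measurable_japanese.
under eq_integral do rewrite /= ger0_norm ?japanese_ge0//.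
by rewrite integral_japanese ltry.
Qed.

End lebesgue_line.

Section spacetime_coordinates.
Variable T : Type.

Lemma spacetime_lift d (x : 'rV[T]_d) t i :
  spacetime (x, t) ord0 (lift ord_max i) = x ord0 i.
Proof. by rewrite mxE liftK. Qed.

Lemma spacetime_max d (x : 'rV[T]_d) t : spacetime (x, t) ord0 ord_max = t.
Proof. by rewrite mxE unlift_none. Qed.

End spacetime_coordinates.

Section lebesgue_rV_integral.
Variable R : realType.
Local Notation leb := (@lebesgue_measure R).

(* The product measure lives over [measurableTypeR R], whose display differs
   from that of [R]. *)
Let measurable_spacetimeR d :
  measurable_fun [set: ('rV[R]_d * measurableTypeR R)%type] (@spacetime R d).
Proof. exact: (@measurable_spacetime R d). Qed.

Lemma ge0_integral_rVS d (f : 'rV[R]_d.+1 -> \bar R) :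
  measurable_fun setT f -> (forall z, 0 <= f z)%E ->
  (\int[lebesgue_rV R d.+1]_z f z =
   \int[lebesgue_rV R d]_x \int[leb]_t f (spacetime (x, t)))%E.
Proof.
move=> mf f0; transitivity
  (\int[(lebesgue_rV R d \x leb)]_p (f \o @spacetime R d) p)%E.
  have := @ge0_integral_pushforward _ _ _ _ _ _ (@measurable_spacetimeR d)
    (lebesgue_rV R d \x leb)%E setT f measurableT mf (fun y _ => f0 y).
  rewrite preimage_setT => <-.
  by apply: eq_measure_integral => [|? A mA //]; exact: measurable_spacetimeR.
rewrite fubini_tonelli1//; last by move=> p; exact: f0.
exact: (measurableT_comp mf (@measurable_spacetimeR d)).
Qed.

Lemma Cintegrable_rVS d (f : 'rV[R]_d.+1 -> R[i]) :
  Cmeasurable f ->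
  Cintegrable (lebesgue_rV R d \x leb)%E (f \o @spacetime R d) ->
  Cintegrable (lebesgue_rV R d.+1) f.
Proof.
move=> [m1 m2] [i1 i2]; split.
- exact: (integrable_pushforward (@measurable_spacetimeR d)
    (proj2 (measurable_EFinP _ _) m1) i1).
- exact: (integrable_pushforward (@measurable_spacetimeR d)
    (proj2 (measurable_EFinP _ _) m2) i2).
Qed.

Lemma Cintegral_rVS d (f : 'rV[R]_d.+1 -> R[i]) :
  Cmeasurable f ->
  Cintegrable (lebesgue_rV R d \x leb)%E (f \o @spacetime R d) ->
  Cintegral (lebesgue_rV R d.+1) f =
  Cintegral (lebesgue_rV R d \x leb)%E (f \o @spacetime R d).
Proof.
move=> [m1 m2] [i1 i2]; rewrite /Cintegral /Rintegral.
have /= E1 := (integral_pushforward (@measurable_spacetimeR d)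
    (proj2 (measurable_EFinP _ _) m1) i1 measurableT).
have /= E2 := (integral_pushforward (@measurable_spacetimeR d)
    (proj2 (measurable_EFinP _ _) m2) i2 measurableT).
by congr Complex; rewrite /= /lebesgue_step ?E1 ?E2.
Qed.

(** The ring is a parameter because complex wave packets and real weights are both products of this
    kind. *)
Definition tensor (K : comNzRingType) d (phi : 'I_d -> R -> K) (x : 'rV[R]_d) : K :=
  \prod_i phi i (x ord0 i).

Lemma tensorS (K : comNzRingType) d (phi : 'I_d.+1 -> R -> K) p :
  tensor phi (spacetime p) =
  tensor (fun i => phi (lift ord_max i)) p.1 * phi ord_max p.2.
Proof.
case: p => x t; rewrite /tensor (bigD1_ord ord_max)//= spacetime_max mulrC.
by congr (_ * _); apply: eq_bigr => i _; rewrite spacetime_lift.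
Qed.

Lemma Cmeasurable_tensor d (phi : 'I_d -> R -> R[i]) :
  (forall i, Cmeasurable (phi i)) -> Cmeasurable (tensor phi).
Proof.
move=> mphi; apply: Cmeasurable_prod => i.
exact: Cmeasurable_comp (mphi i) (measurable_rV_coord i).
Qed.

Lemma Cintegrable_tensor d (phi : 'I_d -> R -> R[i]) :
  (forall i, Cintegrable leb (phi i)) ->
  Cintegrable (lebesgue_rV R d) (tensor phi).
Proof.
elim: d phi => [|d IH] phi iphi.
  apply: (@Cintegrable_le _ _ _ _ (fun=> 1)).
  - by apply: Cmeasurable_tensor => -[].
  - apply/integrableP; split; first exact: measurable_cst.
    rewrite /= normr1 integral_cst// mul1e.
    by rewrite (_ : _ setT = 1%E) ?ltry//; exact: diracT.
  - by move=> x; rewrite /tensor big_ord0 cabs1.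
apply: Cintegrable_rVS.
  by apply: Cmeasurable_tensor => i; exact: Cintegrable_measurable (iphi i).
rewrite (_ : _ \o _ = fun p => tensor (fun i => phi (lift ord_max i)) p.1 *
  phi ord_max p.2); last by apply/funext => p; exact: tensorS.
exact: Cintegrable_separated (IH _ _) (iphi _).
Qed.

Lemma Cintegral_tensor d (phi : 'I_d -> R -> R[i]) :
  (forall i, Cintegrable leb (phi i)) ->
  Cintegral (lebesgue_rV R d) (tensor phi) = \prod_i Cintegral leb (phi i).
Proof.
elim: d phi => [|d IH] phi iphi.
  (* In dimension 0 the measure is the Dirac mass at the only point, and the product is empty. *)
  rewrite big_ord0 /Cintegral /Rintegral /=.
  rewrite !integral_dirac//= ?diracT ?mul1e; last 2 first.
  - by apply/measurable_EFinP; apply: (Cmeasurable_tensor _).2 => -[].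
  - by apply/measurable_EFinP; apply: (Cmeasurable_tensor _).1 => -[].
  by rewrite indicT /tensor big_ord0 /= mul1r mulr0.
have E : tensor phi \o @spacetime R d =
    fun p => tensor (fun i => phi (lift ord_max i)) p.1 * phi ord_max p.2.
  by apply/funext => p; exact: tensorS.
have I1 : Cintegrable (lebesgue_rV R d) (tensor (fun i => phi (lift ord_max i))).
  by apply: Cintegrable_tensor.
rewrite Cintegral_rVS; last 2 first.
- by apply: Cmeasurable_tensor => i; exact: Cintegrable_measurable (iphi i).
- by rewrite E; exact: Cintegrable_separated.
by rewrite E Cintegral_separated// IH// (bigD1_ord ord_max)//= mulrC.
Qed.

Lemma ge0_integral_tensor d (phi : 'I_d -> R -> R) :
  (forall i, measurable_fun setT (phi i)) -> (forall i x, 0 <= phi i x) ->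
  (\int[lebesgue_rV R d]_x (tensor phi x)%:E =
   \prod_i \int[leb]_x (phi i x)%:E)%E.
Proof.
move=> + phi0; have T0 k (psi : 'I_k -> R -> R) x : (forall i x, 0 <= psi i x) ->
  0 <= tensor psi x by move=> psi0; exact: prodr_ge0.
have mT k (psi : 'I_k -> R -> R) : (forall i, measurable_fun setT (psi i)) ->
    measurable_fun setT (tensor psi).
  move=> mpsi; apply: measurable_prod => i _.
  exact: measurableT_comp (mpsi i) (measurable_rV_coord i).
elim: d phi phi0 => [|d IH] phi phi0 mphi.
  rewrite big_ord0 /= integral_dirac//= ?diracT ?mul1e.
    by rewrite /tensor big_ord0.
  by apply/measurable_EFinP; exact: mT.
rewrite ge0_integral_rVS//; last 2 first.
- by apply/measurable_EFinP; exact: mT.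
- by move=> z; rewrite lee_fin; exact: T0.
transitivity (\int[lebesgue_rV R d]_x ((tensor (fun i => phi (lift ord_max i)) x)%:E *
    \int[leb]_t (phi ord_max t)%:E))%E.
  apply: eq_integral => x _; rewrite -ge0_integralZl//=.
  - by apply: eq_integral => t _; rewrite tensorS EFinM.
  - by apply/measurable_EFinP; exact: mphi.
  - by move=> t _; rewrite lee_fin.
  - by rewrite lee_fin; exact: T0.
rewrite ge0_integralZr//=; last 3 first.
- by apply/measurable_EFinP; exact: mT.
- by move=> x _; rewrite lee_fin; exact: T0.
- by apply: integral_ge0 => t _; rewrite lee_fin.
by rewrite IH// (bigD1_ord ord_max)//= muleC.
Qed.

End lebesgue_rV_integral.

(** * Fourier decay of Schwartz functions *)

Section continuous_rV.
Variables (R : realType) (d : nat).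

(** The intersection runs over all natural numbers, with trivial members from [d] on, so that the
    rule for countable intersections applies. *)
Lemma measurable_box (A : 'I_d -> set R) : (forall i, measurable (A i)) ->
  measurable [set x : 'rV[R]_d | forall i, A i (x ord0 i)].
Proof.
move=> mA; pose F k := [set x : 'rV[R]_d | forall i : 'I_d, i = k :> nat -> A i (x ord0 i)].
rewrite (_ : [set x | _] = \bigcap_(k in [set: nat]) F k); last first.
  apply/seteqP; split => x /=; first by move=> Ax k _ i _; exact: Ax.
  by move=> Fx i; exact: (Fx i I i).
apply: bigcapT_measurable => k; have [kd|dk] := ltnP k d.
  have -> : F k = (fun x : 'rV[R]_d => x ord0 (Ordinal kd)) @^-1` A (Ordinal kd).
    apply/seteqP; split => x /=; first by apply.
    by move=> Ax i ik; rewrite (_ : i = Ordinal kd)//; exact: val_inj.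
  by rewrite -[X in measurable X]setTI; exact: measurable_rV_coord.
rewrite (_ : F k = setT)//; apply/seteqP; split => // x _ i ik.
by move: dk; rewrite -ik leqNgt ltn_ord.
Qed.

(** An open set is the countable union of the cubes inside it that have a rational centre and a
    radius 1/(k+1). This links continuity for the sup norm with the sigma-algebra generated by the
    coordinates. *)
Lemma open_measurable_rV (O : set 'rV[R]_d) : open O -> measurable O.
Proof.
move=> oO; pose cube (p : 'rV[rat]_d * nat) :=
  [set x : 'rV[R]_d | forall i, ball (ratr (p.1 ord0 i) : R) p.2.+1%:R^-1 (x ord0 i)].
have -> : O = \bigcup_p (if `[< cube p `<=` O >] then cube p else set0).
  apply/seteqP; split => [x Ox|x [p _]]; last by case: ifPn => // /asboolP; apply.
  have /nbhs_ballP[e /= e0 xeO] : nbhs x O by exact: open_nbhs_nbhs.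
  (* The radius is taken below [e / 2]: a cube whose centre is within 1/(k+1) of [x] then lies in
     the ball of radius [e] around [x]. *)
  have [k] := @ltr_add_invr R 0 (e / 2) (divr_gt0 e0 (ltr0Sn _ 1)); rewrite add0r => ke.
  have k0 : 0 < k.+1%:R^-1 :> R by rewrite invr_gt0.
  have /choice[q qP] : forall i, exists q : rat, `|ratr q - x ord0 i| < k.+1%:R^-1.
    move=> i; have [q] := @rat_in_itvoo R (x ord0 i - k.+1%:R^-1) (x ord0 i)
    ltac:(by rewrite ltrBlDr ltrDl).
    rewrite in_itv /= => /andP[q1 q2]; exists q.
    by move: k0 q1 q2; set r := _^-1 => k0 q1 q2; rewrite ltr_norml; apply/andP; split; lra.
  exists (\row_i q i, k) => //; rewrite asboolT.
    by move=> i /=; rewrite mxE; exact: qP.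
  move=> y /= ykx; apply: xeO; split => // i j; rewrite !ord1.
  have := ykx j; rewrite /= mxE /ball /= => yk.
  rewrite (_ : x ord0 j - y ord0 j = (x ord0 j - ratr (q j)) + (ratr (q j) - y ord0 j));
    last by ring.
  by rewrite (le_lt_trans (ler_normD _ _))// distrC; move: ke (qP j) yk; set r := _^-1; lra.
apply: countable_bigcupT_measurable; first exact: countableP.
move=> p; case: ifPn => _; last exact: measurable0.
apply: (measurable_box (A := fun i => ball (ratr (p.1 ord0 i) : R) p.2.+1%:R^-1)).
by move=> i; exact: measurable_ball.
Qed.

Lemma continuous_measurable_rV (h : 'rV[R]_d -> R) : continuous h ->
  measurable_fun setT h.
Proof.
move=> /continuousP ch; apply: (measurability _ (RGenOpens.measurableE R)) => //.
move=> _ [_ [a [b ->] <-]].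
rewrite setTI; apply: open_measurable_rV; exact/ch/interval_open.
Qed.

End continuous_rV.

(** * Integrals of derivatives on the line *)

Section derivative_integral.
Variable R : realType.
Local Notation leb := (@lebesgue_measure R).

Lemma cvg_japanese0 : @japanese R n.+1%:R @[n --> \oo] --> 0.
Proof.
apply: (@squeeze_cvgr _ _ _ _ (fun=> 0) (@harmonic R)); last 2 first.
- exact: cvg_cst.
- exact: cvg_harmonic.
apply: nearW => n; rewrite japanese_ge0 /= /japanese lef_pV2 ?posrE ?oneD_sqr_gt0//.
by rewrite ler_wpDl// expr2 ler_peMl// ler1n.
Qed.

(** The fundamental theorem of calculus on [-n-1, n+1]: the bound on [H] kills the boundary terms,
    the bound on [h] gives dominated convergence to the integral over the line. *)
Lemma integral_derive_eq0 (H h : R -> R) (C : R) :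
  (forall x : R, is_derive x 1 H (h x)) -> continuous h ->
  (forall x, `|H x| <= C * japanese x) -> (forall x, `|h x| <= C * japanese x) ->
  \int[leb]_x h x = 0.
Proof.
move=> dH ch HC hC.
have cH : continuous H.
  move=> x; apply/differentiable_continuous/derivable1_diffP.
  exact: (@ex_derive _ _ _ _ _ _ _ (dH x)).
pose I n : set R := `[- n.+1%:R, n.+1%:R]%classic.
have E n : (\int[leb]_(x in I n) (h x)%:E = (H n.+1%:R - H (- n.+1%:R))%:E)%E.
  rewrite (@continuous_FTC2 _ h H)//.
  - by rewrite ltrNl (@lt_trans _ _ 0)// ?oppr_lt0 ltr0n.
  - exact: continuous_subspaceT.
  - split.
    + by move=> x _; exact: (@ex_derive _ _ _ _ _ _ _ (dH x)).
    + by apply: cvg_at_right_filter; exact: cH.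
    + by apply: cvg_at_left_filter; exact: cH.
  - by move=> x _; rewrite derive1E; exact: (@derive_val _ _ _ _ _ _ _ (dH x)).
have mh : measurable_fun setT h by exact: continuous_measurable_fun.
have ij : leb.-integrable setT (fun x => (C * japanese x)%:E).
  have := integrableZl measurableT C (@integrable_japanese R).
  by apply: eq_integrable.
have mI n : measurable (I n) by exact: measurable_itv.
have mn n : measurable_fun setT ((EFin \o h) \_ (I n)).
  apply/(measurable_restrictT _ (mI n)); apply: measurable_funTS.
  exact/measurable_EFinP.
have cvI : {ae leb, forall x, setT x ->
    (fun n => ((EFin \o h) \_ (I n)) x) @ \oo --> (EFin \o h) x}.
  apply: aeW => x _; apply: cvg_near_cst; near=> n.
  rewrite patchE mem_set// /I /= in_itv /= -ler_norml.
  have xn : `|x| <= n%:R by near: n; exact: nbhs_infty_ger.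
  by rewrite (le_trans xn)// ler_nat.
have bI : {ae leb, forall x n, setT x ->
    (`|((EFin \o h) \_ (I n)) x| <= (C * japanese x)%:E)%E}.
  apply: aeW => x n _; rewrite patchE; case: ifPn => _ /=; first by rewrite lee_fin.
  by rewrite normr0 lee_fin (le_trans _ (hC x)).
have [_ _ cv] := @dominated_convergence _ _ _ leb setT measurableT _ _ _ mn
  (proj2 (measurable_EFinP _ _) mh) cvI ij bI.
have cv0 : (H n.+1%:R - H (- n.+1%:R))%:E @[n --> \oo] --> (0 : \bar R)%E.
  apply: cvg_EFin; first exact: nearW.
  apply/norm_cvg0P; apply: (@squeeze_cvgr _ _ _ _ (fun=> 0)
      (fun n => 2 * C * @japanese R n.+1%:R)); last 2 first.
  - exact: cvg_cst.
  - by rewrite -(mulr0 (2 * C)); apply: cvgMl_tmp; exact: cvg_japanese0.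
  apply: nearW => n; rewrite normr_ge0 /= (le_trans (ler_normB _ _))//.
  have := HC n.+1%:R; have := HC (- n.+1%:R); rewrite /japanese sqrrN => h1 h2.
  by rewrite -mulrA mulr_natl mulr2n; exact: lerD.
rewrite /Rintegral (_ : (\int[leb]_x (h x)%:E)%E = 0%E)//.
apply: cvg_unique cv _ => //.
rewrite (_ : [sequence _]_n = fun n => (H n.+1%:R - H (- n.+1%:R))%:E)//.
by apply/funext => n /=; rewrite -E [RHS]integral_mkcond.
Unshelve. all: by end_near. Qed.

End derivative_integral.

(** * Domination by a product weight; integrals of partial derivatives *)

Section real_slices.
Variable R : realType.
Local Notation leb := (@lebesgue_measure R).

Lemma integrable_real_complex d (T : measurableType d) (mu : {measure set T -> \bar R})
    (h : T -> R) : mu.-integrable setT (EFin \o h) ->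
  Cintegrable mu (fun x => (h x)%:C%C).
Proof. by move=> ih; split => //=; exact: integrable0. Qed.

Lemma Rintegral_rVS d (h : 'rV[R]_d.+1 -> R) : measurable_fun setT h ->
  (lebesgue_rV R d \x leb)%E.-integrable setT (EFin \o (h \o @spacetime R d)) ->
  \int[lebesgue_rV R d.+1]_z h z = \int[(lebesgue_rV R d \x leb)%E]_p h (spacetime p).
Proof.
move=> mh ih.
have := Cintegral_rVS (Cmeasurable_real mh) (integrable_real_complex ih).
by case.
Qed.

Definition japanese_prod d : 'rV[R]_d -> R := tensor (fun _ => @japanese R).

Lemma japanese_prod_ge0 d (x : 'rV[R]_d) : 0 <= japanese_prod x.
Proof. by apply: prodr_ge0 => i _; exact: japanese_ge0. Qed.

Lemma japanese_prodS d (x : 'rV[R]_d) t :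
  japanese_prod (spacetime (x, t)) = japanese_prod x * japanese t.
Proof. exact: tensorS. Qed.

Lemma integrable_japanese_prod d :
  (lebesgue_rV R d).-integrable setT (EFin \o @japanese_prod d).
Proof.
have [+ _] : Cintegrable (lebesgue_rV R d) (fun x => tensor (fun _ t => (japanese t)%:C%C) x).
  by apply: Cintegrable_tensor => i; apply: integrable_real_complex; exact: integrable_japanese.
apply: eq_integrable => // x _ /=; congr EFin.
rewrite /tensor (_ : \prod_(i < d) _ = ((japanese_prod x)%:C)%C)//.
by rewrite /japanese_prod /tensor rmorph_prod.
Qed.

Lemma integrable_japanese_prod2 d :
  (lebesgue_rV R d \x leb)%E.-integrable setT
    (EFin \o (fun p => japanese_prod (spacetime p))).
Proof.
have Ip := Cintegrable_separated (integrable_real_complex (integrable_japanese_prod d))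
  (integrable_real_complex (@integrable_japanese R)).
have [+ _] := Ip; apply: eq_integrable => // -[x t] _ /=.
by rewrite japanese_prodS !mul0r subr0.
Qed.

Section dominated.
Variables (d : nat) (C : R).

Lemma integrable_dominated (h : 'rV[R]_d -> R) : measurable_fun setT h ->
  (forall x, `|h x| <= C * japanese_prod x) ->
  (lebesgue_rV R d).-integrable setT (EFin \o h).
Proof.
move=> mh hC; apply: (@le_integrable_real _ _ _ _ (fun x => C * japanese_prod x)) => //.
have := integrableZl measurableT C (integrable_japanese_prod d).
exact: eq_integrable.
Qed.

Lemma integrable_dominated2 (h : 'rV[R]_d.+1 -> R) : measurable_fun setT h ->
  (forall x, `|h x| <= C * japanese_prod x) ->
  (lebesgue_rV R d \x leb)%E.-integrable setT (EFin \o (h \o @spacetime R d)).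
Proof.
move=> mh hC; apply: (@le_integrable_real _ _ _ (lebesgue_rV R d \x leb)%E
  (fun p => C * japanese_prod (spacetime p))) => //.
- exact: (measurableT_comp mh (@measurable_spacetime R d)).
- have := integrableZl measurableT C (integrable_japanese_prod2 d).
  exact: eq_integrable.
- by move=> p; exact: hC.
Qed.

End dominated.

Lemma spacetimeD_space d (x : 'rV[R]_d) t j s :
  s *: delta_mx ord0 (lift ord_max j) + spacetime (x, t) =
  spacetime (s *: delta_mx ord0 j + x, t).
Proof.
apply/rowP => i; rewrite !mxE; case: unliftP => [k ->|->].
  by rewrite !mxE /= (inj_eq lift_inj).
by rewrite eqxx (negbTE (neq_lift _ _)) mulr0 add0r.
Qed.

Lemma spacetimeD_time d (x : 'rV[R]_d) t s :
  s *: delta_mx ord0 ord_max + spacetime (x, t) = spacetime (x, s + t).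
Proof.
apply/rowP => i; rewrite !mxE; case: unliftP => [k ->|->].
  by rewrite [lift _ _ == _]eq_sym (negbTE (neq_lift _ _)) andbF mulr0 add0r.
by rewrite !eqxx mulr1.
Qed.

(** The two difference quotients coincide. This serves to freeze the other coordinates in a partial
    derivative, and also to recover a partial derivative from a derivative along a line. *)
Lemma is_derive_slice (V V' : normedModType R) (a v : V) (b w : V') (f : V -> R) (g : V' -> R) l :
  (forall s : R, g (s *: w + b) = f (s *: v + a)) ->
  is_derive a v f l -> is_derive b w g l.
Proof.
move=> gf [df dl].
have gb : g b = f a by have := gf 0; rewrite !scale0r !add0r.
have E : (fun s => s^-1 *: ((g \o shift b) (s *: w) - g b)) =
         (fun s => s^-1 *: ((f \o shift a) (s *: v) - f a)).
  by apply/funext => s /=; rewrite gb gf.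
by split; rewrite /derivable /derive E.
Qed.

Lemma continuous_spacetime_space d t : continuous (fun x : 'rV[R]_d => spacetime (x, t)).
Proof.
move=> x A /nbhs_ballP[e /= e0 xeA]; apply/nbhs_ballP; exists e => // y [_ xy].
apply: xeA; split => // i j; rewrite !mxE; case: unliftP => [k _|_].
  exact: xy.
exact: ballxx.
Qed.

Lemma continuous_spacetime_time d (x : 'rV[R]_d) : continuous (fun t : R => spacetime (x, t)).
Proof.
move=> t A /nbhs_ballP[e /= e0 xeA]; apply/nbhs_ballP; exists e => // s ts.
apply: xeA; split => // i j; rewrite !mxE; case: unliftP => [k _|_] //.
exact: ballxx.
Qed.

(** Induction on the dimension. For an earlier coordinate, the last one is frozen and the constant
    becomes [C * japanese t]; for the last coordinate, the result on the line applies with the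
    others frozen. *)
Lemma integral_partial_eq0 d (i : 'I_d) (H h : 'rV[R]_d -> R) (C : R) :
  (forall x, is_derive x (delta_mx ord0 i) H (h x)) -> continuous h ->
  (forall x, `|H x| <= C * japanese_prod x) ->
  (forall x, `|h x| <= C * japanese_prod x) ->
  \int[lebesgue_rV R d]_x h x = 0.
Proof.
elim: d i H h C => [[]//|d IH] i H h C dH ch HC hC.
have mh : measurable_fun setT h by exact: continuous_measurable_rV.
have ih := integrable_dominated2 mh hC.
rewrite Rintegral_rVS//.
case: (unliftP ord_max i) => [j|] ij; subst i.
- rewrite Rfubini2// (_ : (fun t => _) = fun=> 0); first by rewrite /Rintegral integral0.
  apply/funext => t.
  apply: (IH j (fun x => H (spacetime (x, t))) _ (C * japanese t)).
  + move=> x; apply: is_derive_slice (dH (spacetime (x, t))) => s.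
    by rewrite spacetimeD_space.
  + by move=> x; apply: continuous_comp; [exact: continuous_spacetime_space|exact: ch].
  + by move=> x; rewrite -mulrA [japanese t * _]mulrC -japanese_prodS.
  + by move=> x; rewrite -mulrA [japanese t * _]mulrC -japanese_prodS.
- rewrite Rfubini1// (_ : (fun x => _) = fun=> 0); first by rewrite /Rintegral integral0.
  apply/funext => x.
  apply: (@integral_derive_eq0 _ (fun t => H (spacetime (x, t))) _ (C * japanese_prod x)).
  + move=> t; apply: is_derive_slice (dH (spacetime (x, t))) => s.
    by rewrite spacetimeD_time /= [s *: 1]mulr1.
  + by move=> t; apply: continuous_comp; [exact: continuous_spacetime_time|exact: ch].
  + by move=> t; rewrite -mulrA -japanese_prodS.
  + by move=> t; rewrite -mulrA -japanese_prodS.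
Qed.

End real_slices.

(** * Decay of the inverse Fourier transform of a Schwartz function *)

Section schwartz_decay.
Variables (R : realType) (n : nat).
Implicit Types (h : 'rV[R]_n -> R) (z w : 'rV[R]_n).
Local Notation leb := (@lebesgue_measure R).
Local Notation e_ i := (delta_mx ord0 i : 'rV[R]_n).

Lemma schwartz_real_is_derive h i w : schwartz_real h ->
  is_derive w (e_ i) h ('D_(e_ i) h w).
Proof. by move=> [/(_ [::] w) dh _]; apply/derivableP; exact: diff_derivable. Qed.

Lemma schwartz_real_continuous h : schwartz_real h -> continuous h.
Proof. by move=> [/(_ [::]) dh _] w; exact/differentiable_continuous/dh. Qed.

Lemma schwartz_real_partial h i : schwartz_real h ->
  schwartz_real ('D_(e_ i) h : 'rV[R]_n -> R).
Proof.
have E s : iter_partial s ('D_(e_ i) h) = iter_partial (rcons s i) h.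
  by rewrite /iter_partial foldr_rcons.
by move=> [h1 h2]; split=> [s z|a s]; rewrite E; [exact: h1|exact: h2].
Qed.

(** A factor 1 + z_i^2 splits the expression in two: one part with the same monomial, one with the
    exponent of z_i raised by 2. Hence the induction is over all monomials at once. *)
Lemma schwartz_real_weighted h (s : seq 'I_n) (a : 'I_n -> nat) : schwartz_real h ->
  exists M : R, forall z,
    `|(\prod_i z ord0 i ^+ a i) * h z| * \prod_(i <- s) (1 + z ord0 i ^+ 2) <= M.
Proof.
move=> sh; elim: s a => [a|i s IH a].
  have [_ /(_ a [::]) [M hM]] := sh; exists M => z.
  by rewrite big_nil mulr1; exact: hM.
have [M1 h1] := IH a.
have [M2 h2] := IH (fun k => a k + (k == i) * 2)%N.
exists (M1 + M2) => z; rewrite big_cons.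
have -> : `|(\prod_i z ord0 i ^+ a i) * h z| *
    ((1 + z ord0 i ^+ 2) * \prod_(j <- s) (1 + z ord0 j ^+ 2)) =
  `|(\prod_i z ord0 i ^+ a i) * h z| * \prod_(j <- s) (1 + z ord0 j ^+ 2) +
  `|(\prod_k z ord0 k ^+ (a k + (k == i) * 2)) * h z| *
    \prod_(j <- s) (1 + z ord0 j ^+ 2).
  under [X in _ + `|X * _| * _]eq_bigr do rewrite exprD.
  rewrite big_split /= [X in _ + `|_ * X * _| * _](bigD1 i)//= eqxx.
  rewrite [X in _ + `|_ * (_ * X) * _| * _]big1.
    set P := \prod_(i < n) _; set S := \prod_(j <- s) _; rewrite mulr1 mul1n.
    by rewrite [P * _ * h z]mulrAC [`|_ * z _ _ ^+ 2|]normrM [`|_ ^+ 2|]ger0_norm ?sqr_ge0//; ring.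
  by move=> k /negbTE ->.
exact: lerD.
Qed.

Lemma schwartz_real_dominated h : schwartz_real h ->
  exists C : R, forall z, `|h z| <= C * japanese_prod z.
Proof.
move=> /(schwartz_real_weighted (enum 'I_n) (fun=> 0%N)) [C hC]; exists C => z.
have := hC z; rewrite big1 ?mul1r; last by move=> i _; rewrite expr0.
rewrite (_ : \prod_(i <- enum 'I_n) _ = (japanese_prod z)^-1); last first.
  by rewrite big_enum /= /japanese_prod /tensor prodfV invrK.
rewrite ler_pdivrMr//; apply: prodr_gt0 => i _; exact: japanese_gt0.
Qed.

Lemma rV_continuousM (f g : 'rV[R]_n -> R) : continuous f -> continuous g ->
  continuous (fun w : 'rV[R]_n => f w * g w).
Proof. by move=> cf cg w; exact: (continuousM (cf w) (cg w)). Qed.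

Lemma rV_continuousD (f g : 'rV[R]_n -> R) : continuous f -> continuous g ->
  continuous (fun w : 'rV[R]_n => f w + g w).
Proof. by move=> cf cg w; exact: (continuousD (cf w) (cg w)). Qed.

Lemma rV_continuous_scale (a : R) (f : 'rV[R]_n -> R) : continuous f ->
  continuous (fun w : 'rV[R]_n => a * f w).
Proof. by apply: rV_continuousM; exact: cst_continuous. Qed.

Lemma continuous_dotmul z : continuous (fun w : 'rV[R]_n => dotmul z w).
Proof.
apply: continuous_big => [|i _]; first exact: add_continuous.
by apply: rV_continuous_scale; exact: coord_continuous.
Qed.

Lemma dotmulDr z w w' : dotmul z (w + w') = dotmul z w + dotmul z w'.
Proof. by rewrite /dotmul -big_split; apply: eq_bigr => i _; rewrite mxE mulrDr. Qed.

Lemma dotmul_delta z i (s : R) : dotmul z (s *: e_ i) = s * z ord0 i.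
Proof.
rewrite /dotmul (bigD1 i)//= big1 ?addr0; last first.
  by move=> k /negbTE ki; rewrite !mxE ki andbF !mulr0.
by rewrite !mxE !eqxx mulr1 mulrC.
Qed.

(** Integration by parts: the transform of the partial derivative is -2 pi i z_i times the
    transform. Only moduli are compared, because only decay is wanted. *)
Lemma cabs_inv_fourier_partial h i z : schwartz_real h ->
  cabs (inv_fourier (fun w => ('D_(e_ i) h w)%:C%C) z) =
  2 * pi * `|z ord0 i| * cabs (inv_fourier (fun w => (h w)%:C%C) z).
Proof.
move=> sh; have sDh := schwartz_real_partial i sh.
have [C1 hC1] := schwartz_real_dominated sh.
have [C2 hC2] := schwartz_real_dominated sDh.
set Dh := 'D_(e_ i) h in sDh hC2 *.
have {}hC2 : forall w, `|Dh w| <= C2 * japanese_prod w by [].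
have ch := schwartz_real_continuous sh.
have cDh := schwartz_real_continuous sDh.
pose c w := cos (2 * pi * dotmul z w); pose s w := sin (2 * pi * dotmul z w).
have cphase : continuous (fun w => 2 * pi * dotmul z w).
  by apply: rV_continuous_scale; exact: continuous_dotmul.
have cc : continuous c.
  by move=> w; apply: continuous_comp; [exact: cphase|exact: continuous_cos].
have cs : continuous s.
  by move=> w; apply: continuous_comp; [exact: cphase|exact: continuous_sin].
have c1 w : `|c w| <= 1 by rewrite ler_norml cos_geN1 cos_le1.
have s1 w : `|s w| <= 1 by rewrite ler_norml sin_geN1 sin_le1.
pose k := 2 * pi * z ord0 i.
have J0 w := japanese_prod_ge0 w.
have bd (f g : 'rV[R]_n -> R) C : (forall w, `|f w| <= C * japanese_prod w) ->
    (forall w, `|g w| <= 1) -> forall w, `|f w * g w| <= C * japanese_prod w.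
  by move=> fC g1 w; rewrite normrM (le_trans _ (fC w))// ler_piMr.
have int (f g : 'rV[R]_n -> R) C : continuous f -> continuous g ->
    (forall w, `|f w| <= C * japanese_prod w) -> (forall w, `|g w| <= 1) ->
    (lebesgue_rV R n).-integrable setT (EFin \o (fun w => f w * g w)).
  move=> cf cg fC g1; apply: (integrable_dominated _ (bd _ _ _ fC g1)).
  by apply: continuous_measurable_rV; exact: rV_continuousM.
have dphase w : is_derive (0 : R) 1 (fun r => 2 * pi * dotmul z (r *: e_ i + w)) k.
  rewrite (_ : (fun r => _) = (fun r => r * k + 2 * pi * dotmul z w)); last first.
    by apply/funext => r; rewrite dotmulDr dotmul_delta /k; ring.
  by apply: is_derive_eq; rewrite /GRing.scale /=; ring.
have dslice (f : 'rV[R]_n -> R) (f' : R) w : is_derive w (e_ i) f f' ->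
    is_derive (0 : R) 1 (fun r => f (r *: e_ i + w)) f'.
  by apply: is_derive_slice => r; rewrite addr0 [r *: 1]mulr1.
(* Integration by parts against a real trigonometric factor; cosine and sine give the real and the
   imaginary part. *)
have key (g g' : R -> R) : (forall x : R, is_derive x 1 g (g' x)) ->
    continuous g -> continuous g' ->
    (forall x, `|g x| <= 1) -> (forall x, `|g' x| <= 1) ->
  \int[lebesgue_rV R n]_w (Dh w * g (2 * pi * dotmul z w)) =
  - k * \int[lebesgue_rV R n]_w (h w * g' (2 * pi * dotmul z w)).
  move=> dg cg cg' g1 g'1.
  have cgp : continuous (fun w => g (2 * pi * dotmul z w)).
    by move=> w; apply: (continuous_comp (cphase w)); exact: cg.
  have cg'p : continuous (fun w => g' (2 * pi * dotmul z w)).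
    by move=> w; apply: (continuous_comp (cphase w)); exact: cg'.
  have I1 := int _ _ _ cDh cgp hC2 (fun w => g1 _).
  have I2 := int _ _ _ ch cg'p hC1 (fun w => g'1 _).
  have I2' : (lebesgue_rV R n).-integrable setT
      (EFin \o (fun w => k * (h w * g' (2 * pi * dotmul z w)))).
    by have := integrableZl measurableT k I2; apply: eq_integrable.
  apply/eqP; rewrite mulNr -addr_eq0 -RintegralZl// -RintegralD//; apply/eqP.
  (* The constant has to dominate both the product of [h] with the trigonometric factor and the
     partial derivative of this product. *)
  apply: (@integral_partial_eq0 _ _ i (fun w => h w * g (2 * pi * dotmul z w)) _
     (`|C1| + (`|C2| + `|k| * `|C1|))).
  - move=> w; apply: (@is_derive_slice _ _ _ (0 : R) 1 _ _
      (fun r => h (r *: e_ i + w) * g (2 * pi * dotmul z (r *: e_ i + w)))).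
      by move=> r; rewrite addr0 [r *: 1]mulr1.
    have d1 := dslice _ _ _ (schwartz_real_is_derive i w sh).
    have d2 := @is_derive1_comp R g (fun r => 2 * pi * dotmul z (r *: e_ i + w)) 0 _ _
      (dg _) (dphase w).
    apply: (is_derive_eq (is_deriveM d1 d2)).
    by rewrite /= scale0r add0r /GRing.scale /= /Dh; ring.
  - apply: rV_continuousD; first exact: rV_continuousM.
    by apply: rV_continuous_scale; exact: rV_continuousM.
  - move=> w; apply: le_trans (bd _ _ _ hC1 (fun w => g1 _) w) _.
    rewrite ler_wpM2r// (le_trans (ler_norm _))// lerDl.
    by rewrite addr_ge0// mulr_ge0.
  - move=> w; apply: le_trans (ler_normD _ _) _; rewrite [`|k * _|]normrM.
    apply: (@le_trans _ _ (`|C2| * japanese_prod w + `|k| * (`|C1| * japanese_prod w))).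
      apply: lerD; first apply: le_trans (bd _ _ _ hC2 (fun w => g1 _) w) _.
        by rewrite ler_wpM2r// ler_norm.
      rewrite ler_wpM2l// (le_trans (bd _ _ _ hC1 (fun w => g'1 _) w))//.
      by rewrite ler_wpM2r// ler_norm.
    by rewrite mulrA -mulrDl ler_wpM2r// lerDr.
have Ec : \int[lebesgue_rV R n]_w (Dh w * c w) = k * \int[lebesgue_rV R n]_w (h w * s w).
  rewrite (key cos (fun x => - sin x)).
  - have -> : \int[lebesgue_rV R n]_w (h w * - sin (2 * pi * dotmul z w)) =
        -1 * \int[lebesgue_rV R n]_w (h w * s w).
      rewrite -RintegralZl//; last exact: (int _ _ _ ch cs hC1 s1).
      by apply: eq_Rintegral => w _; rewrite /s; ring.
    by ring.
  - exact: continuous_cos.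
  - by move=> x; apply: cvgN; exact: continuous_sin.
  - by move=> x; rewrite ler_norml cos_geN1 cos_le1.
  - by move=> x; rewrite normrN ler_norml sin_geN1 sin_le1.
have Es : \int[lebesgue_rV R n]_w (Dh w * s w) = - k * \int[lebesgue_rV R n]_w (h w * c w).
  rewrite (key sin cos)//.
  - exact: continuous_sin.
  - exact: continuous_cos.
  - by move=> x; rewrite ler_norml sin_geN1 sin_le1.
  - by move=> x; rewrite ler_norml cos_geN1 cos_le1.
have E f : inv_fourier (fun w => (f w)%:C%C) z =
    ((\int[lebesgue_rV R n]_w (f w * c w)) +i* (\int[lebesgue_rV R n]_w (f w * s w)))%C.
  rewrite /inv_fourier /Cintegral; congr Complex; apply: eq_Rintegral => w _.
  - by rewrite ReM /= mul0r subr0.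
  - by rewrite ImM /= mul0r addr0.
rewrite !E Ec Es; set X := \int[_]_w _; set Y := \int[_]_w _.
rewrite /cabs /=.
have -> : (k * X) ^+ 2 + (- k * Y) ^+ 2 = k ^+ 2 * (Y ^+ 2 + X ^+ 2) by ring.
rewrite sqrtrM ?sqr_ge0// sqrtr_sqr /k !normrM; congr (_ * _ * _ * _).
- exact: ger0_norm.
- by rewrite ger0_norm ?pi_ge0.
Qed.

Lemma Cmeasurable_phase (a : R) z :
  Cmeasurable (fun w : 'rV[R]_n => expi (a * dotmul z w)).
Proof.
apply: Cmeasurable_expi; apply: continuous_measurable_rV.
by apply: rV_continuous_scale; exact: continuous_dotmul.
Qed.

(** By [cabs_inv_fourier_partial] a factor 1 + |z_i| costs one derivative, and the derivative is
    again Schwartz. Repeated indices in [s] give higher powers of one coordinate. *)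
Lemma schwartz_real_inv_fourier_decay h (s : seq 'I_n) : schwartz_real h ->
  exists C : R, forall z, cabs (inv_fourier (fun w => (h w)%:C%C) z) *
    \prod_(i <- s) (1 + `|z ord0 i|) <= C.
Proof.
elim: s h => [|i s IH] h sh.
  have [C hC] := schwartz_real_dominated sh.
  exists (2 * \int[lebesgue_rV R n]_w (C * japanese_prod w)) => z.
  rewrite big_nil mulr1; apply: cabs_Cintegral_le.
  - apply: CmeasurableM; last exact: Cmeasurable_phase.
    apply: Cmeasurable_real; apply: continuous_measurable_rV.
    exact: schwartz_real_continuous.
  - have := integrableZl measurableT C (integrable_japanese_prod R n).
    exact: eq_integrable.
  - by move=> w; rewrite cabsM cabs_expi mulr1 cabs_real.
have [C1 h1] := IH _ sh.
have [C2 h2] := IH _ (schwartz_real_partial i sh).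
exists (C1 + (2 * pi)^-1 * C2) => z; rewrite big_cons.
have := h1 z; have := h2 z; rewrite cabs_inv_fourier_partial//.
set F := cabs _; set P := \prod_(j <- s) _ => h2z h1z.
rewrite mulrCA mulrDl mul1r; apply: lerD => //.
have p0 : 0 < 2 * pi :> R by rewrite mulr_gt0// pi_gt0.
rewrite -ler_pdivrMl ?invr_gt0// invrK.
by apply: le_trans h2z; rewrite !mulrA.
Qed.

Lemma inv_fourier_ReIm (f : 'rV[R]_n -> R[i]) z : schwartz f ->
  inv_fourier f z = inv_fourier (fun w => (complex.Re (f w))%:C%C) z +
    'i%C * inv_fourier (fun w => (complex.Im (f w))%:C%C) z.
Proof.
move=> [s1 s2]; rewrite /inv_fourier.
have I h : schwartz_real h -> Cintegrable (lebesgue_rV R n)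
    (fun w => (h w)%:C%C * expi (2 * pi * dotmul z w)).
  move=> sh; have [C hC] := schwartz_real_dominated sh.
  apply: (@Cintegrable_le _ _ _ _ (fun w => C * japanese_prod w)).
  - apply: CmeasurableM; last exact: Cmeasurable_phase.
    apply: Cmeasurable_real; apply: continuous_measurable_rV.
    exact: schwartz_real_continuous.
  - have := integrableZl measurableT C (integrable_japanese_prod R n).
    exact: eq_integrable.
  - by move=> w; rewrite cabsM cabs_expi mulr1 cabs_real.
rewrite -CintegralZl; last exact: I.
rewrite -CintegralD; [|exact: I|by apply: CintegrableZl; exact: I].
apply: eq_Cintegral => w; rewrite mulrA -mulrDl -complexE.
by [].
Qed.

(** The exponent 3 is what [multiplier_majorant] consumes: two factors of the weight pay for the
    slow variation of the majorant, the third makes the convolution integral converge. *)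
Lemma schwartz_inv_fourier_decay (f : 'rV[R]_n -> R[i]) : schwartz f ->
  exists2 C : R, 0 <= C &
    forall z, cabs (inv_fourier f z) <= C * japanese_prod z ^+ 3.
Proof.
(* Each coordinate occurs six times, as (1 + |x|)^6 >= (1 + x^2)^3. *)
move=> sf; have [s1 s2] := sf; pose s := flatten (nseq 6 (enum 'I_n)).
have [C1 h1] := schwartz_real_inv_fourier_decay s s1.
have [C2 h2] := schwartz_real_inv_fourier_decay s s2.
have J0 (z : 'rV[R]_n) : 0 < japanese_prod z.
  by apply: prodr_gt0 => i _; exact: japanese_gt0.
have hs z : (japanese_prod z ^+ 3)^-1 <= \prod_(i <- s) (1 + `|z ord0 i|).
  rewrite /s /= !big_cat big_nil /= mulr1 !big_enum /=.
  rewrite /japanese_prod /tensor -exprVn -prodfV.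
  set P := \prod_(i < n) (1 + _); set Q := \prod_(i < n) _.
  have -> : P * (P * (P * (P * (P * P)))) = (P ^+ 2) ^+ 3 by ring.
  have Q0 : 0 <= Q by apply: prodr_ge0 => i _; rewrite invr_ge0 japanese_ge0.
  rewrite lerXn2r ?nnegrE ?sqr_ge0// /P -prodrXl; apply: ler_prod => i _.
  rewrite invrK addr_ge0 ?sqr_ge0//= sqrrD expr1n mul1r real_normK ?num_real//.
  by rewrite lerD2r lerDl mulrn_wge0.
have C0 : 0 <= C1 + C2.
  rewrite addr_ge0//; [apply: le_trans (h1 0)|apply: le_trans (h2 0)];
    by rewrite mulr_ge0 ?cabs_ge0// prodr_ge0// => i _; rewrite addr_ge0.
exists (C1 + C2) => // z.
rewrite -ler_pdivrMr ?exprn_gt0//; rewrite inv_fourier_ReIm//.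
apply: le_trans (ler_wpM2l (cabs_ge0 _) (hs z)) _.
apply: le_trans (lerD (h1 z) (h2 z)); rewrite -mulrDl ler_wpM2r//.
  by rewrite prodr_ge0// => i _; rewrite addr_ge0.
apply: le_trans (cabsD _ _) _; rewrite lerD2l cabsM.
by rewrite (_ : cabs 'i%C = 1) ?mul1r// /cabs /= expr0n expr1n add0r sqrtr1.
Qed.

Lemma schwartz_continuousRe (f : 'rV[R]_n -> R[i]) : schwartz f ->
  continuous (fun w => complex.Re (f w)).
Proof. by move=> [s1 _]; exact: schwartz_real_continuous. Qed.

Lemma schwartz_continuousIm (f : 'rV[R]_n -> R[i]) : schwartz f ->
  continuous (fun w => complex.Im (f w)).
Proof. by move=> [_ s2]; exact: schwartz_real_continuous. Qed.

Lemma schwartz_Cmeasurable (f : 'rV[R]_n -> R[i]) : schwartz f -> Cmeasurable f.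
Proof.
move=> sf; split; apply: continuous_measurable_rV.
- exact: schwartz_continuousRe.
- exact: schwartz_continuousIm.
Qed.

Lemma schwartz_Cintegrable (f : 'rV[R]_n -> R[i]) : schwartz f ->
  Cintegrable (lebesgue_rV R n) f.
Proof.
move=> sf; have [s1 s2] := sf; have [m1 m2] := schwartz_Cmeasurable sf.
have [C1 h1] := schwartz_real_dominated s1.
have [C2 h2] := schwartz_real_dominated s2.
by split; [exact: integrable_dominated h1|exact: integrable_dominated h2].
Qed.

End schwartz_decay.

(** * Multipliers as convolutions *)

Section convolution.
Variables (R : realType) (n : nat).
Implicit Types (z w y : 'rV[R]_n) (f chi : 'rV[R]_n -> R[i]).
Local Notation leb := (@lebesgue_measure R).
Local Notation mu := (lebesgue_rV R n).

Lemma measurable_dotmul2 :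
  measurable_fun setT (fun p : 'rV[R]_n * 'rV[R]_n => dotmul p.1 p.2).
Proof.
apply: measurable_sum => i; apply: measurable_funM.
- exact: (measurableT_comp (measurable_rV_coord i) measurable_fst).
- exact: (measurableT_comp (measurable_rV_coord i) measurable_snd).
Qed.

Lemma dotmulC z w : dotmul z w = dotmul w z.
Proof. by apply: eq_bigr => i _; rewrite mulrC. Qed.

Lemma dotmulBl z y w : dotmul (z - y) w = dotmul z w - dotmul y w.
Proof. by rewrite /dotmul -sumrB; apply: eq_bigr => i _; rewrite !mxE mulrBl. Qed.

(** Exchange the integrals over w and y of chi(w) f(y) e^(2 pi i (z - y).w). The measurability of
    the convolution integrand is recorded as well because it comes out of the same use of Fubini. *)
Lemma inv_fourier_mul_fourier chi f z : schwartz chi -> Cintegrable mu f ->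
  inv_fourier (fun w => chi w * fourier f w) z =
    Cintegral mu (fun y => f y * inv_fourier chi (z - y)) /\
  Cmeasurable (fun y => f y * inv_fourier chi (z - y)).
Proof.
move=> schi If; have Ichi := schwartz_Cintegrable schi.
have mf := Cintegrable_measurable If; have mchi := Cintegrable_measurable Ichi.
pose F (p : 'rV[R]_n * 'rV[R]_n) := chi p.1 * f p.2 *
  expi (2 * pi * dotmul z p.1 - 2 * pi * dotmul p.2 p.1).
have mz : measurable_fun setT (fun w : 'rV[R]_n => dotmul z w).
  by apply: continuous_measurable_rV; exact: continuous_dotmul.
have mpair : measurable_fun setT (fun p : 'rV[R]_n * 'rV[R]_n => dotmul p.2 p.1).
  by under eq_fun do rewrite dotmulC; exact: measurable_dotmul2.
have IF : Cintegrable (mu \x mu)%E F.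
  apply: (@Cintegrable_le _ _ _ _ (fun p => cabs (chi p.1 * f p.2))).
  - apply: CmeasurableM.
      apply: CmeasurableM; first exact: (Cmeasurable_comp mchi).
      exact: (Cmeasurable_comp mf).
    apply: Cmeasurable_expi; apply: measurable_funB.
      apply: measurable_funM => //.
      exact: (measurableT_comp mz).
    exact: measurable_funM.
  - by apply: integrable_cabs; exact: Cintegrable_separated.
  - by move=> p; rewrite /F [cabs (_ * expi _)]cabsM cabs_expi mulr1.
have FE y : Cintegral mu (fun w => F (w, y)) = f y * inv_fourier chi (z - y).
  rewrite /inv_fourier -CintegralZl.
    by apply: eq_Cintegral => w; rewrite /F /= dotmulBl mulrBr; ring.
  apply: (@Cintegrable_le _ _ _ _ (fun w => cabs (chi w))).
  - by apply: CmeasurableM => //; exact: Cmeasurable_phase.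
  - exact: integrable_cabs.
  - by move=> w; rewrite cabsM cabs_expi mulr1.
split; last first.
  by under eq_fun do rewrite -FE; exact: (Cmeasurable_fubini2 IF).
transitivity (Cintegral (mu \x mu)%E F).
  rewrite Cfubini1//; apply: eq_Cintegral => w.
  rewrite -mulrA [fourier f w * _]mulrC mulrA /fourier -CintegralZl.
    by apply: eq_Cintegral => y; rewrite /F /= expiD; ring.
  apply: (@Cintegrable_le _ _ _ _ (fun y => cabs (f y))).
  - apply: CmeasurableM => //; apply: Cmeasurable_expi.
    apply: measurableT_comp => //; apply: measurable_funM => //.
    by under eq_fun do rewrite dotmulC; apply: continuous_measurable_rV; exact: continuous_dotmul.
  - exact: integrable_cabs.
  - by move=> y; rewrite cabsM cabs_expi mulr1.
by rewrite Cfubini2//; apply: eq_Cintegral.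
Qed.

Lemma integrable_japanese_prod_shift z :
  mu.-integrable setT (EFin \o (fun y => japanese_prod (z - y))) /\
  \int[mu]_y japanese_prod (z - y) = pi ^+ n.
Proof.
pose phi (i : 'I_n) (x : R) := japanese (z ord0 i - x).
have mphi i : measurable_fun setT (phi i).
  apply: (measurableT_comp (@measurable_japanese R)).
  by apply: measurable_funB; [exact: measurable_cst|exact: measurable_id].
have E y : japanese_prod (z - y) = tensor phi y.
  by apply: eq_bigr => i _; rewrite !mxE.
have J0 y : 0 <= japanese_prod (z - y) by exact: japanese_prod_ge0.
have int1 i : (\int[leb]_x (phi i x)%:E = pi%:E)%E.
  rewrite -integral_japanese -[RHS](integral_shift (- z ord0 i)).
  - apply: eq_integral => x _; congr EFin; rewrite /phi /japanese.
    by rewrite -[z _ _ - x]opprB sqrrN.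
  - by apply/measurable_EFinP; exact: measurable_japanese.
  - by move=> x; rewrite lee_fin japanese_ge0.
have I : (\int[mu]_y (japanese_prod (z - y))%:E = (pi ^+ n)%:E)%E.
  under eq_integral do rewrite E.
  rewrite ge0_integral_tensor//; last by move=> i x; exact: japanese_ge0.
  rewrite (eq_bigr (fun=> pi%:E)) => [|i _]; last exact: int1.
  by rewrite prodEFin prodr_const card_ord.
split; last by rewrite /Rintegral I.
apply/integrableP; split.
  apply/measurable_EFinP; under eq_fun do rewrite E.
  apply: measurable_prod => i _.
  exact: (measurableT_comp (mphi i) (measurable_rV_coord i)).
by under eq_integral do rewrite /= ger0_norm//; rewrite I ltry.
Qed.

(* The multiplier [chi] acts as convolution with a rapidly decreasing kernel,
   which preserves any slowly varying majorant. *)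
Lemma multiplier_majorant chi : schwartz chi ->
  exists2 D : R, 0 <= D & forall (f : 'rV[R]_n -> R[i]) (W : 'rV[R]_n -> R) (A : R),
    Cintegrable mu f -> (forall y, cabs (f y) <= A * W y) -> 0 <= A ->
    (forall z, 0 <= W z) ->
    (forall z y, W y * japanese_prod (z - y) ^+ 2 <= 2 ^+ n.+1 * W z) ->
    forall z, cabs (inv_fourier (fun w => chi w * fourier f w) z) <= D * A * W z.
Proof.
move=> schi; have [C C0 hC] := schwartz_inv_fourier_decay schi.
exists (2 * (C * 2 ^+ n.+1 * pi ^+ n)).
  by rewrite !mulr_ge0 ?exprn_ge0 ?pi_ge0.
move=> f W A If fA A0 W0 WP z; have [-> mfK] := inv_fourier_mul_fourier z schi If.
have [iJ eJ] := integrable_japanese_prod_shift z.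
pose B := A * C * 2 ^+ n.+1 * W z.
apply: (@le_trans _ _ (2 * \int[mu]_y (B * japanese_prod (z - y)))); last first.
  by rewrite RintegralZl// eJ le_eqVlt; apply/orP; left; apply/eqP; rewrite /B; ring.
apply: cabs_Cintegral_le.
- exact: mfK.
- by have := integrableZl measurableT B iJ; apply: eq_integrable.
- move=> y; rewrite cabsM.
  apply: (@le_trans _ _ (A * W y * (C * japanese_prod (z - y) ^+ 3))).
    by apply: ler_pM; rewrite ?cabs_ge0.
  (* Two powers of the weight go into the slow variation of [W]; the remaining one is integrated in
     [y]. *)
  rewrite (_ : _ * _ = A * C * (W y * japanese_prod (z - y) ^+ 2) * japanese_prod (z - y));
    last by ring.
  rewrite ler_wpM2r ?japanese_prod_ge0// /B -[leRHS]mulrA ler_wpM2l//.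
  exact: mulr_ge0.
Qed.

End convolution.

(** * Fourier transforms on the line *)

Section fourier_line.
Variable R : realType.
Local Notation leb := (@lebesgue_measure R).

Definition fourier1 (h : R -> R[i]) (eta : R) : R[i] :=
  Cintegral leb (fun x => h x * expi (- (2 * pi * (x * eta)))).

Lemma measurable_linear_phase (a eta : R) :
  measurable_fun setT (fun x : R => a * (x * eta)).
Proof. by apply: measurable_funM => //; apply: measurable_funM. Qed.

Lemma Cintegrable_fourier1 (h : R -> R[i]) eta : Cintegrable leb h ->
  Cintegrable leb (fun x => h x * expi (- (2 * pi * (x * eta)))).
Proof.
move=> ih; apply: (@Cintegrable_le _ _ _ leb (fun x => cabs (h x))).
- apply: CmeasurableM; first exact: Cintegrable_measurable ih.
  apply: Cmeasurable_expi; apply: measurableT_comp => //.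
  exact: measurable_linear_phase.
- exact: integrable_cabs.
- by move=> x; rewrite cabsM cabs_expi mulr1.
Qed.

Lemma fourier1Z (c : R[i]) (h : R -> R[i]) eta : Cintegrable leb h ->
  fourier1 (fun x => c * h x) eta = c * fourier1 h eta.
Proof.
move=> ih; rewrite /fourier1 -CintegralZl; last exact: Cintegrable_fourier1.
by apply: eq_Cintegral => x; rewrite -mulrA.
Qed.

Lemma fourier1D (h k : R -> R[i]) eta : Cintegrable leb h -> Cintegrable leb k ->
  fourier1 (fun x => h x + k x) eta = fourier1 h eta + fourier1 k eta.
Proof.
move=> ih ik; rewrite /fourier1 -CintegralD; [|exact: Cintegrable_fourier1..].
by apply: eq_Cintegral => x; rewrite mulrDl.
Qed.

Lemma fourier1_dilation (h : R -> R[i]) (a eta : R) : 0 < a -> Cintegrable leb h ->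
  fourier1 (fun x => h (a * x)) eta = (a^-1)%:C%C * fourier1 h (eta / a).
Proof.
move=> a0 ih.
rewrite /fourier1 -(Cintegral_affine 0 a0); last exact: Cintegrable_fourier1.
apply: eq_Cintegral => x; rewrite addr0; congr (_ * expi (- (_ * _))).
by rewrite mulrCA mulrA; field; exact: lt0r_neq0.
Qed.

Lemma fourier1_modulation (h : R -> R[i]) (t0 eta : R) :
  fourier1 (fun x => h x * expi (2 * pi * (x * t0))) eta = fourier1 h (eta - t0).
Proof.
by apply: eq_Cintegral => x; rewrite -mulrA -expiD; congr (_ * expi _); ring.
Qed.

Lemma integrable_japanese_dominated (a : R -> R) (C : R) : measurable_fun setT a ->
  (forall x, `|a x| <= C * japanese x) -> leb.-integrable setT (EFin \o a).
Proof.
move=> ma aC; apply: (@le_integrable_real _ _ _ leb (fun x => C * japanese x)) => //.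
have := integrableZl measurableT C (@integrable_japanese R).
exact: eq_integrable.
Qed.

(** Integration by parts, one trigonometric factor at a time. The identity keeps its phase, not only
    its modulus, because the transforms of the pieces of [knapp] have to add up to the wave
    symbol. *)
Lemma fourier1_derive (a a' : R -> R) (C eta : R) :
  (forall x : R, is_derive x 1 a (a' x)) -> continuous a' ->
  (forall x, `|a x| <= C * japanese x) -> (forall x, `|a' x| <= C * japanese x) ->
  fourier1 (fun x => (a' x)%:C%C) eta =
  'i%C * (2 * pi * eta)%:C%C * fourier1 (fun x => (a x)%:C%C) eta.
Proof.
move=> da ca' aC a'C.
have ca : continuous a.
  move=> x; apply/differentiable_continuous/derivable1_diffP.
  exact: (@ex_derive _ _ _ _ _ _ _ (da x)).
pose k := 2 * pi * eta.
have C0 : 0 <= C by have := le_trans (normr_ge0 _) (aC 0); rewrite pmulr_lge0// japanese_gt0.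
have cphase : continuous (fun x : R => k * x) by exact: mulrl_continuous.
have dphase (x : R) : is_derive x 1 (fun x : R => k * x) k.
  exact: (is_derive_eq (is_deriveZ k (is_derive_id x (1 : R))) (mulr1 k)).
have key (g g' : R -> R) : (forall x : R, is_derive x 1 g (g' x)) ->
    continuous g -> continuous g' ->
    (forall x, `|g x| <= 1) -> (forall x, `|g' x| <= 1) ->
    [/\ leb.-integrable setT (EFin \o (fun x => a x * g (k * x))),
        leb.-integrable setT (EFin \o (fun x => a x * g' (k * x))) &
      \int[leb]_x (a' x * g (k * x)) = - k * \int[leb]_x (a x * g' (k * x))].
  move=> dg cg cg' g1 g'1.
  have cgk : continuous (fun x => g (k * x)).
    by move=> x; apply: (continuous_comp (cphase x)); exact: cg.
  have cg'k : continuous (fun x => g' (k * x)).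
    by move=> x; apply: (continuous_comp (cphase x)); exact: cg'.
  have bd (u v : R -> R) : (forall x, `|u x| <= C * japanese x) ->
      (forall x, `|v x| <= 1) -> forall x, `|u x * v x| <= C * japanese x.
    by move=> uC v1 x; rewrite normrM (le_trans _ (uC x))// ler_piMr.
  have int (u v : R -> R) : continuous u -> continuous v ->
      (forall x, `|u x| <= C * japanese x) -> (forall x, `|v x| <= 1) ->
      leb.-integrable setT (EFin \o (fun x => u x * v x)).
    move=> cu cv uC v1; apply: (integrable_japanese_dominated _ (bd _ _ uC v1)).
    by apply: measurable_funM; exact: continuous_measurable_fun.
  have I1 := int _ _ ca' cgk a'C (fun x => g1 _).
  have I2 := int _ _ ca cg'k aC (fun x => g'1 _).
  have I3 := int _ _ ca cgk aC (fun x => g1 _).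
  split => //.
  have I2' : leb.-integrable setT (EFin \o (fun x => k * (a x * g' (k * x)))).
    by have := integrableZl measurableT k I2; apply: eq_integrable.
  have cD : continuous (fun x : R => a' x * g (k * x) + k * (a x * g' (k * x))).
    move=> x; apply: (continuousD (continuousM (ca' x) (cgk x))).
    exact: (continuousM (@cst_continuous R R k x) (continuousM (ca x) (cg'k x))).
  apply/eqP; rewrite mulNr -addr_eq0 -RintegralZl// -RintegralD//; apply/eqP.
  apply: (@integral_derive_eq0 _ (fun x => a x * g (k * x)) _ (C + `|k| * C)).
  - move=> x; have d2 := @is_derive1_comp R g (fun x => k * x) x _ _ (dg _) (dphase x).
    apply: (is_derive_eq (is_deriveM (da x) d2)).
    by rewrite /= /GRing.scale /=; ring.
  - exact: cD.
  - move=> x; apply: le_trans (bd _ _ aC (fun x => g1 _) x) _.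
    by rewrite ler_wpM2r ?japanese_ge0// lerDl mulr_ge0.
  - move=> x; apply: le_trans (ler_normD _ _) _; rewrite [`|k * _|]normrM mulrDl.
    apply: lerD; first exact: (bd _ _ a'C (fun x => g1 _)).
    by rewrite -[leRHS]mulrA ler_wpM2l//; exact: (bd _ _ aC (fun x => g'1 _)).
have [Ia Ib Ec] := key cos (fun x => - sin x) (@is_derive_cos R)
  (@continuous_cos R) ltac:(by move=> x; apply: continuousN; exact: continuous_sin)
  ltac:(by move=> x; rewrite ler_norml cos_geN1 cos_le1)
  ltac:(by move=> x; rewrite normrN ler_norml sin_geN1 sin_le1).
have [Ic _ Es] := key sin cos (@is_derive_sin R)
  (@continuous_sin R) (@continuous_cos R)
  ltac:(by move=> x; rewrite ler_norml sin_geN1 sin_le1)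
  ltac:(by move=> x; rewrite ler_norml cos_geN1 cos_le1).
have Esin : \int[leb]_x (a x * - sin (k * x)) = -1 * \int[leb]_x (a x * sin (k * x)).
  by rewrite -RintegralZl//; apply: eq_Rintegral => x _; ring.
have E (h : R -> R) : fourier1 (fun x => (h x)%:C%C) eta =
    (\int[leb]_x (h x * cos (k * x)) +i* \int[leb]_x (h x * - sin (k * x)))%C.
  have ph x : 2 * pi * (x * eta) = k * x by rewrite /k; ring.
  rewrite /fourier1 /Cintegral; congr Complex; apply: eq_Rintegral => x _.
  - by rewrite ReM /= mul0r subr0 ph cosN.
  - by rewrite ImM /= mul0r addr0 ph sinN.
(* The imaginary part carries the sine with a minus sign, so [key] is used with -sin and its
   derivative -cos. *)
have Esin' : \int[leb]_x (a' x * - sin (k * x)) = k * \int[leb]_x (a x * cos (k * x)).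
  have [_ _ En] := key (fun x => - sin x) (fun x => - cos x)
    ltac:(by move=> x; exact: is_deriveN) ltac:(by move=> x; apply: continuousN; exact: continuous_sin)
    ltac:(by move=> x; apply: continuousN; exact: continuous_cos)
    ltac:(by move=> x; rewrite normrN ler_norml sin_geN1 sin_le1)
    ltac:(by move=> x; rewrite normrN ler_norml cos_geN1 cos_le1).
  rewrite En mulNr -mulrN; congr (_ * _).
  have -> : \int[leb]_x (a x * - cos (k * x)) = -1 * \int[leb]_x (a x * cos (k * x)).
    by rewrite -RintegralZl//; apply: eq_Rintegral => x _; ring.
  by ring.
rewrite !E Ec Esin'; set X := \int[_]_x _; set Y := \int[_]_x _.
by apply: complex_eqP; rewrite !(ReM, ImM) /= /k; ring.
Qed.

(* A rational profile of nonzero mean, so that it and its first two derivatives are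
   bounded by multiples of [japanese]. *)
Definition profile (x : R) : R := japanese x ^+ 2.
Definition profile1 (x : R) : R := - (4 * x * japanese x ^+ 3).
Definition profile2 (x : R) : R :=
  - (4 * japanese x ^+ 3) + 24 * x ^+ 2 * japanese x ^+ 4.

Lemma is_derive_japanese (x : R) :
  is_derive x 1 (@japanese R) (- (2 * x * japanese x ^+ 2)).
Proof.
have d1 : is_derive x 1 (fun x : R => 1 + x ^+ 2) (2 * x).
  have := is_deriveD (is_derive_cst (1 : R) x 1) (is_deriveX 2 (is_derive_id x (1 : R))).
  move=> h; apply: (is_derive_eq h); rewrite /GRing.scale /=; ring.
have nz : 1 + x ^+ 2 != 0 by rewrite lt0r_neq0// oneD_sqr_gt0.
have := @is_deriveV R (fun x : R => 1 + x ^+ 2) x _ _ nz d1.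
move=> h; apply: (is_derive_eq h).
by rewrite /japanese /GRing.scale /= exprVn; ring.
Qed.

Lemma is_derive_profile (x : R) : is_derive x 1 profile (profile1 x).
Proof.
apply: (is_derive_eq (is_deriveX 2 (is_derive_japanese x))).
by rewrite /profile1 /GRing.scale /=; ring.
Qed.

Lemma is_derive_profile1 (x : R) : is_derive x 1 profile1 (profile2 x).
Proof.
have d3 := is_deriveX 3 (is_derive_japanese x).
have dx := is_deriveZ (4 : R) (is_derive_id x (1 : R)).
apply: (is_derive_eq (is_deriveN (is_deriveM dx d3))).
rewrite (_ : (4 \*: id) x = 4 * x)// (_ : (@japanese R ^+ 3) x = japanese x ^+ 3)//.
by rewrite /profile2 /GRing.scale /=; ring.
Qed.

Lemma normr_mul_japanese_le1 (x : R) : `|x| * japanese x <= 1.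
Proof.
rewrite /japanese ler_pdivrMr ?oneD_sqr_gt0// mul1r -real_normK ?num_real//.
have := sqr_ge0 (`|x| - 1); have := normr_ge0 x; nra.
Qed.

Lemma sqr_mul_japanese_le1 (x : R) : x ^+ 2 * japanese x <= 1.
Proof. by rewrite /japanese ler_pdivrMr ?oneD_sqr_gt0// mul1r lerDr. Qed.

Lemma profile_ge0 (x : R) : 0 <= profile x.
Proof. by rewrite exprn_ge0 ?japanese_ge0. Qed.

Lemma japaneseX_le (x : R) k : japanese x ^+ k.+1 <= japanese x.
Proof.
rewrite exprS ler_piMr ?japanese_ge0// exprn_ile1 ?japanese_ge0//.
exact: japanese_le1.
Qed.

(** The constant 28 = 4 + 24 comes from the two terms of [profile2]. It is used for all three
    functions because [fourier1_derive] wants one constant for a function and its derivative. *)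
Lemma profile_le (x : R) : `|profile x| <= 28 * japanese x.
Proof.
rewrite ger0_norm ?profile_ge0//; have := japaneseX_le x 1; have := japanese_ge0 x.
rewrite /profile; lra.
Qed.

Lemma profile1_le (x : R) : `|profile1 x| <= 28 * japanese x.
Proof.
have J0 := japanese_ge0 x; have J1 := japanese_le1 x.
have -> : `|profile1 x| = 4 * ((`|x| * japanese x) * japanese x ^+ 2).
  by rewrite /profile1 normrN 2!normrM normrX (ger0_norm J0) [`|4|]ger0_norm//; ring.
have := normr_mul_japanese_le1 x; have := japaneseX_le x 1; set u := `|x| * _; set v := _ ^+ 2 => v1 u1.
have u0 : 0 <= u by rewrite mulr_ge0.
have v0 : 0 <= v by rewrite sqr_ge0.
have : u * v <= v by rewrite ler_piMl.
lra.
Qed.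

Lemma profile2_le (x : R) : `|profile2 x| <= 28 * japanese x.
Proof.
have J0 := japanese_ge0 x; have J1 := japanese_le1 x.
rewrite /profile2 (le_trans (ler_normD _ _))// normrN.
have -> : 24 * x ^+ 2 * japanese x ^+ 4 = 24 * ((x ^+ 2 * japanese x) * japanese x ^+ 3) by ring.
have := sqr_mul_japanese_le1 x; have := japaneseX_le x 2.
set u := x ^+ 2 * _; set v := _ ^+ 3 => v1 u1.
have u0 : 0 <= u by rewrite mulr_ge0 ?sqr_ge0.
have v0 : 0 <= v by rewrite exprn_ge0.
have uv : u * v <= v by rewrite ler_piMl.
have uv0 : 0 <= u * v by rewrite mulr_ge0.
rewrite [`|4 * v|]ger0_norm; last exact: mulr_ge0.
rewrite [`|24 * _|]ger0_norm; last exact: mulr_ge0.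
lra.
Qed.

Lemma continuous_derivable_line (f f' : R -> R) :
  (forall x : R, is_derive x 1 f (f' x)) -> continuous f.
Proof.
move=> df x; apply/differentiable_continuous/derivable1_diffP.
exact: (@ex_derive _ _ _ _ _ _ _ (df x)).
Qed.

Lemma continuous_profile1 : continuous profile1.
Proof. exact: continuous_derivable_line is_derive_profile1. Qed.

Lemma continuous_profile : continuous profile.
Proof. exact: continuous_derivable_line is_derive_profile. Qed.

Lemma continuous_profile2 : continuous profile2.
Proof.
have cX k : continuous (fun x => @japanese R x ^+ k).
  by move=> x; exact: (continuous_comp (@continuous_japanese R x) (@exprn_continuous R k _)).
have c24 : continuous (fun x : R => 24 * x ^+ 2).
  by move=> x; exact: (continuousM (@cst_continuous R R 24 x) (@exprn_continuous R 2 x)).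
move=> x; have c1 := continuousM (@cst_continuous R R 4 x) (cX 3 x).
exact: (continuousD (continuousN c1) (continuousM (c24 x) (cX 4 x))).
Qed.

End fourier_line.

(** * The Fourier transform of the profile near the origin *)

Section profile_fourier.
Variable R : realType.
Local Notation leb := (@lebesgue_measure R).

(** Mean value theorem. A linear bound is enough, since the error |x| [profile x] that it produces
    is still at most [japanese x]. *)
Lemma cos_ge_1Bnorm (t : R) : 1 - `|t| <= cos t.
Proof.
wlog t0 : t / 0 <= t => [wl|].
  have [/wl//|/ltW t0] := leP 0 t.
  by have := wl (- t); rewrite cosN normrN; apply; rewrite oppr_ge0.
have [c _ ] := @MVT_segment R cos (fun x => - sin x) 0 t t0 (fun x _ => is_derive_cos x)
  (continuous_subspaceT (@continuous_cos R)).
rewrite cos0 subr0 ger0_norm// => /eqP; rewrite subr_eq => /eqP ->.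
have : - t <= - sin c * t by rewrite mulNr lerN2 ler_piMl// sin_le1.
lra.
Qed.

Lemma integrable_profile : leb.-integrable setT (EFin \o @profile R).
Proof.
apply: (integrable_japanese_dominated _ (@profile_le R)).
by apply: continuous_measurable_fun; exact: continuous_profile.
Qed.

(** On [0, 1] the profile is at least 1/4. *)
Lemma integral_profile_gt0 : 0 < \int[leb]_x profile x.
Proof.
have mI : measurable (`[0, 1] : set R) by exact: measurable_itv.
have e : (\int[leb]_(x in `[0%R, 1%R]) (4^-1)%:E = (4^-1 : R)%:E)%E.
  rewrite integral_cst//= lebesgue_measure_itv /= lte_fin ltr01 oppr0 addr0 -EFinM.
  by rewrite mulr1.
have : ((4^-1)%:E <= \int[leb]_x (profile x)%:E)%E.
  rewrite -e; apply: (@le_trans _ _ (\int[leb]_(x in `[0%R, 1%R]) (profile x)%:E)%E).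
    apply: ge0_le_integral => //.
    - by apply/measurable_EFinP; apply: measurable_funTS;
        apply: continuous_measurable_fun; exact: continuous_profile.
    - move=> x /=; rewrite in_itv /= => /andP[x0 x1]; rewrite lee_fin /profile /japanese.
      rewrite exprVn lef_pV2 ?posrE ?exprn_gt0 ?oneD_sqr_gt0//.
      rewrite (_ : 4 = 2 ^+ 2); last by rewrite -natrX.
      have ? : x ^+ 2 <= 1 by rewrite exprn_ile1.
      by rewrite lerXn2r ?nnegrE ?addr_ge0 ?sqr_ge0// -[leRHS]/(1 + 1) lerD2l.
  apply: ge0_subset_integral => //.
  - by apply/measurable_EFinP; apply: continuous_measurable_fun; exact: continuous_profile.
  - by move=> x _; rewrite lee_fin profile_ge0.
rewrite /Rintegral; have := integrable_fin_num measurableT integrable_profile.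
move=> /fineK <-; rewrite lee_fin => h; apply: lt_le_trans h.
by rewrite invr_gt0.
Qed.

(** With g the integral of the profile, the real part of the transform is at least g - 2 pi |eta|
    pi, where the last pi is the integral of [japanese]. This is at least g / 2 as soon as |eta| <=
    g / (4 pi^2). *)
Lemma fourier1_profile_near0 : exists r c : R, [/\ 0 < r, 0 < c &
  forall eta, `|eta| <= r -> c <= cabs (fourier1 (fun x => (profile x)%:C%C) eta)].
Proof.
set g := \int[leb]_x profile x.
have g0 : 0 < g by exact: integral_profile_gt0.
have p0 := pi_gt0 R.
have k0 : 0 < 2 * pi * pi :> R by rewrite !mulr_gt0.
exists (g / 2 / (2 * pi * pi)), (g / 2); split; [by rewrite !divr_gt0|by rewrite divr_gt0|].
move=> eta etar; apply: le_trans (Re_le_cabs _); apply: le_trans (ler_norm _).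
rewrite /fourier1 /Cintegral /=.
have mc : measurable_fun setT (fun x : R => cos (- (2 * pi * (x * eta)))).
  apply: (@measurableT_comp _ _ _ _ _ _ (@cos R)).
    by apply: continuous_measurable_fun; exact: continuous_cos.
  by apply: measurableT_comp => //; exact: measurable_linear_phase.
have mp : measurable_fun setT (@profile R).
  by apply: continuous_measurable_fun; exact: continuous_profile.
have ij : leb.-integrable setT (EFin \o (fun x => 2 * pi * `|eta| * japanese x)).
  have := integrableZl measurableT (2 * pi * `|eta|) (@integrable_japanese R).
  exact: eq_integrable.
have iB : leb.-integrable setT (EFin \o (fun x => profile x - 2 * pi * `|eta| * japanese x)).
  by have := integrableB measurableT integrable_profile ij; apply: eq_integrable.
apply: (@le_trans _ _ (\int[leb]_x (profile x - 2 * pi * `|eta| * japanese x))).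
  rewrite RintegralB//; last exact: integrable_profile.
  rewrite RintegralZl//; last exact: integrable_japanese.
  rewrite -/g (_ : \int[leb]_x japanese x = pi); last by rewrite /Rintegral integral_japanese.
  have : 2 * pi * `|eta| * pi <= g / 2.
    rewrite mulrAC -[leRHS](divfK (lt0r_neq0 k0)) mulrC ler_wpM2r// ltW//.
  by lra.
apply: le_Rintegral => //.
  apply: (integrable_japanese_dominated (C := 28)).
    by under eq_fun do rewrite mul0r subr0; exact: measurable_funM.
  move=> x; rewrite mul0r subr0 normrM; apply: le_trans (profile_le x).
  by rewrite ler_piMr// ler_norml cos_geN1 cos_le1.
move=> x _; rewrite mul0r subr0.
have := cos_ge_1Bnorm (- (2 * pi * (x * eta))).
rewrite normrN !normrM [`|pi|]gtr0_norm// [`|2|]gtr0_norm// => h.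
apply: le_trans (ler_wpM2l (profile_ge0 x) h).
rewrite mulrBr mulr1 lerB//.
have -> : profile x * (2 * pi * (`|x| * `|eta|)) =
  2 * pi * `|eta| * japanese x * (`|x| * japanese x) by rewrite /profile; ring.
rewrite ler_piMr ?normr_mul_japanese_le1//.
by rewrite !mulr_ge0 ?japanese_ge0// ltW.
Qed.

End profile_fourier.

Local Notation space := Defs.space.

(** * The Knapp example *)

Section sheared.
Variables (R : realType) (m : nat).
Local Notation leb := (@lebesgue_measure R).
Implicit Types (z w : 'rV[R]_m.+2) (P : 'rV[R]_m -> R[i]) (A B : R -> R[i]).

(* [time (space z)] is the spatial coordinate paired with time: the shear
   x_1 + t is dual to the null coordinate xi_1 - tau. *)
Definition sheared (P : 'rV[R]_m -> R[i]) (A B : R -> R[i]) z : R[i] :=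
  P (space (space z)) * A (time (space z)) * B (time (space z) + time z).

Lemma space_spacetime d (p : 'rV[R]_d * R) : space (spacetime p) = p.1.
Proof. by case: p => x t; have [] := spacetimeK (x, t). Qed.

Lemma time_spacetime d (p : 'rV[R]_d * R) : time (spacetime p) = p.2.
Proof. by case: p => x t; have [] := spacetimeK (x, t). Qed.

Lemma dotmulS d (z w : 'rV[R]_d.+1) :
  dotmul z w = dotmul (space z) (space w) + time z * time w.
Proof.
rewrite /dotmul (bigD1_ord ord_max)//= addrC; congr (_ + _).
by apply: eq_bigr => i _; rewrite !mxE.
Qed.

Lemma Cintegrable_space_time P A :
  Cintegrable (lebesgue_rV R m) P -> Cintegrable leb A ->
  Cintegrable (lebesgue_rV R m.+1) (fun y => P (space y) * A (time y)).
Proof.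
move=> iP iA; apply: Cintegrable_rVS.
  apply: CmeasurableM.
    exact: (Cmeasurable_comp (Cintegrable_measurable iP) (@measurable_space R m)).
  exact: (Cmeasurable_comp (Cintegrable_measurable iA) (@measurable_time R m)).
rewrite (_ : _ \o _ = fun p => P p.1 * A p.2); first exact: Cintegrable_separated.
by apply/funext => p /=; rewrite space_spacetime time_spacetime.
Qed.

Lemma Cmeasurable_sheared P A B : Cmeasurable P -> Cmeasurable A -> Cmeasurable B ->
  Cmeasurable (sheared P A B).
Proof.
move=> mP mA mB; have ms := @measurable_space R m.+1; have mt := @measurable_time R m.+1.
have mts : measurable_fun setT (fun z : 'rV[R]_m.+2 => time (space z)).
  exact: (measurableT_comp (@measurable_time R m) ms).
apply: CmeasurableM; first apply: CmeasurableM.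
- exact: (Cmeasurable_comp mP (measurableT_comp (@measurable_space R m) ms)).
- exact: (Cmeasurable_comp mA mts).
- exact: (Cmeasurable_comp mB (measurable_funD mts mt)).
Qed.

(** [B] is evaluated at s + t, so the integrand is not a product in the integration variables; by
    translation invariance the integral of |B(s + t)| in t does not depend on s, which is what
    [Cintegrable_iterated] asks for. *)
Lemma Cintegrable_sheared2 P A B :
  Cintegrable (lebesgue_rV R m) P -> Cintegrable leb A -> Cintegrable leb B ->
  Cintegrable (lebesgue_rV R m.+1 \x leb)%E (sheared P A B \o @spacetime R m.+1).
Proof.
move=> iP iA iB; have mB := Cintegrable_measurable iB.
have mS := Cmeasurable_sheared (Cintegrable_measurable iP) (Cintegrable_measurable iA) mB.
apply: (@Cintegrable_iterated _ _ _ _ _ _ _ _ (fun y => cabs (P (space y) * A (time y)))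
  (\int[leb]_t (cabs (B t))%:E)%E).
- exact: (Cmeasurable_comp mS (@measurable_spacetime R m.+1)).
- by apply: integrable_cabs; exact: Cintegrable_space_time.
- by move=> x; exact: cabs_ge0.
- apply/andP; split; first by apply: integral_ge0 => y _; rewrite lee_fin cabs_ge0.
  have /integrableP[_] := integrable_cabs iB; congr (_ < _)%E.
  by apply: eq_integral => y _ /=; rewrite ger0_norm ?cabs_ge0.
- move=> y; have mcB : measurable_fun setT (fun t => (cabs (B t))%:E).
    by apply/measurable_EFinP; exact: measurable_cabs.
  rewrite -[in leRHS](integral_shift (time y))//; last by move=> t; rewrite lee_fin cabs_ge0.
  rewrite -ge0_integralZl//.
  + rewrite le_eqVlt; apply/orP; left; apply/eqP; apply: eq_integral => t _.
    by rewrite /sheared /= space_spacetime time_spacetime cabsM EFinM [t + _]addrC.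
  + apply: (measurableT_comp mcB); apply: measurable_funD => //; exact: measurable_cst.
  + by move=> t _; rewrite lee_fin cabs_ge0.
  + by rewrite lee_fin cabs_ge0.
Qed.

Lemma Cintegrable_sheared P A B :
  Cintegrable (lebesgue_rV R m) P -> Cintegrable leb A -> Cintegrable leb B ->
  Cintegrable (lebesgue_rV R m.+2) (sheared P A B).
Proof.
move=> iP iA iB; apply: Cintegrable_rVS; last exact: Cintegrable_sheared2.
exact: (Cmeasurable_sheared (Cintegrable_measurable iP) (Cintegrable_measurable iA)
  (Cintegrable_measurable iB)).
Qed.

Lemma Cintegral_sheared P A B :
  Cintegrable (lebesgue_rV R m) P -> Cintegrable leb A -> Cintegrable leb B ->
  Cintegral (lebesgue_rV R m.+2) (sheared P A B) =
  Cintegral (lebesgue_rV R m) P * Cintegral leb A * Cintegral leb B.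
Proof.
move=> iP iA iB.
have mP := Cintegrable_measurable iP; have mA := Cintegrable_measurable iA.
have mB := Cintegrable_measurable iB.
rewrite Cintegral_rVS; last 2 first.
- exact: Cmeasurable_sheared.
- exact: Cintegrable_sheared2.
rewrite Cfubini1; last exact: Cintegrable_sheared2.
have E y : Cintegral leb (fun t => (sheared P A B \o @spacetime R m.+1) (y, t)) =
    Cintegral leb B * (P (space y) * A (time y)).
  rewrite mulrC -[X in _ * X](_ : Cintegral leb (fun t => B (1 * t + time y)) = _).
    rewrite -CintegralZl; last exact: (Cintegrable_affine (time y) ltr01 iB).
    apply: eq_Cintegral => t; rewrite /sheared /= space_spacetime time_spacetime mul1r.
    by rewrite [t + _]addrC.
  by rewrite Cintegral_affine// invr1 mul1r.
under eq_Cintegral do rewrite E.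
rewrite CintegralZl; last exact: Cintegrable_space_time.
rewrite mulrC; congr (_ * _).
rewrite Cintegral_rVS; last 2 first.
- exact: Cintegrable_measurable (Cintegrable_space_time iP iA).
- rewrite (_ : _ \o _ = fun p => P p.1 * A p.2); first exact: Cintegrable_separated.
  by apply/funext => p /=; rewrite space_spacetime time_spacetime.
rewrite -Cintegral_separated//; apply: eq_Cintegral => p /=.
by rewrite space_spacetime time_spacetime.
Qed.

Lemma Cintegrable_fourier d (f : 'rV[R]_d -> R[i]) (w : 'rV[R]_d) : Cintegrable (lebesgue_rV R d) f ->
  Cintegrable (lebesgue_rV R d) (fun z : 'rV[R]_d => f z * expi (- (2 * pi * dotmul z w))).
Proof.
move=> If; apply: (@Cintegrable_le _ _ _ _ (fun y => cabs (f y))).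
- apply: CmeasurableM; first exact: (Cintegrable_measurable If).
  apply: Cmeasurable_expi; apply: measurableT_comp => //; apply: measurable_funM => //.
  under eq_fun do rewrite dotmulC; apply: continuous_measurable_rV.
  exact: continuous_dotmul.
- exact: integrable_cabs.
- by move=> y; rewrite cabsM cabs_expi mulr1.
Qed.

(** The phase splits as x'.xi' + s (sigma - tau) + (s + t) tau. *)
Lemma fourier_sheared P A B w :
  Cintegrable (lebesgue_rV R m) P -> Cintegrable leb A -> Cintegrable leb B ->
  fourier (sheared P A B) w =
  fourier P (space (space w)) * fourier1 A (time (space w) - time w) *
  fourier1 B (time w).
Proof.
move=> iP iA iB; rewrite /fourier /fourier1 -Cintegral_sheared.
- apply: eq_Cintegral => z; rewrite /sheared.
  set x := space (space z); set s := time (space z); set t := time z.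
  have -> : - (2 * pi * dotmul z w) = - (2 * pi * dotmul x (space (space w)))
      + - (2 * pi * (s * (time (space w) - time w))) + - (2 * pi * ((s + t) * time w)).
    by rewrite 2!dotmulS -/x -/s -/t; ring.
  by rewrite !expiD; ring.
- exact: Cintegrable_fourier.
- exact: Cintegrable_fourier1.
- exact: Cintegrable_fourier1.
Qed.

Lemma fourier_tensor (phi : 'I_m -> R -> R[i]) (xi : 'rV[R]_m) :
  (forall i, Cintegrable leb (phi i)) ->
  fourier (tensor phi) xi = \prod_i fourier1 (phi i) (xi ord0 i).
Proof.
move=> iphi; rewrite /fourier /fourier1.
rewrite -(Cintegral_tensor (phi := fun i x => phi i x * expi (- (2 * pi * (x * xi ord0 i))))).
  apply: eq_Cintegral => x; rewrite /tensor big_split /=; congr (_ * _).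
  by rewrite -expi_sum sumrN -mulr_sumr.
by move=> i; exact: Cintegrable_fourier1.
Qed.

(** Two shears occur: [beta s t] depends on s + t for the majorant in physical space, and on s - t
    for the box in frequency space. *)
Lemma ge0_integral_sheared (P : 'rV[R]_m -> R) (A : R -> R) (beta : R -> R -> R) (b : R) :
  measurable_fun setT P -> measurable_fun setT A ->
  measurable_fun setT (fun q : R * R => beta q.1 q.2) ->
  (forall x, 0 <= P x) -> (forall s, 0 <= A s) -> (forall s t, 0 <= beta s t) ->
  (forall s, \int[leb]_t (beta s t)%:E = b%:E)%E ->
  (\int[lebesgue_rV R m.+2]_z (P (space (space z)) * A (time (space z)) *
     beta (time (space z)) (time z))%:E =
   \int[lebesgue_rV R m]_x (P x)%:E * \int[leb]_s (A s)%:E * b%:E)%E.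
Proof.
move=> mP mA mbeta P0 A0 beta0 ib.
have b0 : 0 <= b by rewrite -lee_fin -(ib 0); apply: integral_ge0 => t _; rewrite lee_fin.
have ms := @measurable_space R m.+1; have mt := @measurable_time R m.+1.
have mts : measurable_fun setT (fun z : 'rV[R]_m.+2 => time (space z)).
  exact: (measurableT_comp (@measurable_time R m) ms).
have mPA : measurable_fun setT (fun y : 'rV[R]_m.+1 => P (space y) * A (time y)).
  apply: measurable_funM; first exact: (measurableT_comp mP (@measurable_space R m)).
  exact: (measurableT_comp mA (@measurable_time R m)).
have mbs s : measurable_fun [set: R] (beta s).
  exact: (measurableT_comp mbeta (pair1_measurable s)).
rewrite ge0_integral_rVS; last 2 first.
- apply/measurable_EFinP; apply: measurable_funM.
    exact: (measurableT_comp mPA ms).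
  exact: (measurableT_comp mbeta (measurable_fun_pair mts mt)).
- by move=> z; rewrite lee_fin !mulr_ge0.
transitivity (\int[lebesgue_rV R m.+1]_y ((P (space y) * A (time y))%:E * b%:E))%E.
  apply: eq_integral => y _; rewrite -(ib (time y)) -ge0_integralZl//.
  - by apply: eq_integral => t _; rewrite space_spacetime time_spacetime EFinM.
  - apply/measurable_EFinP.
    exact: mbs.
  - by move=> t _; rewrite lee_fin.
  - by rewrite lee_fin mulr_ge0.
rewrite ge0_integralZr//=; last 2 first.
- by apply/measurable_EFinP.
- by move=> y _; rewrite lee_fin mulr_ge0.
congr (_ * _)%E; rewrite ge0_integral_rVS; last 2 first.
- by apply/measurable_EFinP.
- by move=> y; rewrite lee_fin mulr_ge0.
transitivity (\int[lebesgue_rV R m]_x ((P x)%:E * \int[leb]_s (A s)%:E))%E.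
  apply: eq_integral => x _; rewrite -ge0_integralZl//.
  - by apply: eq_integral => t _; rewrite space_spacetime time_spacetime EFinM.
  - by apply/measurable_EFinP.
  - by move=> t _; rewrite lee_fin.
  - by rewrite lee_fin.
rewrite ge0_integralZr//=.
- by apply/measurable_EFinP.
- by move=> y _; rewrite lee_fin.
- by apply: integral_ge0 => s _; rewrite lee_fin.
Qed.

End sheared.

(** * The wave packet and its image under the wave operator *)

Section knapp.
Variables (R : realType) (m : nat) (t0 : R).
Local Notation leb := (@lebesgue_measure R).
Implicit Types (w z : 'rV[R]_m.+2).

Definition profile_hat (eta : R) : R[i] := fourier1 (fun x => (profile x)%:C%C) eta.

(** The symbol of d/dx when the Fourier transform has 2 pi in the exponent. *)
Definition dsymbol (eta : R) : R[i] := 'i%C * (2 * pi * eta)%:C%C.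

Lemma fourier1_profile1 eta :
  fourier1 (fun x => (profile1 x)%:C%C) eta = dsymbol eta * profile_hat eta.
Proof.
exact: (fourier1_derive _ (@is_derive_profile R) (@continuous_profile1 R)
  (@profile_le R) (@profile1_le R)).
Qed.

Lemma fourier1_profile2 eta :
  fourier1 (fun x => (profile2 x)%:C%C) eta = dsymbol eta ^+ 2 * profile_hat eta.
Proof.
rewrite (fourier1_derive _ (@is_derive_profile1 R) (@continuous_profile2 R)
  (@profile1_le R) (@profile2_le R)) fourier1_profile1.
by rewrite expr2 mulrA.
Qed.

Lemma Cintegrable_line (h : R -> R) : continuous h ->
  (forall x, `|h x| <= 28 * japanese x) -> Cintegrable leb (fun x => (h x)%:C%C).
Proof.
move=> ch hJ; apply: integrable_real_complex.
by apply: (integrable_japanese_dominated _ hJ); exact: continuous_measurable_fun.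
Qed.

Lemma Cintegrable_profile : Cintegrable leb (fun x => (profile x)%:C%C).
Proof. by apply: Cintegrable_line; [exact: continuous_profile|exact: profile_le]. Qed.

Lemma Cintegrable_profile1 : Cintegrable leb (fun x => (profile1 x)%:C%C).
Proof. by apply: Cintegrable_line; [exact: continuous_profile1|exact: profile1_le]. Qed.

Lemma Cintegrable_profile2 : Cintegrable leb (fun x => (profile2 x)%:C%C).
Proof. by apply: Cintegrable_line; [exact: continuous_profile2|exact: profile2_le]. Qed.

(** With [phi] the k-th derivative of [profile], this is the k-th derivative of the dilate of
    [profile] by [a]. *)
Definition scaled (k : nat) (phi : R -> R) (a : R) (x : R) : R[i] :=
  (a ^+ k * phi (a * x))%:C%C.

Lemma scaledE k phi a : scaled k phi a =
  (fun x => (a ^+ k)%:C%C * (phi (a * x))%:C%C).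
Proof. by apply/funext => x; rewrite /scaled rmorphM. Qed.

Lemma Cintegrable_scaled k phi a : 0 < a ->
  Cintegrable leb (fun x => (phi x)%:C%C) -> Cintegrable leb (scaled k phi a).
Proof.
move=> a0 iphi; rewrite scaledE; apply: CintegrableZl.
have := Cintegrable_affine 0 a0 iphi.
by under eq_fun do rewrite addr0.
Qed.

Lemma fourier1_scaled k phi a eta : 0 < a ->
  Cintegrable leb (fun x => (phi x)%:C%C) ->
  (forall xi, fourier1 (fun x => (phi x)%:C%C) xi = dsymbol xi ^+ k * profile_hat xi) ->
  fourier1 (scaled k phi a) eta =
  dsymbol eta ^+ k * ((a^-1)%:C%C * profile_hat (eta / a)).
Proof.
move=> a0 iphi Fphi; rewrite scaledE fourier1Z; last first.
  have := Cintegrable_affine 0 a0 iphi.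
  by under eq_fun do rewrite addr0.
rewrite (fourier1_dilation (h := fun x => (phi x)%:C%C))// Fphi.
have -> : dsymbol (eta / a) = (a^-1)%:C%C * dsymbol eta.
  by rewrite /dsymbol [RHS]mulrCA -rmorphM; congr (_ * _%:C%C); ring.
have e : (a ^+ k)%:C%C * (a^-1)%:C%C ^+ k = 1.
  by rewrite -rmorphXn -rmorphM -exprMn divff ?lt0r_neq0// expr1n rmorph1.
rewrite exprMn -[RHS]mul1r -e; ring.
Qed.

Definition modulated (s : R) : R[i] := (profile s)%:C%C * expi (2 * pi * (s * t0)).

(** The derivative of [modulated], by the product rule. *)
Definition modulated1 (s : R) : R[i] :=
  (profile1 s)%:C%C * expi (2 * pi * (s * t0)) + dsymbol t0 * modulated s.

Lemma Cintegrable_modulation (h : R -> R[i]) : Cintegrable leb h ->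
  Cintegrable leb (fun s => h s * expi (2 * pi * (s * t0))).
Proof.
move=> ih; apply: (@Cintegrable_le _ _ _ leb (fun x => cabs (h x))).
- apply: CmeasurableM; first exact: Cintegrable_measurable ih.
  by apply: Cmeasurable_expi; exact: measurable_linear_phase.
- exact: integrable_cabs.
- by move=> x; rewrite cabsM cabs_expi mulr1.
Qed.

Lemma Cintegrable_modulated : Cintegrable leb modulated.
Proof. exact: Cintegrable_modulation Cintegrable_profile. Qed.

Lemma Cintegrable_modulated1 : Cintegrable leb modulated1.
Proof.
apply: CintegrableD; first exact: Cintegrable_modulation Cintegrable_profile1.
by apply: CintegrableZl; exact: Cintegrable_modulated.
Qed.

Lemma fourier1_modulated tau : fourier1 modulated tau = profile_hat (tau - t0).
Proof. exact: fourier1_modulation. Qed.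

Lemma fourier1_modulated1 tau :
  fourier1 modulated1 tau = dsymbol tau * profile_hat (tau - t0).
Proof.
rewrite fourier1D; last 2 first.
- exact: Cintegrable_modulation Cintegrable_profile1.
- by apply: CintegrableZl; exact: Cintegrable_modulated.
rewrite fourier1_modulation fourier1_profile1 fourier1Z; last exact: Cintegrable_modulated.
rewrite fourier1_modulated -mulrDl; congr (_ * _).
by rewrite /dsymbol -mulrDr -rmorphD; congr (_ * _%:C%C); ring.
Qed.

Section scale.
Variable eps : R.
Hypotheses (eps0 : 0 < eps) (eps1 : eps <= 1).

Let eps20 : 0 < eps ^+ 2. Proof. exact: exprn_gt0. Qed.

Definition packet : 'rV[R]_m -> R[i] := tensor (fun _ => scaled 0 (@profile R) eps).

(** The second derivative of [packet] in the i-th coordinate. *)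
Definition packet2 (i : 'I_m) : 'rV[R]_m -> R[i] :=
  tensor (fun j => if j == i then scaled 2 (@profile2 R) eps else scaled 0 (@profile R) eps).

(* Up to a constant this is the wave operator applied to the Knapp wave packet
   [sheared packet (scaled 0 (@profile R) (eps ^+ 2)) modulated], so its Fourier
   transform carries the wave symbol as a factor. *)
Definition knapp z : R[i] :=
  sheared packet (scaled 2 (@profile2 R) (eps ^+ 2)) modulated z +
  2 * sheared packet (scaled 1 (@profile1 R) (eps ^+ 2)) modulated1 z +
  \sum_i sheared (packet2 i) (scaled 0 (@profile R) (eps ^+ 2)) modulated z.

(** The Fourier transform of the wave packet itself, at scale eps in xi', eps^2 in sigma - tau and 1
    in tau - t0. *)
Definition knapp_hat w : R[i] :=
  (\prod_i ((eps^-1)%:C%C * profile_hat (space (space w) ord0 i / eps))) *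
  (((eps ^+ 2)^-1)%:C%C *
    profile_hat ((time (space w) - time w) / eps ^+ 2)) *
  profile_hat (time w - t0).

Let ik0 a : 0 < a -> Cintegrable leb (scaled 0 (@profile R) a).
Proof. by move=> a0; apply: Cintegrable_scaled => //; exact: Cintegrable_profile. Qed.

Let ik1 a : 0 < a -> Cintegrable leb (scaled 1 (@profile1 R) a).
Proof. by move=> a0; apply: Cintegrable_scaled => //; exact: Cintegrable_profile1. Qed.

Let ik2 a : 0 < a -> Cintegrable leb (scaled 2 (@profile2 R) a).
Proof. by move=> a0; apply: Cintegrable_scaled => //; exact: Cintegrable_profile2. Qed.

Let Fk0 a eta : 0 < a ->
  fourier1 (scaled 0 (@profile R) a) eta = (a^-1)%:C%C * profile_hat (eta / a).
Proof.
move=> a0; rewrite fourier1_scaled ?expr0 ?mul1r//; first exact: Cintegrable_profile.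
by move=> xi; rewrite expr0 mul1r.
Qed.

Let Fk1 a eta : 0 < a -> fourier1 (scaled 1 (@profile1 R) a) eta =
  dsymbol eta * ((a^-1)%:C%C * profile_hat (eta / a)).
Proof.
move=> a0; rewrite fourier1_scaled ?expr1//; first exact: Cintegrable_profile1.
by move=> xi; rewrite expr1; exact: fourier1_profile1.
Qed.

Let Fk2 a eta : 0 < a -> fourier1 (scaled 2 (@profile2 R) a) eta =
  dsymbol eta ^+ 2 * ((a^-1)%:C%C * profile_hat (eta / a)).
Proof.
move=> a0; rewrite fourier1_scaled//; first exact: Cintegrable_profile2.
by move=> xi; exact: fourier1_profile2.
Qed.

Let ipacket : Cintegrable (lebesgue_rV R m) packet.
Proof. by apply: Cintegrable_tensor => i; exact: ik0. Qed.

Let ipacket2 i : Cintegrable (lebesgue_rV R m) (packet2 i).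
Proof. by apply: Cintegrable_tensor => j; case: ifPn => _; [exact: ik2|exact: ik0]. Qed.

Lemma Cintegrable_knapp : Cintegrable (lebesgue_rV R m.+2) knapp.
Proof.
apply: CintegrableD; first apply: CintegrableD.
- exact: (Cintegrable_sheared ipacket (ik2 eps20) Cintegrable_modulated).
- apply: CintegrableZl.
  exact: (Cintegrable_sheared ipacket (ik1 eps20) Cintegrable_modulated1).
- apply: Cintegrable_sum => i.
  exact: (Cintegrable_sheared (ipacket2 i) (ik0 eps20) Cintegrable_modulated).
Qed.

Lemma wave_symbolE w : wave_symbol w =
  dotmul (space (space w)) (space (space w)) + time (space w) ^+ 2 - time w ^+ 2.
Proof.
rewrite /wave_symbol /enorm sqr_sqrtr; first by rewrite dotmulS -expr2.
by apply: sumr_ge0 => i _; rewrite -expr2 sqr_ge0.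
Qed.

(** With u = sigma - tau the symbol is u^2 + 2 u tau + |xi'|^2, and the three summands of [knapp]
    contribute these terms in turn; -4 pi^2 is the square of 2 pi i. *)
Lemma fourier_knapp w : fourier knapp w =
  (- (4 * pi ^+ 2 * wave_symbol w))%:C%C * knapp_hat w.
Proof.
have i1 := Cintegrable_sheared ipacket (ik2 eps20) Cintegrable_modulated.
have i2 := Cintegrable_sheared ipacket (ik1 eps20) Cintegrable_modulated1.
have i3 i := Cintegrable_sheared (ipacket2 i) (ik0 eps20) Cintegrable_modulated.
have E : fourier knapp w =
    fourier (sheared packet (scaled 2 (@profile2 R) (eps ^+ 2)) modulated) w +
    2 * fourier (sheared packet (scaled 1 (@profile1 R) (eps ^+ 2)) modulated1) w +
    \sum_i fourier (sheared (packet2 i) (scaled 0 (@profile R) (eps ^+ 2)) modulated) w.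
  rewrite /fourier -CintegralZl; last exact: Cintegrable_fourier.
  rewrite -Cintegral_sum; last by move=> i; exact: Cintegrable_fourier.
  rewrite -CintegralD; [|exact: Cintegrable_fourier|
    by apply: CintegrableZl; exact: Cintegrable_fourier].
  rewrite -CintegralD; last 2 first.
  - apply: CintegrableD; first exact: Cintegrable_fourier.
    by apply: CintegrableZl; exact: Cintegrable_fourier.
  - by apply: Cintegrable_sum => i; exact: Cintegrable_fourier.
  by apply: eq_Cintegral => z; rewrite /knapp !mulrDl mulr_suml mulrA.
set xi := space (space w); set u := time (space w) - time w.
have Fp : fourier packet xi = \prod_i ((eps^-1)%:C%C * profile_hat (xi ord0 i / eps)).
  rewrite fourier_tensor; last by move=> i; exact: ik0.
  by apply: eq_bigr => i _; rewrite Fk0.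
have Fp2 i : fourier (packet2 i) xi = dsymbol (xi ord0 i) ^+ 2 * fourier packet xi.
  rewrite fourier_tensor; last by move=> j; case: ifPn => _; [exact: ik2|exact: ik0].
  rewrite Fp [LHS](bigD1 i)//= [in RHS](bigD1 i)//= eqxx Fk2// -[LHS]mulrA; congr (_ * (_ * _)).
  by apply: eq_bigr => j /negbTE ->; rewrite Fk0.
rewrite E !fourier_sheared//; [|exact: ik1|exact: Cintegrable_modulated1|exact: ik2|
  exact: Cintegrable_modulated].
rewrite (eq_bigr (fun i => dsymbol (xi ord0 i) ^+ 2 * knapp_hat w)); last first.
  move=> i _; rewrite fourier_sheared//; last 2 first.
  - exact: ik0.
  - exact: Cintegrable_modulated.
  rewrite -/xi Fp2 Fp Fk0// fourier1_modulated /knapp_hat -/xi.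
  by rewrite !mulrA.
rewrite -/xi -/u Fp Fk1// Fk2// fourier1_modulated fourier1_modulated1.
rewrite -mulr_suml wave_symbolE -/xi.
have dE x y : dsymbol x * dsymbol y = (- (4 * pi ^+ 2 * (x * y)))%:C%C.
  apply: complex_eqP; rewrite /dsymbol !(ReM, ImM) /=; ring.
have -> : (- (4 * pi ^+ 2 * (dotmul xi xi + time (space w) ^+ 2 - time w ^+ 2)))%:C%C =
    dsymbol u ^+ 2 + 2 * (dsymbol u * dsymbol (time w)) + \sum_i dsymbol (xi ord0 i) ^+ 2.
  rewrite (eq_bigr (fun i => (- (4 * pi ^+ 2 * (xi ord0 i * xi ord0 i)))%:C%C)); last first.
    by move=> i _; rewrite expr2 dE.
  rewrite -rmorph_sum [dsymbol u ^+ 2]expr2 !dE sumrN -mulr_sumr -/(dotmul xi xi).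
  have -> : (2 : R[i]) = (2 : R)%:C%C by rewrite rmorph_nat.
  by apply: complex_eqP; rewrite !(ReD, ImD, ReM, ImM) /= /u; ring.
rewrite /knapp_hat -/xi -/u !mulrDl; congr (_ + _ + _); ring.
Qed.

(** The envelope of the packet: lengths 1/eps in x', 1/eps^2 in s and 1 in s + t. It is built from
    [japanese], not from its square [profile], as it also has to dominate the derivatives. *)
Definition majorant z : R :=
  (\prod_i japanese (eps * space (space z) ord0 i)) *
  japanese (eps ^+ 2 * time (space z)) * japanese (time (space z) + time z).

(** One summand for each term of [knapp]: 28 is the constant of the profile, 28 + 2 |pi t0| bounds
    [modulated1], and [m] counts the transverse second derivatives. *)
Definition knapp_const : R := 28 + 2 * 28 * (28 + 2 * `|pi * t0|) + m%:R * 28.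

Lemma majorant_ge0 z : 0 <= majorant z.
Proof. by rewrite !mulr_ge0 ?japanese_ge0// prodr_ge0// => i _; exact: japanese_ge0. Qed.

Lemma majorant_le1 z : majorant z <= 1.
Proof.
rewrite /majorant !mulr_ile1 ?mulr_ge0 ?japanese_ge0 ?japanese_le1//.
- by apply: prodr_ge0 => i _; exact: japanese_ge0.
- by apply: prodr_ge0 => i _; exact: japanese_ge0.
- by apply: prodr_ile1 => i; rewrite japanese_ge0 japanese_le1.
Qed.

Lemma cabs_scaled0 a x : cabs (scaled 0 (@profile R) a x) <= japanese (a * x).
Proof.
by rewrite /scaled expr0 mul1r cabs_real ger0_norm ?profile_ge0// japaneseX_le.
Qed.

Lemma cabs_scaled1 a x : 0 <= a ->
  cabs (scaled 1 (@profile1 R) a x) <= a * 28 * japanese (a * x).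
Proof.
move=> a0; rewrite /scaled expr1 cabs_real normrM ger0_norm// -mulrA ler_wpM2l//.
exact: profile1_le.
Qed.

Lemma cabs_scaled2 a x : 0 <= a ->
  cabs (scaled 2 (@profile2 R) a x) <= a ^+ 2 * 28 * japanese (a * x).
Proof.
move=> a0; rewrite /scaled cabs_real normrM ger0_norm ?sqr_ge0// -mulrA ler_wpM2l ?sqr_ge0//.
exact: profile2_le.
Qed.

Lemma cabs_modulated s : cabs (modulated s) <= japanese s.
Proof.
by rewrite cabsM cabs_expi mulr1 cabs_real ger0_norm ?profile_ge0// japaneseX_le.
Qed.

Lemma cabs_modulated1 s : cabs (modulated1 s) <= (28 + 2 * `|pi * t0|) * japanese s.
Proof.
apply: le_trans (cabsD _ _) _; rewrite [leRHS]mulrDl; apply: lerD.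
  by rewrite cabsM cabs_expi mulr1 cabs_real; exact: profile1_le.
rewrite cabsM ler_pM ?cabs_ge0 ?cabs_modulated//.
rewrite /dsymbol cabsM cabs_real (_ : cabs 'i%C = 1).
  by rewrite mul1r -mulrA normrM ger0_norm.
by rewrite /cabs /= expr0n expr1n add0r sqrtr1.
Qed.

Lemma cabs_packet x : cabs (packet x) <= \prod_i japanese (eps * x ord0 i).
Proof.
rewrite /packet /tensor cabs_prod; apply: ler_prod => i _.
by rewrite cabs_ge0 cabs_scaled0.
Qed.

Lemma cabs_packet2 i x :
  cabs (packet2 i x) <= eps ^+ 2 * 28 * \prod_i japanese (eps * x ord0 i).
Proof.
rewrite /packet2 /tensor cabs_prod (bigD1 i)//= eqxx [in leRHS](bigD1 i)//= mulrA.
apply: ler_pM; rewrite ?cabs_ge0//.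
- by apply: prodr_ge0 => j _; exact: cabs_ge0.
- by apply: cabs_scaled2; exact: ltW.
- by apply: ler_prod => j /negbTE ->; rewrite cabs_ge0 cabs_scaled0.
Qed.

Lemma cabs_sheared P A B z : cabs (sheared P A B z) =
  cabs (P (space (space z))) * cabs (A (time (space z))) *
  cabs (B (time (space z) + time z)).
Proof. by rewrite /sheared 2!cabsM. Qed.

(** A second derivative in s gains eps^4, which is weakened to eps^2 by [eps <= 1]; a first
    derivative in s and a transverse second derivative gain eps^2 each. *)
Lemma cabs_knapp z : cabs (knapp z) <= eps ^+ 2 * knapp_const * majorant z.
Proof.
set x := space (space z); set s := time (space z); set t := time z.
pose P := \prod_i japanese (eps * x ord0 i); pose A := japanese (eps ^+ 2 * s).
pose B := japanese (s + t).
have P0 : 0 <= P by apply: prodr_ge0 => i _; exact: japanese_ge0.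
have A0 : 0 <= A by exact: japanese_ge0.
have B0 : 0 <= B by exact: japanese_ge0.
have e0 := ltW eps20.
have e1 : eps ^+ 2 <= 1 by rewrite exprn_ile1// ltW.
have S1 : cabs (sheared packet (scaled 2 (@profile2 R) (eps ^+ 2)) modulated z) <=
    eps ^+ 2 * 28 * majorant z.
  rewrite cabs_sheared (_ : _ * majorant z = P * (eps ^+ 2 * 28 * A) * B); last first.
    by rewrite /majorant /P /A /B; ring.
  apply: ler_pM; rewrite ?mulr_ge0 ?cabs_ge0//; last exact: cabs_modulated.
  apply: ler_pM; rewrite ?cabs_ge0 ?cabs_packet//.
  apply: le_trans (cabs_scaled2 _ e0) _; rewrite ler_wpM2r// ler_wpM2r//.
  by rewrite expr2 ler_piMr.
have S2 : cabs (sheared packet (scaled 1 (@profile1 R) (eps ^+ 2)) modulated1 z) <=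
    eps ^+ 2 * 28 * (28 + 2 * `|pi * t0|) * majorant z.
  rewrite cabs_sheared (_ : _ * majorant z =
    P * (eps ^+ 2 * 28 * A) * ((28 + 2 * `|pi * t0|) * B)); last first.
    by rewrite /majorant /P /A /B; ring.
  apply: ler_pM; rewrite ?mulr_ge0 ?cabs_ge0//; last exact: cabs_modulated1.
  apply: ler_pM; rewrite ?cabs_ge0 ?cabs_packet//.
  exact: cabs_scaled1.
have S3 i : cabs (sheared (packet2 i) (scaled 0 (@profile R) (eps ^+ 2)) modulated z) <=
    eps ^+ 2 * 28 * majorant z.
  rewrite cabs_sheared (_ : _ * majorant z = (eps ^+ 2 * 28 * P) * A * B); last first.
    by rewrite /majorant /P /A /B; ring.
  apply: ler_pM; rewrite ?mulr_ge0 ?cabs_ge0//; last exact: cabs_modulated.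
  apply: ler_pM; rewrite ?cabs_ge0 ?cabs_packet2//.
  exact: cabs_scaled0.
have S3' : cabs (\sum_i sheared (packet2 i) (scaled 0 (@profile R) (eps ^+ 2)) modulated z) <=
    m%:R * (eps ^+ 2 * 28 * majorant z).
  apply: le_trans (_ : _ <= \sum_i cabs (sheared (packet2 i) (scaled 0 (@profile R) (eps ^+ 2)) modulated z)) _.
    elim/big_ind2 : _ => [|c1 r1 c2 r2 h1 h2|//]; first by rewrite /cabs Normc.normc0.
    by apply: le_trans (cabsD _ _) _; exact: lerD.
  apply: (@le_trans _ _ (\sum_(i < m) eps ^+ 2 * 28 * majorant z)).
    by apply: ler_sum => i _; exact: S3.
  by rewrite sumr_const card_ord mulr_natl.
rewrite /knapp (le_trans (cabsD _ _))//.
apply: le_trans (lerD (cabsD _ _) S3') _.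
have c2 : cabs (2 : R[i]) = 2.
  by rewrite (_ : (2 : R[i]) = (2 : R)%:C%C) ?cabs_real ?ger0_norm// rmorph_nat.
rewrite [cabs (2 * _)]cabsM c2.
apply: le_trans (lerD (lerD S1 (ler_wpM2l _ S2)) (lexx _)) _ => //.
rewrite le_eqVlt; apply/orP; left; apply/eqP; rewrite /knapp_const; ring.
Qed.

End scale.
End knapp.

(** * Norm bounds *)

Section majorant_theory.
Variables (R : realType) (m : nat).
Local Notation leb := (@lebesgue_measure R).
Implicit Types (w z y : 'rV[R]_m.+2).

(** Peetre's inequality, uniform in the scale: y^2 <= 2 x^2 + 2 (y - x)^2, and [a <= 1] bounds a^2
    (y - x)^2 by (y - x)^2. *)
Lemma japanese_peetre (a x y : R) : 0 <= a <= 1 ->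
  japanese (a * x) * japanese (y - x) <= 2 * japanese (a * y).
Proof.
move=> /andP[a0 a1]; rewrite /japanese -invfM -[2]invrK -invfM lef_pV2 ?posrE; last 2 first.
- by rewrite mulr_gt0 ?oneD_sqr_gt0.
- by rewrite mulr_gt0 ?invr_gt0 ?oneD_sqr_gt0.
rewrite mulrC ler_pdivrMr// !exprMn.
have h1 : a ^+ 2 <= 1 by rewrite exprn_ile1.
have h0 : 0 <= a ^+ 2 by rewrite sqr_ge0.
have h2 : 0 <= (y - x) ^+ 2 by rewrite sqr_ge0.
have h3 : 0 <= x ^+ 2 by rewrite sqr_ge0.
have h4 : a ^+ 2 * (y - x) ^+ 2 <= (y - x) ^+ 2 by rewrite ler_piMl.
have h5 : y ^+ 2 <= 2 * x ^+ 2 + 2 * (y - x) ^+ 2.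
  by have := sqr_ge0 (y - 2 * x); rewrite !expr2; lra.
have h6 : a ^+ 2 * y ^+ 2 <= a ^+ 2 * (2 * x ^+ 2 + 2 * (y - x) ^+ 2) by rewrite ler_wpM2l.
have h7 : 0 <= a ^+ 2 * x ^+ 2 * (y - x) ^+ 2 by exact: mulr_ge0 (mulr_ge0 h0 h3) h2.
rewrite mulrDr in h6.
have -> : (1 + a ^+ 2 * x ^+ 2) * (1 + (y - x) ^+ 2) * 2 =
  2 + 2 * (a ^+ 2 * x ^+ 2) + 2 * (y - x) ^+ 2 + 2 * (a ^+ 2 * x ^+ 2 * (y - x) ^+ 2) by ring.
lra.
Qed.

Lemma japanese_prod_space d (z : 'rV[R]_d.+1) :
  japanese_prod z = japanese_prod (space z) * japanese (time z).
Proof. by rewrite -{1}(space_timeK z) japanese_prodS. Qed.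

Lemma spaceB d (z y : 'rV[R]_d.+1) : space (z - y) = space z - space y.
Proof. by apply/rowP => i; rewrite !mxE. Qed.

Lemma timeB d (z y : 'rV[R]_d.+1) : time (z - y) = time z - time y.
Proof. by rewrite /time !mxE. Qed.

(** The weight is squared because the difference in s is spent twice: on the variable s and,
    together with the difference in t, on s + t. The constant is 2^m from x', 2 from s and 4 from s
    + t, where Peetre's inequality is used twice; it does not depend on [eps]. *)
Lemma majorant_slowly_varying (eps : R) z y : 0 <= eps <= 1 ->
  majorant eps y * japanese_prod (z - y) ^+ 2 <= 2 ^+ m.+3 * majorant eps z.
Proof.
move=> /andP[e0 e1]; rewrite !japanese_prod_space !spaceB !timeB.
set x := space (space z); set x' := space (space y).
set s := time (space z); set s' := time (space y); set t := time z; set t' := time y.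
set X := japanese_prod (x - x'); set S := japanese (s - s'); set T := japanese (t - t').
have X0 : 0 <= X by exact: japanese_prod_ge0.
have X1 : X <= 1 by apply: prodr_ile1 => i; rewrite japanese_ge0 japanese_le1.
have S0 : 0 <= S by exact: japanese_ge0.
have T0 : 0 <= T by exact: japanese_ge0.
have T1 : T <= 1 by exact: japanese_le1.
set P := \prod_i japanese (eps * x' ord0 i).
have P0 : 0 <= P by apply: prodr_ge0 => i _; exact: japanese_ge0.
have PX : P * X <= 2 ^+ m * \prod_i japanese (eps * x ord0 i).
  rewrite /P /X /japanese_prod /tensor -big_split /= -[m in 2 ^+ m]card_ord -prodr_const -big_split /=.
  apply: ler_prod => i _; rewrite mulr_ge0 ?japanese_ge0//= !mxE.
  by apply: japanese_peetre; rewrite e0.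
have AS : japanese (eps ^+ 2 * s') * S <= 2 * japanese (eps ^+ 2 * s).
  by apply: japanese_peetre; rewrite sqr_ge0 exprn_ile1.
have BST : japanese (s' + t') * (S * T) <= 4 * japanese (s + t).
  have ST : S * T <= 2 * japanese ((s + t) - (s' + t')).
    rewrite (_ : T = japanese ((s + t) - (s' + t') - (s - s'))); last by rewrite /T; congr japanese; ring.
    by have := @japanese_peetre 1 (s - s') ((s + t) - (s' + t')); rewrite !mul1r lexx ler01; apply.
  apply: le_trans (ler_wpM2l (japanese_ge0 _) ST) _.
  have := @japanese_peetre 1 (s' + t') (s + t); rewrite !mul1r lexx ler01 => /(_ isT).
  by rewrite mulrCA; lra.
(* The factors that are left over, [X * T], are at most 1. *)
have -> : majorant eps y * (X * S * T) ^+ 2 =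
  (P * X) * (japanese (eps ^+ 2 * s') * S) * (japanese (s' + t') * (S * T)) * (X * T).
  by rewrite /majorant -/x' -/s' -/t' -/P; ring.
apply: (@le_trans _ _ ((P * X) * (japanese (eps ^+ 2 * s') * S) * (japanese (s' + t') * (S * T)))).
  by rewrite ler_piMr ?mulr_ge0 ?japanese_ge0// mulr_ile1.
have -> : 2 ^+ m.+3 * majorant eps z = (2 ^+ m * \prod_i japanese (eps * x ord0 i)) *
    (2 * japanese (eps ^+ 2 * s)) * (4 * japanese (s + t)).
  by rewrite /majorant -/x -/s -/t !exprS; ring.
have PX0 : 0 <= P * X by exact: mulr_ge0.
have AS0 : 0 <= japanese (eps ^+ 2 * s') * S by rewrite mulr_ge0 ?japanese_ge0.
have BST0 : 0 <= japanese (s' + t') * (S * T) by rewrite !mulr_ge0 ?japanese_ge0.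
exact: ler_pM (mulr_ge0 PX0 AS0) BST0 (ler_pM PX0 AS0 PX AS) BST.
Qed.

Lemma measurable_japaneseM (a : R) : measurable_fun setT (fun x : R => japanese (a * x)).
Proof. exact: (measurableT_comp (@measurable_japanese R) (@mulrl_measurable R setT a)). Qed.

Lemma integral_japaneseM (a : R) : 0 < a ->
  (\int[leb]_x (japanese (a * x))%:E = (a^-1 * pi)%:E)%E.
Proof.
move=> a0; have := ge0_integral_affine 0 a0 (f := fun x => (japanese x)%:E).
rewrite integral_japanese -EFinM => <-.
- by under [RHS]eq_integral do rewrite addr0.
- by apply/measurable_EFinP; exact: measurable_japanese.
- by move=> x; rewrite lee_fin japanese_ge0.
Qed.

Lemma measurable_prod_coord d (phi : R -> R) : measurable_fun setT phi ->
  measurable_fun setT (fun x : 'rV[R]_d => \prod_i phi (x ord0 i)).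
Proof.
move=> mphi; apply: measurable_prod => i _.
exact: (measurableT_comp mphi (measurable_rV_coord i)).
Qed.

Lemma measurable_space_space : measurable_fun setT (fun z : 'rV[R]_m.+2 => space (space z)).
Proof. exact: (measurableT_comp (@measurable_space R m) (@measurable_space R m.+1)). Qed.

Lemma measurable_time_space : measurable_fun setT (fun z : 'rV[R]_m.+2 => time (space z)).
Proof. exact: (measurableT_comp (@measurable_time R m) (@measurable_space R m.+1)). Qed.

Lemma measurable_majorant (eps : R) : measurable_fun setT (@majorant R m eps).
Proof.
apply: measurable_funM; first apply: measurable_funM.
- exact: (measurableT_comp (measurable_prod_coord (measurable_japaneseM eps)) measurable_space_space).
- exact: (measurableT_comp (measurable_japaneseM (eps ^+ 2)) measurable_time_space).
- apply: (measurableT_comp (@measurable_japanese R)).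
  exact: (measurable_funD measurable_time_space (@measurable_time R m.+1)).
Qed.

Lemma integral_majorant (eps : R) : 0 < eps ->
  (\int[lebesgue_rV R m.+2]_z (majorant eps z)%:E = (pi ^+ m.+2 * (eps ^+ m.+2)^-1)%:E)%E.
Proof.
move=> e0.
rewrite (ge0_integral_sheared (P := fun x => \prod_i japanese (eps * x ord0 i))
  (A := fun s => japanese (eps ^+ 2 * s)) (beta := fun s t => japanese (s + t)) (b := pi)).
- rewrite integral_japaneseM ?exprn_gt0//.
  rewrite (ge0_integral_tensor (phi := fun _ x => japanese (eps * x))); last 2 first.
  + by move=> i; exact: measurable_japaneseM.
  + by move=> i x; exact: japanese_ge0.
  rewrite (eq_bigr (fun=> (eps^-1 * pi)%:E)); last by move=> i _; exact: integral_japaneseM.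
  rewrite prodEFin prodr_const card_ord -!EFinM; congr EFin.
  by rewrite exprMn -!exprVn !exprS; ring.
- exact: (measurable_prod_coord (measurable_japaneseM eps)).
- exact: measurable_japaneseM.
- apply: (measurableT_comp (@measurable_japanese R)).
  by apply: measurable_funD; [exact: measurable_fst|exact: measurable_snd].
- by move=> x; apply: prodr_ge0 => i _; exact: japanese_ge0.
- by move=> s; exact: japanese_ge0.
- by move=> s t; exact: japanese_ge0.
- move=> s; rewrite -integral_japanese -[RHS](integral_shift s).
  + by apply: eq_integral => t _; rewrite addrC.
  + by apply/measurable_EFinP; exact: measurable_japanese.
  + by move=> x; rewrite lee_fin japanese_ge0.
Qed.

End majorant_theory.

(** * Norms from pointwise bounds *)

Section norm_bounds.
Context d (T : measurableType d) (R : realType) (mu : {measure set T -> \bar R}).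

(* The integral of a nonnegative function is a supremum over the simple functions
   below it, measurable or not. *)
Lemma ge0_le_integralT (f g : T -> \bar R) : (forall x, 0 <= f x)%E ->
  (forall x, f x <= g x)%E -> (\int[mu]_x f x <= \int[mu]_x g x)%E.
Proof.
move=> f0 fg; rewrite !ge0_integralTE//; last by move=> x; exact: le_trans (fg x).
apply: le_ereal_sup => _ /= [h hf <-]; exists h => // x.
exact: le_trans (hf x) (fg x).
Qed.

(** The value 0 at infinity puts p = oo under the same formulas as finite p. *)
Definition inv_exponent (p : \bar R) : R := if p is r%:E%E then r^-1 else 0.

(** As [W x <= 1] and [1 <= p], the integral of |F|^p is at most a^p times that of W; at p = oo the
    pointwise bound by [a] is enough. *)
Lemma CLnorm_le (F : T -> R[i]) (W : T -> R) (a b : R) (p : \bar R) :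
  (1 <= p)%E -> 0 <= a -> 0 <= b -> (forall x, 0 <= W x <= 1) -> measurable_fun setT W ->
  (\int[mu]_x (W x)%:E = b%:E)%E ->
  (forall x, cabs (F x) <= a * W x) ->
  (CLnorm mu p F <= (a * b `^ inv_exponent p)%:E)%E.
Proof.
move=> p1 a0 b0 W01 mW iW FW; rewrite /CLnorm unlock.
have W0 x : 0 <= W x by have /andP[] := W01 x.
case: p p1 => [r|_|//]; last first.
  rewrite /= powRr0 mulr1; case: ifPn => _; last by rewrite lee_fin.
  apply/ess_supP; apply: nearW => x /=; rewrite lee_fin ger0_norm ?cabs_ge0//.
  by apply: le_trans (FW x) _; rewrite ler_piMr//; have /andP[] := W01 x.
rewrite lee_fin => r1; have r0 : 0 < r by exact: lt_le_trans ltr01 r1.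
apply: (@le_trans _ _ (((a `^ r)%:E * b%:E) `^ r^-1)%E); last first.
  rewrite -EFinM poweR_EFin lee_fin powRM ?powR_ge0//.
  by rewrite -powRrM mulfV ?lt0r_neq0// powRr1.
have ri0 : 0 <= r^-1 by rewrite invr_ge0 ltW.
apply: (gt0_ler_poweR ri0).
- by rewrite in_itv /= leey integral_ge0// => x _; exact: poweR_ge0.
- by rewrite in_itv /= leey -EFinM lee_fin mulr_ge0 ?powR_ge0.
- rewrite -iW -ge0_integralZl//; last 3 first.
  + exact/measurable_EFinP.
  + by move=> x _; rewrite lee_fin.
  + by rewrite lee_fin powR_ge0.
  apply: ge0_le_integralT => x; first exact: poweR_ge0.
  rewrite /= -EFinM lee_fin ger0_norm ?cabs_ge0//.
  apply: (@le_trans _ _ ((a * W x) `^ r)).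
    by apply: (ge0_ler_powR (ltW r0)); rewrite ?nnegrE ?cabs_ge0 ?mulr_ge0.
  rewrite powRM// ler_wpM2l ?powR_ge0//.
  (* The comparison of a power with its base is for a positive base. *)
  have [->|Wx0] := eqVneq (W x) 0; first by rewrite powR0 ?lt0r_neq0.
  by apply: ge1r_powR => //; rewrite lt_neqAle eq_sym Wx0 W0 /=; have /andP[] := W01 x.
Qed.

Lemma poweR2 (x : \bar R) : (0 <= x)%E -> (x `^ 2 = x ^+ 2)%E.
Proof.
case: x => [r|_|//]; last by rewrite poweRyr// expe2 mulyy.
by rewrite lee_fin => r0; rewrite poweR_EFin powR_mulrn// EFin_expe.
Qed.

(** Chebyshev's inequality. The set is given by a function with values 0 and 1, since [knapp_box] is
    a product of indicators. *)
Lemma CLnorm2_ge (F : T -> R[i]) (B : T -> R) (a b : R) : 0 <= a ->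
  (forall x, B x = 0 \/ (B x = 1 /\ a <= cabs (F x))) -> measurable_fun setT B ->
  (\int[mu]_x (B x)%:E = b%:E)%E ->
  ((a ^+ 2 * b)%:E <= CLnorm mu 2%:E F ^+ 2)%E.
Proof.
move=> a0 FB mB iB.
have -> : (CLnorm mu 2%:E F ^+ 2 = \int[mu]_x ((cabs (F x)) ^+ 2)%:E)%E.
  rewrite -poweR2 ?Lnorm_ge0// /CLnorm poweR_Lnorm//; apply: eq_integral => x _.
  by rewrite /= ger0_norm ?cabs_ge0// powR_mulrn// cabs_ge0.
rewrite EFinM -iB -ge0_integralZl//; last 3 first.
- exact/measurable_EFinP.
- by move=> x _; rewrite lee_fin; have [->|[->]] := FB x.
- by rewrite lee_fin sqr_ge0.
apply: ge0_le_integralT => x; rewrite -EFinM lee_fin.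
  by have [->|[->]] := FB x; rewrite ?mulr0// mulr1 sqr_ge0.
have [->|[-> h]] := FB x; first by rewrite mulr0 sqr_ge0.
by rewrite mulr1 lerXn2r// nnegrE cabs_ge0.
Qed.

End norm_bounds.

(** * The box in frequency space *)

Section box.
Variables (R : realType) (m : nat).
Local Notation leb := (@lebesgue_measure R).

Definition itv_indic (a b : R) (x : R) : R := \1_(`[a, b]%classic : set R) x.

Lemma itv_indicP a b x : itv_indic a b x = 0 \/ (itv_indic a b x = 1 /\ a <= x <= b).
Proof.
rewrite /itv_indic indicE; have [/set_mem|_] := boolP (x \in _).
  by rewrite /= in_itv /= => h; right.
by left.
Qed.

Lemma itv_indic_ge0 a b x : 0 <= itv_indic a b x.
Proof. by rewrite /itv_indic indicE ler0n. Qed.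

Lemma measurable_itv_indic a b : measurable_fun setT (itv_indic a b).
Proof. by apply: measurable_indic; exact: measurable_itv. Qed.

Lemma integral_itv_indic a b : a <= b ->
  (\int[leb]_x (itv_indic a b x)%:E = (b - a)%:E)%E.
Proof.
move=> ab; rewrite integral_indic// setIT /= lebesgue_measure_itv /= lte_fin; move: ab.
rewrite le_eqVlt => /predU1P[->|->]; last by rewrite EFinB.
by rewrite ltxx subrr.
Qed.

(** The last interval starts at eps^2 rho / 2 and not at 0: the null frequency sigma - tau stays
    positive, and for small [rho] the box avoids the cone. *)
Definition knapp_box (eps rho t0 : R) (z : 'rV[R]_m.+2) : R :=
  (\prod_i itv_indic 0 (eps * rho) (space (space z) ord0 i)) *
  itv_indic (t0 - rho) (t0 + rho) (time (space z)) *
  itv_indic (eps ^+ 2 * rho / 2) (eps ^+ 2 * rho) (time (space z) - time z).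

Lemma measurable_knapp_box eps rho t0 : measurable_fun setT (knapp_box eps rho t0).
Proof.
apply: measurable_funM; first apply: measurable_funM.
- exact: (measurableT_comp (measurable_prod_coord (measurable_itv_indic _ _))
    (@measurable_space_space R m)).
- exact: (measurableT_comp (measurable_itv_indic _ _) (@measurable_time_space R m)).
- apply: (measurableT_comp (measurable_itv_indic _ _)).
  exact: (measurable_funB (@measurable_time_space R m) (@measurable_time R m.+1)).
Qed.

(** The length 2 rho of the second interval cancels the 1/2 in the length of the last one. *)
Lemma integral_knapp_box eps rho t0 : 0 < eps -> 0 < rho ->
  (\int[lebesgue_rV R m.+2]_z (knapp_box eps rho t0 z)%:E =
   (eps ^+ m.+2 * rho ^+ m.+2)%:E)%E.
Proof.
move=> e0 r0; have e20 : 0 < eps ^+ 2 * rho by rewrite mulr_gt0// exprn_gt0.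
rewrite (ge0_integral_sheared (P := fun x => \prod_i itv_indic 0 (eps * rho) (x ord0 i))
  (A := itv_indic (t0 - rho) (t0 + rho))
  (beta := fun s t => itv_indic (eps ^+ 2 * rho / 2) (eps ^+ 2 * rho) (s - t))
  (b := eps ^+ 2 * rho / 2)).
- rewrite integral_itv_indic; last lra.
  rewrite (ge0_integral_tensor (phi := fun _ => itv_indic 0 (eps * rho))); last 2 first.
  + by move=> i; exact: measurable_itv_indic.
  + by move=> i x; exact: itv_indic_ge0.
  rewrite (eq_bigr (fun=> (eps * rho)%:E)); last first.
    by move=> i _; rewrite integral_itv_indic ?subr0// mulr_ge0 ?ltW.
  rewrite prodEFin prodr_const card_ord -!EFinM; congr EFin.
  by rewrite exprMn !exprS; field.
- exact: (measurable_prod_coord (measurable_itv_indic _ _)).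
- exact: measurable_itv_indic.
- apply: (measurableT_comp (measurable_itv_indic _ _)).
  by apply: measurable_funB; [exact: measurable_fst|exact: measurable_snd].
- by move=> x; apply: prodr_ge0 => i _; exact: itv_indic_ge0.
- by move=> s; exact: itv_indic_ge0.
- by move=> s t; exact: itv_indic_ge0.
- move=> s.
  have E t : itv_indic (eps ^+ 2 * rho / 2) (eps ^+ 2 * rho) (s - t) =
      itv_indic (s - eps ^+ 2 * rho) (s - eps ^+ 2 * rho / 2) t.
    rewrite /itv_indic !indicE; congr ((nat_of_bool _)%:R); apply/idP/idP => /set_mem /=;
      rewrite in_itv /= => /andP[h1 h2]; apply/mem_set; rewrite /= in_itv /=;
      apply/andP; split; lra.
  under eq_integral do rewrite E.
  by rewrite integral_itv_indic; [congr EFin; field|lra].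
Qed.

Lemma knapp_boxP eps rho t0 z : knapp_box eps rho t0 z = 0 \/
  [/\ knapp_box eps rho t0 z = 1,
      forall i, 0 <= space (space z) ord0 i <= eps * rho,
      t0 - rho <= time (space z) <= t0 + rho &
      eps ^+ 2 * rho / 2 <= time (space z) - time z <= eps ^+ 2 * rho].
Proof.
rewrite /knapp_box.
have [->|[-> h3]] := itv_indicP (eps ^+ 2 * rho / 2) (eps ^+ 2 * rho) (time (space z) - time z).
  by left; rewrite mulr0.
have [->|[-> h2]] := itv_indicP (t0 - rho) (t0 + rho) (time (space z)).
  by left; rewrite mulr0 mul0r.
rewrite !mulr1; have [h1|] := pselect (forall i, 0 <= space (space z) ord0 i <= eps * rho).
  right; split => //; rewrite big1// => i _; have /andP[a b] := h1 i.
  by rewrite /itv_indic indicE mem_set//= in_itv /= a b.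
move=> /existsNP[i hi]; left; rewrite (bigD1 i)//=.
by have [->|[_ ?]] := itv_indicP 0 (eps * rho) (space (space z) ord0 i); rewrite ?mul0r.
Qed.

End box.

(** * A point of the cone where the cutoff does not vanish *)

Section cone_point.
Variables (R : realType) (m : nat) (chi : 'rV[R]_m.+2 -> R[i]).

Lemma continuous_cabs (f : 'rV[R]_m.+2 -> R[i]) : schwartz f ->
  continuous (fun w => cabs (f w)).
Proof.
move=> sf; have cR := schwartz_continuousRe sf; have cI := schwartz_continuousIm sf.
have -> : (fun w => cabs (f w)) = (fun w => Num.sqrt
    (complex.Re (f w) * complex.Re (f w) + complex.Im (f w) * complex.Im (f w))).
  by apply/funext => w; rewrite /cabs; case: (f w) => a b /=; rewrite !expr2.
have c2 := rV_continuousD (rV_continuousM cR cR) (rV_continuousM cI cI).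
by move=> w; apply: (continuous_comp (c2 w)); exact: sqrt_continuous.
Qed.

Lemma rV2E (w : 'rV[R]_m.+2) : w =
  spacetime (spacetime (space (space w), time (space w)), time w).
Proof. by rewrite space_timeK space_timeK. Qed.

(** The dyadic identity makes [chi] nonzero somewhere away from 0, radiality transports this to the
    point (0, t0, t0) of the cone, and continuity extends it to a neighbourhood. *)
Lemma cutoff_lower_bound : schwartz chi -> radial chi ->
  (forall w, w != 0 ->
     \esum_(j in [set: int]) (cabs (chi (2 ^ (- j) *: w)) ^+ 2)%:E = 1%E) ->
  exists t0 a rho : R, [/\ 0 < t0, 0 < a, 0 < rho &
    forall w, (forall i, `|space (space w) ord0 i| < rho) ->
      `|time (space w) - t0| < rho -> `|time w - t0| < rho -> a <= cabs (chi w)].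
Proof.
move=> schi rchi dchi.
have [w0 [w0n chi0]] : exists w0, 0 < enorm w0 /\ chi w0 != 0.
  pose v : 'rV[R]_m.+2 := const_mx 1.
  have v0 : v != 0.
    by apply/eqP => /rowP /(_ ord0); rewrite !mxE => /eqP; rewrite oner_eq0.
  have [h|/existsNP[j /eqP hj]] := pselect (forall j : int, chi (2 ^ (- j) *: v) = 0).
    have := dchi v v0; rewrite esum1; first by move=> [] /esym/eqP; rewrite oner_eq0.
    by move=> j _; rewrite h /cabs Normc.normc0 expr0n.
  exists (2 ^ (- j) *: v); split => //.
  rewrite /enorm sqrtr_gt0 /dotmul big_ord_recl ltr_wpDr//.
    by apply: sumr_ge0 => i _; rewrite -expr2 sqr_ge0.
  by rewrite !mxE mulr1 mulr_gt0// exprz_gt0.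
(* With this value (0, t0, t0) has the Euclidean norm of [w0]. *)
pose t0 := enorm w0 / Num.sqrt 2.
have s2 : 0 < Num.sqrt 2 :> R by rewrite sqrtr_gt0.
have t00 : 0 < t0 by rewrite divr_gt0.
pose ws : 'rV[R]_m.+2 := spacetime (spacetime (0, t0), t0).
have chis : chi ws = chi w0.
  apply: rchi; rewrite {1}/enorm 2!dotmulS !space_spacetime !time_spacetime.
  rewrite (_ : dotmul _ _ = 0) ?add0r; last first.
    by rewrite /dotmul big1// => i _; rewrite /= mxE mul0r.
  rewrite /=; have -> : t0 * t0 + t0 * t0 = enorm w0 ^+ 2.
    by rewrite /t0 -!expr2 exprMn exprVn [Num.sqrt 2 ^+ 2]sqr_sqrtr//; field.
  by rewrite sqrtr_sqr ger0_norm// ltW.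
pose a := cabs (chi ws) / 2.
have a0 : 0 < cabs (chi ws).
  rewrite lt_neqAle cabs_ge0 andbT eq_sym; apply/eqP => h.
  by move: chi0; rewrite -chis (Normc.eq0_normc h) eqxx.
have : \forall w \near ws, a < cabs (chi w).
  have /cvgr_gt := @continuous_cabs chi schi ws; apply.
  by rewrite /a; lra.
move=> /nbhs_ballP[rho /= rho0 hrho]; exists t0, a, rho; split => //.
  by rewrite divr_gt0.
move=> w hx hs ht; apply/ltW/hrho; split => // i j; rewrite !ord1 {i} [w]rV2E /ws.
rewrite /ball /= !mxE; case: unliftP => [k _|_] /=; last by rewrite distrC.
rewrite !mxE; case: unliftP => [k' _|_] /=; last by rewrite distrC.
by rewrite mxE sub0r normrN; exact: hx.
Qed.

End cone_point.

(** * Lower bound for P_0 u *)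

Section failure.
Variables (R : realType) (m : nat).
Local Notation n := (m.+2).
Local Notation mu := (lebesgue_rV R m.+2).

(** On the box the arguments of [profile_hat] are at most rho, rho and 2 rho in modulus, the last
    because tau - t0 collects the deviations of sigma and of sigma - tau; hence [2 * rho <= r]. The
    dilations supply eps^-m and eps^-2. *)
Lemma cabs_knapp_hat_ge (t0 eps rho r c : R) (w : 'rV[R]_n) :
  0 < eps -> eps <= 1 -> 0 < rho -> 2 * rho <= r -> 0 < c ->
  (forall eta, `|eta| <= r -> c <= cabs (profile_hat eta)) ->
  (forall i, 0 <= space (space w) ord0 i <= eps * rho) ->
  t0 - rho <= time (space w) <= t0 + rho ->
  eps ^+ 2 * rho / 2 <= time (space w) - time w <= eps ^+ 2 * rho ->
  c ^+ n / eps ^+ n <= cabs (knapp_hat t0 eps w).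
Proof.
move=> e0 e1 rho0 rhor c0 hc hx /andP[s1 s2] /andP[u1 u2].
have e20 : 0 < eps ^+ 2 by rewrite exprn_gt0.
have e21 : eps ^+ 2 * rho <= rho by rewrite ler_piMl ?exprn_ile1// ltW.
have e22 : 0 < eps ^+ 2 * rho by rewrite mulr_gt0.
rewrite /knapp_hat !cabsM !cabs_real cabs_prod.
have -> : c ^+ n / eps ^+ n = (c / eps) ^+ m * ((eps ^+ 2)^-1 * c) * c.
  by rewrite exprMn exprVn !exprS; field; rewrite ?lt0r_neq0//= exprn_gt0.
have ei2 : 0 <= (eps ^+ 2)^-1 by rewrite invr_ge0 ltW.
have ei : 0 <= eps^-1 by rewrite invr_ge0 ltW.
have h3 : c <= cabs (profile_hat (time w - t0)).
  by apply: hc; rewrite ler_norml; apply/andP; split; lra.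
have h2 : (eps ^+ 2)^-1 * c <= `|(eps ^+ 2)^-1| *
    cabs (profile_hat ((time (space w) - time w) / eps ^+ 2)).
  rewrite ger0_norm// ler_wpM2l//; apply: hc.
  rewrite ger0_norm; last by rewrite divr_ge0 ?ltW//; lra.
  by rewrite ler_pdivrMr// [r * _]mulrC; apply: (le_trans u2); rewrite ler_pM2l//; lra.
have h1 : (c / eps) ^+ m <= \prod_i cabs ((eps^-1)%:C%C *
    profile_hat (space (space w) ord0 i / eps)).
  rewrite -[m in (c / eps) ^+ m]card_ord -prodr_const; apply: ler_prod => i _.
  apply/andP; split; first exact: mulr_ge0 (ltW c0) ei.
  rewrite cabsM cabs_real ger0_norm// [leLHS]mulrC.
  rewrite ler_wpM2l//; apply: hc; have /andP[x1 x2] := hx i.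
  rewrite ger0_norm; last exact: mulr_ge0 x1 ei.
  by rewrite ler_pdivrMr// [r * _]mulrC; apply: (le_trans x2); rewrite ler_pM2l//; lra.
have p1 : 0 <= (c / eps) ^+ m by rewrite exprn_ge0// mulr_ge0// ltW.
have p2 : 0 <= (eps ^+ 2)^-1 * c by rewrite mulr_ge0// ltW.
exact: ler_pM (mulr_ge0 p1 p2) (ltW c0) (ler_pM p1 p2 h1 h2) h3.
Qed.

(** Off the cone, dividing by the symbol undoes the factor it contributes to the transform of
    [knapp], up to 4 pi^2. *)
Lemma P0u_hat_knapp (chi : 'rV[R]_n -> R[i]) (t0 eps : R) w : 0 < eps ->
  wave_symbol w != 0 ->
  cabs (P0u_hat chi (knapp t0 eps) w) =
  4 * pi ^+ 2 * (cabs (knapp_hat t0 eps w) * cabs (chi w)).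
Proof.
have E (b s : R) (K X : R[i]) :
    cabs (b%:C%C * K / s%:C%C * X) = `|b| * cabs K / `|s| * cabs X.
  by rewrite 3!cabsM cabsV !cabs_real.
move=> e0 w0; rewrite /P0u_hat fourier_knapp// E normrN normrM [`|4 * _|]ger0_norm; last first.
  by rewrite mulr_ge0 ?sqr_ge0.
move: (cabs (knapp_hat _ _ _)) (cabs (chi w)) => K X.
by field; rewrite normr_eq0.
Qed.

Lemma fourier_knapp_cone (t0 eps : R) (w : 'rV[R]_n) : 0 < eps -> cone w ->
  fourier (knapp t0 eps) w = 0.
Proof.
move=> e0 cw; rewrite fourier_knapp// /wave_symbol (cw : enorm _ ^+ 2 = _) subrr.
by rewrite mulr0 oppr0 mul0r.
Qed.

Lemma enorm_sqr d (z : 'rV[R]_d) : enorm z ^+ 2 = dotmul z z.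
Proof. by rewrite sqr_sqrtr// sumr_ge0// => i _; rewrite -expr2 sqr_ge0. Qed.

(** The square of a pointwise bound of order eps^-n, times the volume eps^n rho^n of the box. *)
Lemma P0u_hat_lower (chi : 'rV[R]_n -> R[i]) (t0 a rho1 r c rho : R) :
  0 < t0 -> 0 < a -> 0 < c -> 0 < rho -> 2 * rho <= r -> 2 * rho < rho1 -> 2 * rho < t0 ->
  (forall w, (forall i, `|space (space w) ord0 i| < rho1) ->
      `|time (space w) - t0| < rho1 -> `|time w - t0| < rho1 -> a <= cabs (chi w)) ->
  (forall eta, `|eta| <= r -> c <= cabs (profile_hat eta)) ->
  forall eps : R, 0 < eps -> eps <= 1 ->
  ((((4 * pi ^+ 2 * c ^+ n * a) ^+ 2 * rho ^+ n) / eps ^+ n)%:E <=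
   CLnorm mu 2%:E (P0u_hat chi (knapp t0 eps)) ^+ 2)%E.
Proof.
move=> t00 a0 c0 rho0 rhor rho01 rhot hchi hc eps e0 e1.
have en0 : 0 < eps ^+ n by rewrite exprn_gt0.
pose K := 4 * pi ^+ 2 * (c ^+ n / eps ^+ n * a).
have ceps0 : 0 <= c ^+ n / eps ^+ n.
  by apply: mulr_ge0; [rewrite exprn_ge0// ltW|rewrite invr_ge0 ltW].
have pp0 : 0 <= 4 * pi ^+ 2 :> R by apply: mulr_ge0 => //; exact: sqr_ge0.
have K0 : 0 <= K by exact: mulr_ge0 pp0 (mulr_ge0 ceps0 (ltW a0)).
have -> : ((4 * pi ^+ 2 * c ^+ n * a) ^+ 2 * rho ^+ n) / eps ^+ n =
    K ^+ 2 * (eps ^+ n * rho ^+ n).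
  by rewrite /K; field; rewrite lt0r_neq0.
apply: (CLnorm2_ge K0 (B := knapp_box eps rho t0)); last 2 first.
- exact: measurable_knapp_box.
- exact: integral_knapp_box.
move=> w; have [->|[-> hx hs hu]] := knapp_boxP eps rho t0 w; [by left|right; split => //].
have e22 : 0 < eps ^+ 2 * rho by rewrite mulr_gt0// exprn_gt0.
have e21 : eps ^+ 2 * rho <= rho by rewrite ler_piMl ?exprn_ile1// ltW.
have eR : eps * rho <= rho by rewrite ler_piMl// ltW.
have hk := cabs_knapp_hat_ge e0 e1 rho0 rhor c0 hc hx hs hu.
have /andP[s1 s2] := hs; have /andP[u1 u2] := hu.
have ha : a <= cabs (chi w).
  apply: hchi => [i||].
  - have /andP[x1 x2] := hx i; rewrite ger0_norm//; lra.
  - by rewrite ltr_norml; apply/andP; split; lra.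
  - by rewrite ltr_norml; apply/andP; split; lra.
rewrite P0u_hat_knapp//.
  rewrite /K; apply: (ler_wpM2l pp0); exact: ler_pM ceps0 (ltW a0) hk ha.
(* The symbol is |xi'|^2 + (s - t) (s + t), with s - t > 0 on the box and s + t > 0 by
   [2 * rho < t0]. *)
rewrite wave_symbolE lt0r_neq0//.
have d0 : 0 <= dotmul (space (space w)) (space (space w)).
  by rewrite -enorm_sqr sqr_ge0.
set s := time (space w) in s1 s2 u1 u2 *; set t := time w in u1 u2 *.
have : 0 < (s - t) * (s + t) by rewrite mulr_gt0//; lra.
by rewrite -subr_sqr; lra.
Qed.

End failure.

(** * Upper bound for P_0 f and the contradiction *)

Section upper_bound.
Variables (R : realType) (m : nat).
Local Notation n := (m.+2).
Local Notation mu := (lebesgue_rV R m.+2).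

Lemma majorant01 (eps : R) (z : 'rV[R]_n) : 0 <= majorant eps z <= 1.
Proof. by rewrite majorant_ge0 majorant_le1. Qed.

Lemma knapp_const_ge0 (t0 : R) : 0 <= knapp_const m t0.
Proof. by rewrite /knapp_const !addr_ge0 ?mulr_ge0 ?addr_ge0 ?mulr_ge0. Qed.

Lemma pi_eps_ge0 (eps : R) : 0 < eps -> 0 <= pi ^+ n * (eps ^+ n)^-1 :> R.
Proof. by move=> e0; rewrite mulr_ge0 ?invr_ge0 ?exprn_ge0 ?pi_ge0 ?(ltW e0). Qed.

Lemma CLfun_knapp (t0 eps : R) (p : \bar R) : 0 < eps -> eps <= 1 -> (1 <= p)%E ->
  CLfun mu p (knapp t0 eps).
Proof.
move=> e0 e1 p1; split; first exact: (Cintegrable_measurable (@Cintegrable_knapp R m t0 eps e0)).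
have a0 : 0 <= eps ^+ 2 * knapp_const m t0 by rewrite mulr_ge0 ?sqr_ge0 ?knapp_const_ge0.
apply: le_lt_trans (ltry _); exact: (CLnorm_le p1 a0 (pi_eps_ge0 e0) (majorant01 eps)
  (@measurable_majorant R m eps) (integral_majorant m e0) (cabs_knapp t0 e0 e1)).
Qed.

(** [D] must not depend on [eps]; it does not, because neither [knapp_const] nor the constant of
    slow variation of the majorant does. *)
Lemma P0f_upper (chi : 'rV[R]_n -> R[i]) (t0 : R) (p : \bar R) : schwartz chi ->
  (1 <= p)%E -> exists2 D : R, 0 <= D & forall eps : R, 0 < eps -> eps <= 1 ->
  (CLnorm mu p (P0f chi (knapp t0 eps)) <=
   (D * eps ^+ 2 * (pi ^+ n * (eps ^+ n)^-1) `^ inv_exponent p)%:E)%E.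
Proof.
move=> schi p1; have [D D0 hD] := multiplier_majorant schi.
exists (D * knapp_const m t0); first by rewrite mulr_ge0 ?knapp_const_ge0.
move=> eps e0 e1.
have a0 : 0 <= eps ^+ 2 * knapp_const m t0 by rewrite mulr_ge0 ?sqr_ge0 ?knapp_const_ge0.
have -> : D * knapp_const m t0 * eps ^+ 2 = D * (eps ^+ 2 * knapp_const m t0) by ring.
apply: (CLnorm_le p1 (mulr_ge0 D0 a0) (pi_eps_ge0 e0) (majorant01 eps)
  (@measurable_majorant R m eps) (integral_majorant m e0)) => z.
apply: hD => //.
- exact: Cintegrable_knapp.
- exact: cabs_knapp.
- by move=> y; exact: majorant_ge0.
- by move=> y y'; apply: majorant_slowly_varying; rewrite (ltW e0).
Qed.

Lemma powR_eps_bound (K M s : R) : 0 < K -> 0 <= M -> 0 < s ->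
  exists eps : R, [/\ 0 < eps, eps <= 1 & M * eps `^ s < K].
Proof.
(* [M + 1] is positive even for [M = 0], and it makes [M * x < K] strict. *)
move=> K0 M0 s0; pose x := K / (M + 1).
have M1 : 0 < M + 1 by rewrite ltr_wpDl.
have x0 : 0 < x by rewrite divr_gt0.
exists (Num.min 1 (x `^ s^-1)); split.
- by rewrite lt_min ltr01 powR_gt0.
- by rewrite ge_min lexx.
apply: (@le_lt_trans _ _ (M * x)).
  rewrite ler_wpM2l//; apply: (@le_trans _ _ ((x `^ s^-1) `^ s)).
    apply: (ge0_ler_powR (ltW s0)); rewrite ?nnegrE ?powR_ge0 ?le_min ?ler01 ?powR_ge0//.
    by rewrite ge_min lexx orbT.
  by rewrite -powRrM mulVf ?lt0r_neq0// powRr1// ltW.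
by rewrite /x mulrA ltr_pdivrMr// mulrDr mulr1 mulrC ltrDl.
Qed.

(** With q = 1/p the estimate would give K eps^-n <= |C| (D Y)^2 eps^(4 - 2 n q), that is K <= M
    eps^(n + 4 - 2 n q). The exponent is positive, so a small [eps] contradicts this. *)
Lemma no_multiplier_bound (chi : 'rV[R]_n -> R[i]) (p : \bar R) (C : R) :
  schwartz chi -> radial chi ->
  (forall w, w != 0 ->
     \esum_(j in [set: int]) (cabs (chi (2 ^ (- j) *: w)) ^+ 2)%:E = 1%E) ->
  (1 <= p)%E -> 2 * n%:R * inv_exponent p < n%:R + 4 ->
  ~ forall f : 'rV[R]_n -> R[i], CLfun mu 1%E f -> CLfun mu p f ->
      (forall w, cone w -> fourier f w = 0) ->
      (CLnorm mu 2%:E (P0u_hat chi f) ^+ 2 <= C%:E * CLnorm mu p (P0f chi f) ^+ 2)%E.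
Proof.
move=> schi rchi dchi p1 hq H; set q := inv_exponent p in hq.
have [t0 [a [rho1 [t00 a0 rho10 hchi]]]] := cutoff_lower_bound schi rchi dchi.
have [r [c [r0 c0 hc]]] := fourier1_profile_near0 R.
(* The box has to fit where [profile_hat] is bounded below ([r]), where [chi] is ([rho1]), and where
   tau > 0 ([t0]); the thirds leave room for strict inequalities. *)
pose rho := Num.min (r / 2) (Num.min (rho1 / 3) (t0 / 3)).
have rho0 : 0 < rho by rewrite !lt_min !divr_gt0.
have rr : 2 * rho <= r.
  have : rho <= r / 2 by rewrite ge_min lexx.
  lra.
have rrho1 : 2 * rho < rho1.
  have : rho <= rho1 / 3 by rewrite !ge_min lexx !orbT.
  lra.
have rt0 : 2 * rho < t0.
  have : rho <= t0 / 3 by rewrite !ge_min lexx !orbT.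
  lra.
have [D D0 hD] := P0f_upper t0 schi p1.
pose K := (4 * pi ^+ 2 * c ^+ n * a) ^+ 2 * rho ^+ n.
have K0 : 0 < K.
  have pp0 : 0 < 4 * pi ^+ 2 :> R by rewrite mulr_gt0// exprn_gt0// pi_gt0.
  have cn0 : 0 < c ^+ n by rewrite exprn_gt0.
  by apply: mulr_gt0; apply: exprn_gt0 => //; exact: mulr_gt0 (mulr_gt0 pp0 cn0) a0.
pose Y := (pi ^+ n : R) `^ q.
(* The sign of [C] is unknown, and [M] has to be nonnegative. *)
pose M := `|C| * (D * Y) ^+ 2.
have M0 : 0 <= M by rewrite mulr_ge0 ?sqr_ge0.
have s0 : 0 < n%:R + 4 - 2 * n%:R * q by lra.
have [eps [e0 e1 hM]] := powR_eps_bound K0 M0 s0.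
have en0 : 0 < eps ^+ n by rewrite exprn_gt0.
have := H _ (CLfun_knapp t0 e0 e1 (lexx 1%E)) (CLfun_knapp t0 e0 e1 p1)
  (fun w cw => fourier_knapp_cone t0 e0 cw).
have low := P0u_hat_lower t00 a0 c0 rho0 rr rrho1 rt0 hchi hc e0 e1.
move=> /(le_trans low); apply/negP; rewrite -ltNge.
have up := hD eps e0 e1; have X0 : (0 <= CLnorm mu p (P0f chi (knapp t0 eps)))%E by exact: Lnorm_ge0.
set X := CLnorm _ _ _ in up X0 *.
(* The upper bound makes the norm finite, so the comparison can take place among reals. *)
have [x xE] : exists x, X = x%:E.
  by exists (fine X); rewrite fineK// ge0_fin_numE// (le_lt_trans up)// ltry.
rewrite xE lee_fin in up; rewrite xE lee_fin in X0.
rewrite xE -EFin_expe -EFinM lte_fin -/K.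
set B := _ `^ _ in up.
have BE : B = Y * (eps `^ (- (n%:R * q))).
  have pn0 : 0 <= pi ^+ n :> R by rewrite exprn_ge0// pi_ge0.
  have ein0 : 0 <= (eps ^+ n)^-1 by rewrite invr_ge0 ltW.
  rewrite /B powRM// -/q -/Y; congr (_ * _).
  by rewrite -mulNr powRrM powR_invn// ltW.
have E2 : (eps `^ (- (n%:R * q))) ^+ 2 * eps ^+ 4 * eps ^+ n = eps `^ (n%:R + 4 - 2 * n%:R * q).
  have en : eps != 0 by rewrite lt0r_neq0.
  rewrite -!powR_mulrn ?powR_ge0 ?(ltW e0)// -powRrM -!powRD ?en ?implybT//.
  by congr (_ `^ _); ring.
apply: (@le_lt_trans _ _ (`|C| * (D * eps ^+ 2 * B) ^+ 2)).
  apply: (@le_trans _ _ (`|C| * x ^+ 2)).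
    by rewrite ler_wpM2r ?sqr_ge0// ler_norm.
  by rewrite ler_wpM2l// lerXn2r// nnegrE; exact: le_trans up.
rewrite ltr_pdivlMr//; apply: le_lt_trans hM.
rewrite le_eqVlt; apply/orP; left; apply/eqP; rewrite -E2 BE /M; ring.
Qed.

End upper_bound.

Unset Implicit Arguments.
Set Strict Implicit.

Theorem mainTheorem2 (R : realType) (d : nat) (hn : (5 <= d.+1)%N)
  (p : \bar R) (hp : (((2 * d.+1)%:R / (d.+1 + 4)%:R)%:E < p)%E)
  (chi : 'rV[R]_d.+1 -> R[i])
  (chi_schwartz : schwartz chi) (chi_radial : radial chi)
  (chi_supp : forall w, chi w != 0 -> 3^-1 <= enorm w <= 1)
  (chi_dyadic : forall w, w != 0 ->
     \esum_(j in [set: int]) (cabs (chi (2 ^ (- j) *: w)) ^+ 2)%:E = 1%E) :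
  ~ exists C : R, forall f : 'rV[R]_d.+1 -> R[i],
      CLfun (lebesgue_rV R d.+1) 1%E f ->
      CLfun (lebesgue_rV R d.+1) p f ->
      (forall w, cone w -> fourier f w = 0) ->
      (CLnorm (lebesgue_rV R d.+1) 2%:E (P0u_hat chi f) ^+ 2 <=
       C%:E * CLnorm (lebesgue_rV R d.+1) p (P0f chi f) ^+ 2)%E.
Proof.
(* Writing n = m + 2 singles out the two coordinates of the shear, s and t. *)
case: d hn hp chi chi_schwartz chi_radial chi_supp chi_dyadic => [//|m] hn hp
  chi chi_schwartz chi_radial _ chi_dyadic [C HC].
have n5 : (5 : R) <= m.+2%:R by rewrite (ler_nat R 5).
have n40 : 0 < m.+2%:R + 4 :> R by lra.
rewrite natrM natrD in hp.
(* The critical exponent is at least 1, so p >= 1, as the comparison of W^p with W requires. *)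
have b1 : 1 <= 2 * m.+2%:R / (m.+2%:R + 4) :> R by rewrite ler_pdivlMr//; lra.
apply: (no_multiplier_bound chi_schwartz chi_radial chi_dyadic _ _ HC).
  by apply: ltW; apply: le_lt_trans hp; rewrite lee_fin.
(* At p = oo the reciprocal exponent is 0; for finite p, 2 n / p < n + 4 is the hypothesis on p
   rearranged. *)
case: p hp {HC} => [r|_|//]; last by rewrite mulr0.
rewrite lte_fin => hr /=; have r0 : 0 < r by apply: lt_trans hr; lra.
rewrite ltr_pdivrMr// in hr; rewrite ltr_pdivrMr//; lra.
Qed.
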